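(* Fix an integer $p\ge 2$, $\boldsymbol\theta\in\mathcal{S}^{p-1}$ and $f\in\mathcal{F}$. Let $(\kappa_n)$ be a positive real sequence that diverges to infinity. Then, under ${\rm P}^{(n)}_{\boldsymbol\theta,\kappa_n,f}$, $$\sqrt{n\kappa_n\varphi_f(\kappa_n)}\,(\hat{\boldsymbol\theta}_n-\boldsymbol\theta)\stackrel{\mathcal{D}}{\to}\mathcal{N}\big(\mathbf{0},\mathbf{I}_p-\boldsymbol\theta\boldsymbol\theta'\big)$$ as $n\to\infty$, so that, still under ${\rm P}^{(n)}_{\boldsymbol\theta,\kappa_n,f}$, $$n\kappa_n\varphi_f(\kappa_n)\big(1-(\boldsymbol\theta'\hat{\boldsymbol\theta}_n)^2\big)\stackrel{\mathcal{D}}{\to}\chi^2_{p-1}$$ as $n\to\infty$.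
   Context: $\mathcal{S}^{p-1}$ is the unit sphere of $\mathbb{R}^p$, a prime denotes transposition, and $\stackrel{\mathcal{D}}{\to}$ denotes convergence in distribution. For a function $f$, $\varphi_f:=f'/f$ wherever $f$ is differentiable. The class $\mathcal{F}$ is the collection of functions $f:\mathbb{R}\to\mathbb{R}^+$ that (i) are monotone non-decreasing on $(-\infty,0]$ and monotone increasing on $[0,\infty)$; (ii) are differentiable in a neighborhood of $\infty$ (i.e., over $(M,\infty)$ for some $M$); (iii) are such that $\kappa\varphi_f(\kappa)$ diverges to infinity as $\kappa\to\infty$ and $\kappa\mapsto\kappa\varphi_f(\kappa)$ is monotone non-decreasing over $(M,\infty)$ for some $M$; and (iv) satisfy, for any $\xi,\zeta>-1$, $$\int_{-1}^1(1-s)^\xi(1+s)^\zeta\,\big|e^{\log f(\kappa s)-\log f(\kappa)}-e^{(s-1)\kappa\varphi_f(\kappa)}\big|\,ds=o\bigg(\frac{1}{(\kappa\varphi_f(\kappa))^{\xi+1}}\bigg)\quad\text{as }\kappa\to\infty.$$ ${\rm P}^{(n)}_{\boldsymbol\theta,\kappa_n,f}$ is the hypothesis under which $\mathbf{X}_{n1},\ldots,\mathbf{X}_{nn}$ are mutually independent random vectors on $\mathcal{S}^{p-1}$ with common density, with respect to the surface area measure, $\mathbf{x}\mapsto\frac{c_{p,\kappa_n,f}\Gamma((p-1)/2)}{2\pi^{(p-1)/2}}f(\kappa_n\mathbf{x}'\boldsymbol\theta)$, where $c_{p,\kappa,f}:=1\big/\int_{-1}^1(1-s^2)^{(p-3)/2}f(\kappa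 s)\,ds$. The spherical mean is $\hat{\boldsymbol\theta}_n:=\bar{\mathbf{X}}_n/\|\bar{\mathbf{X}}_n\|$, with $\bar{\mathbf{X}}_n:=\frac1n\sum_{i=1}^n\mathbf{X}_{ni}$ (well defined almost surely). The quantity $\varphi_f(\kappa_n)$ is well defined for all $n$ large enough. *)

(* Defs.v *)
From HB Require Import structures.
From mathcomp Require Import all_boot all_order all_algebra.
From mathcomp Require Import all_classical all_reals all_analysis.
From mathcomp Require Import measurable_realfun.

Set Implicit Arguments.
Unset Strict Implicit.
Unset Printing Implicit Defensive.

Import Order.TTheory GRing.Theory Num.Theory.
Import numFieldNormedType.Exports.

Local Open Scope classical_set_scope.
Local Open Scope ring_scope.

Definition cV_display : measure_display.
Proof. by constructor. Qed.

(* The sigma-algebra generated by the coordinates, i.e. the Borel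
   sigma-algebra of R^n. *)
Section measurable_cV.
Context {R : realType} {n : nat}.

Let coors : 'I_n -> 'cV[R]_n -> R := fun i x => x i 0.

Let cV_set0 : g_sigma_preimage coors set0.
Proof. exact: sigma_algebra0. Qed.

Let cV_setC A : g_sigma_preimage coors A -> g_sigma_preimage coors (~` A).
Proof. exact: sigma_algebraC. Qed.

Let cV_bigcup (F : (set 'cV[R]_n)^nat) :
  (forall i, g_sigma_preimage coors (F i)) ->
  g_sigma_preimage coors (\bigcup_i (F i)).
Proof. exact: sigma_algebra_bigcup. Qed.

HB.instance Definition _ := @isMeasurable.Build cV_display
  'cV[R]_n (g_sigma_preimage coors) cV_set0 cV_setC cV_bigcup.

End measurable_cV.

#[short(type="measurableTopologicalType")]
HB.structure Definition MeasurableTopological d :=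
  {T of Topological T & Measurable d T}.

HB.instance Definition _ (R : realType) := Measurable.on R.
HB.instance Definition _ (R : realType) (n : nat) := Measurable.on 'cV[R]_n.

Section measurable_cV_lemmas.
Context {R : realType}.

Lemma measurable_coord n (i : 'I_n) :
  measurable_fun [set: 'cV[R]_n] (fun x => x i 0).
Proof.
move=> _ Y mY; rewrite setTI; apply: sub_sigma_algebra => /=.
rewrite -bigcup_seq/=; exists i => /=; first by rewrite mem_index_enum.
by exists Y => //; rewrite setTI.
Qed.

Lemma measurable_fun_cVP d (T : measurableType d) n (f : T -> 'cV[R]_n) :
  measurable_fun [set: T] f <->
  forall i, measurable_fun [set: T] (fun t => f t i 0).
Proof.
split=> [mf i|mf].
  exact: (measurableT_comp (measurable_coord i) mf).
have H : g_sigma_preimage (fun (i : 'I_n) t => f t i 0) `<=` measurable.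
  apply: smallest_sub; first exact: sigma_algebra_measurable.
  case: n => [|n] in f mf *; first by rewrite big_ord0.
  rewrite -bigcup_mkord_ord; apply: bigcup_sub => i Ii.
  by move=> A [B mB <-]; exact: mf.
move=> _ A mA; apply: H.
rewrite (g_sigma_preimage_comp (fun i (x : 'cV[R]_n) => x i 0) f).
by exists A.
Qed.

End measurable_cV_lemmas.

Section product_power.
Context {R : realType}.

Definition cV_cons n (xv : measurableTypeR R * 'cV[R]_n) : 'cV[R]_n.+1 :=
  \col_i (if unlift ord0 i is Some j then xv.2 j 0 else xv.1).

Lemma measurable_cV_cons n : measurable_fun setT (@cV_cons n).
Proof.
apply/measurable_fun_cVP => i; case: (unliftP ord0 i) => [j|] ->.
  rewrite (_ : (fun _ => _) = fun xv : measurableTypeR R * 'cV[R]_n => xv.2 j 0).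
    exact: (measurableT_comp (measurable_coord j) measurable_snd).
  by apply/funext => xv; rewrite mxE liftK.
rewrite (_ : (fun _ => _) = fst); first exact: measurable_fst.
by apply/funext => xv; rewrite mxE unlift_none.
Qed.

HB.instance Definition _ n :=
  @isMeasurableFun.Build _ _ _ _ (@cV_cons n) (@measurable_cV_cons n).

Definition cV_uncons n (x : 'cV[R]_n.+1) : measurableTypeR R * 'cV[R]_n :=
  (x ord0 0, \col_j x (lift ord0 j) 0).

Lemma measurable_cV_uncons n : measurable_fun setT (@cV_uncons n).
Proof.
apply: measurable_fun_pair; first exact: measurable_coord.
apply/measurable_fun_cVP => i.
rewrite (_ : (fun _ => _) = fun x : 'cV[R]_n.+1 => x (lift ord0 i) 0).
  exact: measurable_coord.
by apply/funext => x; rewrite mxE.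
Qed.

Lemma cV_consK n : cancel (@cV_cons n) (@cV_uncons n).
Proof.
move=> [x v]; rewrite /cV_uncons !mxE unlift_none; congr pair.
by apply/colP => j; rewrite !mxE liftK.
Qed.

Section cV_cons_measure.
Context {n : nat} (mu : {sigma_finite_measure set (measurableTypeR R) -> \bar R})
  (m : {sigma_finite_measure set 'cV[R]_n -> \bar R}).

Definition cV_cons_measure : set 'cV[R]_n.+1 -> \bar R :=
  pushforward (mu \x m)%E (@cV_cons n).

Let cons0 : cV_cons_measure set0 = 0%E.
Proof. exact: measure0. Qed.

Let cons_ge0 A : (0 <= cV_cons_measure A)%E.
Proof. exact: measure_ge0. Qed.

Let cons_sigma_additive : semi_sigma_additive cV_cons_measure.
Proof. exact: measure_semi_sigma_additive. Qed.

HB.instance Definition _ := isMeasure.Build _ _ _ cV_cons_measure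
  cons0 cons_ge0 cons_sigma_additive.

Let cons_sigma_finite : sigma_finite setT cV_cons_measure.
Proof.
have /sigma_finiteP[F [TF ndF Foo]] := sigma_finiteT mu.
have /sigma_finiteP[G [TG ndG Goo]] := sigma_finiteT m.
exists (fun k => @cV_uncons n @^-1` (F k `*` G k)).
  rewrite -preimage_bigcup (_ : \bigcup_k _ = setT) ?preimage_setT//.
  rewrite -subTset => -[x y] _.
  have [i _ Fix] : (\bigcup_k F k) x by rewrite -TF.
  have [j _ Gjy] : (\bigcup_k G k) y by rewrite -TG.
  exists (maxn i j) => //; split => /=.
    by move: x Fix; exact/subsetPset/ndF/leq_maxl.
  by move: y Gjy; exact/subsetPset/ndG/leq_maxr.
move=> k; have [mFk Fkoo] := Foo k; have [mGk Gkoo] := Goo k.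
have mFG : measurable (F k `*` G k) by exact: measurableX.
split; first by rewrite -[X in measurable X]setTI; exact: measurable_cV_uncons.
rewrite /cV_cons_measure /pushforward -comp_preimage.
rewrite (_ : _ \o _ = id) ?preimage_id; last first.
  by apply/funext => x /=; rewrite cV_consK.
by rewrite product_measure1E// lte_mul_pinfty// ge0_fin_numE.
Qed.

HB.instance Definition _ := Measure_isSigmaFinite.Build _ _ _ cV_cons_measure
  cons_sigma_finite.

End cV_cons_measure.

Fixpoint product_power (mu : {sigma_finite_measure set (measurableTypeR R) -> \bar R}) n
    : {sigma_finite_measure set 'cV[R]_n -> \bar R} :=
  match n with
  | 0 => dirac (0 : 'cV[R]_0)
  | n.+1 => cV_cons_measure mu (product_power mu n)
  end.

Lemma product_power_setT (P : probability (measurableTypeR R) R) n :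
  product_power P n setT = 1%E.
Proof.
elim: n => [|n IH] /=; first by rewrite diracT.
rewrite /cV_cons_measure /pushforward preimage_setT -setXTT.
by rewrite product_measure1E// IH mule1; exact: probability_setT.
Qed.

End product_power.

Section sphere.
Context {R : realType}.

Definition dotv {p} (x y : 'cV[R]_p) : R := (x^T *m y) 0 0.

Definition enorm {p} (x : 'cV[R]_p) : R := Num.sqrt (dotv x x).

Definition sphere {p} : set 'cV[R]_p := [set x | enorm x = 1].

Definition lebesgue_cV p : {sigma_finite_measure set 'cV[R]_p -> \bar R} :=
  product_power lebesgue_measure p.

(* The value at 0 is 0. *)
Definition normalize {p} (x : 'cV[R]_p) : 'cV[R]_p := (enorm x)^-1 *: x.

Lemma measurable_dotv p d (T : measurableType d) (f g : T -> 'cV[R]_p) :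
  measurable_fun setT f -> measurable_fun setT g ->
  measurable_fun setT (fun t => dotv (f t) (g t)).
Proof.
move=> /measurable_fun_cVP mf /measurable_fun_cVP mg.
rewrite (_ : (fun _ => _) = fun t => \sum_i f t i 0 * g t i 0).
  by apply: measurable_sum => i; exact: measurable_funM.
by apply/funext => t; rewrite /dotv mxE; under eq_bigr do rewrite mxE.
Qed.

Lemma measurable_enorm p : measurable_fun setT (@enorm p).
Proof.
apply: (@measurableT_comp _ _ _ _ _ _ (@Num.sqrt R)).
  by apply: continuous_measurable_fun; exact: sqrt_continuous.
by apply: measurable_dotv; exact: measurable_id.
Qed.

Lemma measurable_normalize p : measurable_fun setT (@normalize p).
Proof.
apply/measurable_fun_cVP => i.
rewrite (_ : (fun _ => _) = fun x : 'cV[R]_p => enorm x `^ (-1) * x i 0).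
  apply: measurable_funM; last exact: measurable_coord.
  apply: (@measurableT_comp _ _ _ _ _ _ (fun x : R => x `^ (-1))).
    exact: measurable_powR.
  exact: measurable_enorm.
by apply/funext => x; rewrite mxE powR_inv1// sqrtr_ge0.
Qed.

(* Surface area measure of the unit sphere of R^p, as a measure on R^p carried
   by the sphere: the area of A is p times the volume of the cone
   { r x | x in A, 0 < r <= 1 }, so that Lebesgue measure disintegrates as
   r^(p-1) dr dA in polar coordinates. *)
Section surface_measure.
Variable p : nat.

Definition surface_measure (A : set 'cV[R]_p) : \bar R :=
  (p%:R%:E *
   lebesgue_cV p [set x | (0 < enorm x <= 1)%R /\ A (normalize x)])%E.

Let D : set 'cV[R]_p := [set x | 0 < enorm x <= 1].

Let mD : measurable D.
Proof.
rewrite (_ : D = setT `&` @enorm p @^-1` [set` `]0, 1]]).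
  exact: measurable_enorm.
by apply/seteqP; split => x /=; rewrite in_itv/= => // -[].
Qed.

HB.instance Definition _ :=
  @isMeasurableFun.Build _ _ _ _ (@normalize p) (@measurable_normalize p).

Let surface_measureE : surface_measure =
  pushforward (mscale (NngNum (ler0n R p)) (mrestr (lebesgue_cV p) mD))
    (@normalize p).
Proof.
apply/funext => A; congr (_ * lebesgue_cV p _)%E.
by apply/seteqP; split => x [].
Qed.

Let surface0 : surface_measure set0 = 0%E.
Proof. by rewrite surface_measureE /pushforward preimage_set0 measure0. Qed.

Let surface_ge0 A : (0 <= surface_measure A)%E.
Proof. by rewrite surface_measureE; exact: measure_ge0. Qed.

Let surface_sigma_additive : semi_sigma_additive surface_measure.
Proof.
rewrite surface_measureE; apply: measure_semi_sigma_additive.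
exact: measurable_normalize.
Qed.

HB.instance Definition _ := isMeasure.Build _ _ _ surface_measure
  surface0 surface_ge0 surface_sigma_additive.

End surface_measure.
End sphere.

Definition cvg_in_distribution {R : realType} {d : nat -> measure_display}
    {Omega : forall n, measurableType (d n)}
    (P : forall n, probability (Omega n) R)
    {d'} {T : measurableTopologicalType d'}
    (Y : forall n, Omega n -> T) (mu : probability T R) : Prop :=
  forall g : T -> R, continuous g -> bounded_fun (g : T -> R^o) ->
    ('E_(P n)[g \o Y n])%E @[n --> \oo] --> ('E_mu[g])%E.

Section gaussian.
Context {R : realType}.

Definition std_normal_cV n : set 'cV[R]_n -> \bar R :=
  product_power (normal_prob 0 1) n.
Arguments std_normal_cV n : clear implicits.

HB.instance Definition _ n := Measure.on (std_normal_cV n).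

HB.instance Definition _ n := Measure_isProbability.Build _ _ _
  (std_normal_cV n) (product_power_setT (normal_prob 0 1) n).

Definition affine_cV {n} (m : 'cV[R]_n) (A : 'M[R]_n) (z : 'cV[R]_n) :=
  m + A *m z.

Lemma measurable_affine_cV n (m : 'cV[R]_n) A :
  measurable_fun setT (affine_cV m A).
Proof.
apply/measurable_fun_cVP => i.
rewrite (_ : (fun _ => _) =
    fun z : 'cV[R]_n => m i 0 + \sum_j A i j * z j 0).
  apply: measurable_funD => //; apply: measurable_sum => j.
  by apply: measurable_funM => //; exact: measurable_coord.
by apply/funext => z; rewrite !mxE.
Qed.

HB.instance Definition _ n (m : 'cV[R]_n) A :=
  @isMeasurableFun.Build _ _ _ _ (affine_cV m A) (measurable_affine_cV m A).

(* N(m, Sigma): the law of m + A Z with Z standard normal and A A' = Sigma. It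
   does not depend on the choice of A; such an A exists iff Sigma is symmetric
   positive semidefinite, and any other Sigma is treated as 0. *)
Definition normal_cV {n} (m : 'cV[R]_n) (Sigma : 'M[R]_n)
    : probability 'cV[R]_n R :=
  distribution (std_normal_cV n)
    (affine_cV m (xget 0 [set A : 'M[R]_n | A *m A^T = Sigma])).

Definition sqnorm {n} (z : 'cV[R]_n) : R := dotv z z.

Lemma measurable_sqnorm n : measurable_fun setT (@sqnorm n).
Proof. by apply: measurable_dotv; exact: measurable_id. Qed.

HB.instance Definition _ n :=
  @isMeasurableFun.Build _ _ _ _ (@sqnorm n) (@measurable_sqnorm n).

Definition chi2 (k : nat) : probability R R :=
  distribution (std_normal_cV k) (@sqnorm k).

End gaussian.

Section rotationally_symmetric.
Context {R : realType}.

Definition varphi (f : R -> R) (x : R) : R := f^`()%classic x / f x.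

(* In the last condition log 0 = -oo and e^(-oo) = 0, as f may vanish on
   ]-oo, 0]. *)
Record classF (f : R -> R) : Prop := ClassF {
  classF_ge0 : forall x, 0 <= f x ;
  classF_nondecreasing : {in `]-oo, 0] &, {homo f : x y / x <= y}} ;
  classF_increasing : {in `[0, +oo[ &, {homo f : x y / x < y}} ;
  classF_derivable : exists M, forall x, M < x -> derivable f x 1 ;
  classF_cvgy : k * varphi f k @[k --> +oo] --> +oo ;
  classF_varphi_nondecreasing : exists M,
    {in `]M, +oo[ &, {homo (fun k => k * varphi f k) : x y / x <= y}} ;
  classF_littleo : forall xi zeta : R, -1 < xi -> -1 < zeta ->
    forall eps : R, 0 < eps -> \forall k \near +oo,
      (\int[lebesgue_measure]_(s in `[(-1)%R, 1%R])
         (((1 - s) `^ xi * (1 + s) `^ zeta)%:E *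
          `| expeR (lne (f (k * s)%R)%:E - lne (f k)%:E)
             - (expR ((s - 1) * (k * varphi f k)))%:E |)
       <= (eps * (1 / (k * varphi f k) `^ (xi + 1)))%:E)%E }.

Definition Gamma_fun (a : R) : R :=
  \int[lebesgue_measure]_(t in `]0, +oo[) (t `^ (a - 1) * expR (- t)).

Definition norm_const (p : nat) (k : R) (f : R -> R) : R :=
  (\int[lebesgue_measure]_(s in `[-1, 1])
     ((1 - s ^+ 2) `^ ((p%:R - 3) / 2) * f (k * s)))^-1.

Definition rotsym_density (p : nat) (theta : 'cV[R]_p) (k : R) (f : R -> R)
    (x : 'cV[R]_p) : R :=
  norm_const p k f * Gamma_fun ((p%:R - 1) / 2) /
    (2 * pi `^ ((p%:R - 1) / 2)) * f (k * dotv x theta).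

Definition mutually_independent {d} {Omega : measurableType d}
    (P : probability Omega R) {d'} {T : measurableType d'} {n}
    (X : 'I_n -> {RV P >-> T}) : Prop :=
  forall (J : {set 'I_n}) (A : 'I_n -> set T), (forall i, measurable (A i)) ->
    P [set w | forall i, i \in J -> A i (X i w)] =
    (\prod_(i in J) P (X i @^-1` A i))%E.

Record rotsym_sample {p : nat} (theta : 'cV[R]_p) (k : R) (f : R -> R)
    {d} {Omega : measurableType d} (P : probability Omega R) {n}
    (X : 'I_n -> {RV P >-> 'cV[R]_p}) : Prop := RotsymSample {
  sample_sphere : forall i w, sphere (X i w) ;
  sample_independent : mutually_independent X ;
  sample_density : forall i (A : set 'cV[R]_p), measurable A ->
    distribution P (X i) A =
    (\int[@surface_measure R p]_(x in A) (rotsym_density theta k f x)%:E)%E }.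

Definition spherical_mean {p n : nat} {Omega : Type}
    (X : 'I_n -> Omega -> 'cV[R]_p) (w : Omega) : 'cV[R]_p :=
  normalize (n%:R^-1 *: \sum_i X i w).

End rotationally_symmetric.

(* Main.v *)
From HB Require Import structures.
Require Import Defs.
From mathcomp Require Import all_boot all_order all_algebra.
From mathcomp Require Import all_classical all_reals all_analysis.
From mathcomp Require Import measurable_realfun.
From mathcomp Require Import ring lra.

Set Implicit Arguments.
Unset Strict Implicit.
Unset Printing Implicit Defensive.

Import Order.TTheory GRing.Theory Num.Theory.
Import numFieldNormedType.Exports.

Local Open Scope classical_set_scope.
Local Open Scope ring_scope.

(* Write u = theta' X for one observation, lam = kappa varphi_f(kappa).  Reflections
   fixing theta preserve the law of X, so the tangential part of X is symmetric
   and has covariance E(1 - u^2)/(p - 1) (I - theta theta'); slicing the unit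
   ball along theta shows that u has density proportional to
   (1 - s^2)^((p-3)/2) f(kappa s).  Condition (iv) allows replacing
   f(kappa s)/f(kappa) by exp(lam (s - 1)), and integrating by parts against
   that weight yields lam E(1 - u^2) -> p - 1, while lam E(1 - u) and
   lam^2 E(1 - u^2)^2 remain bounded.  Hence the characteristic function of
   sqrt(n lam) (I - theta theta') Xbar, the n-th power of a function equal to
   1 - |t|^2 / (2 n) + o(1/n), converges to that of N(0, I - theta theta').
   Since moreover theta' Xbar -> 1 in probability, normalizing Xbar changes
   this vector by o_P(1), and 1 - (theta' hat theta)^2 is, up to a factor
   tending to 1, the squared norm of the tangential part of Xbar. *)

(** The concentrations vary with n, so the observations form a triangular array and every limit
    comes from explicit bounds. The fourth-order remainder of the cosine, summed over the sample, is
    at most a constant times lam^2 E(1 - u^2)^2 / n; this is why a bound on that moment suffices.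

    Characteristic functions are handled as E cos(t'S + c) for every phase c. This carries the
    cosine and sine transforms at once, and it factorizes over independent symmetric summands
    without complex numbers.

    Surface measure is given by volumes of cones, so sphere integrals are ball integrals of
    functions constant on rays, and rotational symmetry reduces to the orthogonal invariance of a
    product Lebesgue measure. The constants in the law of u are fixed by total mass one.

    With a = (p - 3)/2, condition (iv) at exponent a + n has error o(lam^-(a+n+1)), while the total
    weight is at least of order lam^-(a+1). The mean of a function vanishing to order n at s = 1 is
    therefore known up to o(lam^-n), the precision that each moment requires. *)

Section density.
Local Open Scope ereal_scope.
Import HBNNSimple.
Context d (T : measurableType d) (R : realType).

(** Monotone convergence along simple approximations of [g] reduces the identity to level sets,
    where it is the hypothesis [nuE]. The law of an observation is given only in that form, through
    its values on measurable sets. *)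
Lemma ge0_integral_density (mu nu : {measure set T -> \bar R}) (h : T -> R)
    (mh : measurable_fun setT h) (h0 : forall x, (0 <= h x)%R)
    (nuE : forall A, measurable A -> nu A = \int[mu]_(x in A) (h x)%:E)
    (g : T -> \bar R) (mg : measurable_fun setT g) (g0 : forall x, 0 <= g x) :
  \int[nu]_x g x = \int[mu]_x (g x * (h x)%:E).
Proof.
pose g_ := nnsfun_approx measurableT mg.
have gE x : g x = limn (EFin \o g_ ^~ x).
  by apply/esym/cvg_lim => //; exact: cvg_nnsfun_approx.
have ndg x : {homo (fun n => (g_ n x)%:E) : m n / (m <= n)%N >-> m <= n}.
  by move=> m n mn; rewrite lee_fin; exact/lefP/nd_nnsfun_approx.
have -> : \int[nu]_x g x = limn (fun n => \int[nu]_x (g_ n x)%:E).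
  rewrite -monotone_convergence//.
  - by apply: eq_integral => x _; rewrite gE.
  - by move=> n; exact/measurable_EFinP/measurable_funP.
  - by move=> n x _; rewrite lee_fin.
have -> : \int[mu]_x (g x * (h x)%:E) = limn (fun n => \int[mu]_x ((g_ n x)%:E * (h x)%:E)).
  rewrite -monotone_convergence//.
  - apply: eq_integral => x _; apply/esym/cvg_lim => //.
    by apply: cvgeZr => //; exact: cvg_nnsfun_approx.
  - move=> n; apply: emeasurable_funM; exact/measurable_EFinP.
  - by move=> n x _; rewrite mule_ge0// lee_fin.
  - by move=> x _ m n mn; rewrite lee_wpmul2r ?lee_fin//; exact: ndg.
congr (limn _); apply/funext => n.
transitivity (\int[nu]_x
   (\sum_(y \in range (g_ n)) (y * \1_(g_ n @^-1` [set y]) x)%:E)).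
  by apply: eq_integral => t _; rewrite fimfunE -fsumEFin.
have indich r : measurable_fun setT (fun x => (r * \1_(g_ n @^-1` [set r]) x)%:E).
  exact/measurable_EFinP/measurable_funM.
rewrite ge0_integral_fsum//; last by move=> m y Ey; exact: nnfun_muleindic_ge0.
transitivity (\int[mu]_x (\sum_(y \in range (g_ n))
    (y * \1_(g_ n @^-1` [set y]) x)%:E * (h x)%:E)); last first.
  apply: eq_integral => x _.
  rewrite -ge0_mule_fsuml => [|y]; last exact: nnfun_muleindic_ge0.
  by rewrite fsumEFin// -(fimfunE _ x).
rewrite ge0_integral_fsum//; last 2 first.
  - by move=> y; apply: emeasurable_funM => //; exact/measurable_EFinP.
  - by move=> m y _; rewrite mule_ge0// ?lee_fin//; exact: nnfun_muleindic_ge0.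
apply: eq_fsbigr => r _.
rewrite integralZl_indic_nnsfun//.
under [RHS]eq_integral do rewrite EFinM -muleA.
(* The approximating functions are nonnegative, so a negative level has an empty preimage and both
   sides vanish. *)
have [r0|r0] := leP 0%R r; last first.
  rewrite preimage_nnfun0// integral_indic// setIT measure0 mule0.
  by rewrite integral0_eq// => x _; rewrite indic0 mul0e mule0.
rewrite ge0_integralZl//.
- congr (_ * _); rewrite integral_indic// setIT nuE//.
  rewrite integral_mkcond; apply: eq_integral => x _.
  by rewrite epatch_indic muleC.
- by apply: emeasurable_funM; exact/measurable_EFinP.
- by move=> x _; rewrite mule_ge0// lee_fin.
Qed.

End density.

(** * Lebesgue measure on R^n *)

Section cV_measurable.
Context {R : realType}.

Lemma measurable_mulmx m n (A : 'M[R]_(m, n)) :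
  measurable_fun setT (fun x : 'cV[R]_n => A *m x).
Proof.
apply/measurable_fun_cVP => i.
rewrite (_ : (fun _ => _) = fun z : 'cV[R]_n => \sum_j A i j * z j 0).
  apply: measurable_sum => j.
  by apply: measurable_funM => //; exact: measurable_coord.
by apply/funext => z; rewrite !mxE.
Qed.

Lemma measurable_addcV d (T : measurableType d) n (f g : T -> 'cV[R]_n) :
  measurable_fun setT f -> measurable_fun setT g ->
  measurable_fun setT (fun x => f x + g x).
Proof.
move=> /measurable_fun_cVP mf /measurable_fun_cVP mg.
apply/measurable_fun_cVP => i; under eq_fun do rewrite mxE.
exact: measurable_funD.
Qed.

Lemma measurable_scalecV d (T : measurableType d) n (a : T -> R) (f : T -> 'cV[R]_n) :
  measurable_fun setT a -> measurable_fun setT f ->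
  measurable_fun setT (fun x => a x *: f x).
Proof.
move=> ma /measurable_fun_cVP mf.
apply/measurable_fun_cVP => i; under eq_fun do rewrite mxE.
exact: measurable_funM.
Qed.

Lemma measurable_sumcV d (T : measurableType d) n (I : Type) (s : seq I)
    (f : I -> T -> 'cV[R]_n) :
  (forall i, measurable_fun setT (f i)) ->
  measurable_fun setT (fun x => \sum_(i <- s) f i x).
Proof.
move=> mf; apply/measurable_fun_cVP => i.
under eq_fun do rewrite summxE.
by apply: measurable_sum => k; move: (mf k) => /measurable_fun_cVP.
Qed.

End cV_measurable.

Section product_power_integral.
Context {R : realType}.
Local Open Scope ereal_scope.
Local Notation mR := (measurableTypeR R).
Variable mu : {sigma_finite_measure set mR -> \bar R}.

Lemma measurable_cV_consl n (a : mR) :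
  measurable_fun setT (fun y : 'cV[R]_n => cV_cons (a, y)).
Proof. exact: (measurableT_comp (@measurable_cV_cons R n) (measurable_pair1 a)). Qed.

Lemma ge0_integral_product_powerS n (g : 'cV[R]_n.+1 -> \bar R) :
  measurable_fun setT g -> (forall x, 0 <= g x) ->
  \int[product_power mu n.+1]_x g x =
  \int[mu]_a \int[product_power mu n]_y g (cV_cons (a, y)).
Proof.
move=> mg g0.
rewrite (@ge0_integral_pushforward _ _ _ _ _ (@cV_cons R n) (@measurable_cV_cons R n) _ setT)//.
rewrite preimage_setT fubini_tonelli1//=.
by apply: measurableT_comp => //; exact: measurable_cV_cons.
Qed.

(** Slicing the ball substitutes in the first coordinate with the others frozen, so that coordinate
    must be the inner variable. *)
Lemma ge0_integral_product_powerS_swap n (g : 'cV[R]_n.+1 -> \bar R) :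
  measurable_fun setT g -> (forall x, 0 <= g x) ->
  \int[product_power mu n.+1]_x g x =
  \int[product_power mu n]_y \int[mu]_a g (cV_cons (a, y)).
Proof.
move=> mg g0; rewrite ge0_integral_product_powerS//.
rewrite (fubini_tonelli (fun z => g (cV_cons z)))//.
by apply: measurableT_comp => //; exact: measurable_cV_cons.
Qed.

Lemma measurable_integral_cV_cons n (g : 'cV[R]_n.+1 -> \bar R) :
  measurable_fun setT g -> (forall x, 0 <= g x) ->
  measurable_fun setT (fun a : mR => \int[product_power mu n]_y g (cV_cons (a, y))).
Proof.
move=> mg g0.
apply: (measurable_fun_fubini_tonelli_F (fun z => g (cV_cons z))) => //.
by apply: measurableT_comp => //; exact: measurable_cV_cons.
Qed.

Lemma cV_cons_eta n (x : 'cV[R]_n.+1) : cV_cons (cV_uncons x) = x.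
Proof.
apply/colP => i; rewrite !mxE; case: (unliftP ord0 i) => [j|] -> /=.
  by rewrite mxE.
by [].
Qed.

Lemma cV_consD n (a b : R) (x y : 'cV[R]_n) :
  (cV_cons (a, x) + cV_cons (b, y) = cV_cons (a + b, x + y) :> 'cV[R]_n.+1)%R.
Proof.
by apply/colP => i; rewrite !mxE; case: (unliftP ord0 i) => [j|] _ /=; rewrite ?mxE.
Qed.

Lemma cV_consZ n (r a : R) (x : 'cV[R]_n) :
  (r *: cV_cons (a, x) = cV_cons (r * a, r *: x) :> 'cV[R]_n.+1)%R.
Proof.
by apply/colP => i; rewrite !mxE; case: (unliftP ord0 i) => [j|] _ /=; rewrite ?mxE.
Qed.

End product_power_integral.

Section lebesgue_affine.
Context {R : realType}.
Local Open Scope ereal_scope.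
Local Notation mR := (measurableTypeR R).
Local Notation leb := (@lebesgue_measure R).

(** The image of Lebesgue measure under a translation has the same values on half-open intervals,
    and these determine the measure. Scaling is treated in the same way. *)
Lemma ge0_integral_shift (a : R) (g : R -> \bar R) :
  measurable_fun setT g -> (forall x, 0 <= g x) ->
  \int[leb]_x g (x + a)%R = \int[leb]_x g x.
Proof.
move=> mg g0; pose phi (x : mR) : mR := (x + a)%R.
have mphi : measurable_fun setT phi by exact: measurable_funD.
rewrite -(@ge0_integral_pushforward _ _ _ _ _ phi mphi leb setT g)//.
apply: eq_measure_integral => A mA _; apply/esym/lebesgue_measure_unique => //.
move=> _ [[x y]/= ? <-]; rewrite /pushforward.
rewrite (_ : phi @^-1` _ = `](x - a)%R, (y - a)%R]%classic); last first.
  by apply/seteqP; split => z /=; rewrite !in_itv/= /phi ltrBlDr lerBrDr.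
by rewrite !lebesgue_measure_itv/= !lte_fin ltrD2r -!EFinB opprB addrA subrK.
Qed.

Lemma ge0_integral_scale (r : R) (g : R -> \bar R) : (0 < r)%R ->
  measurable_fun setT g -> (forall x, 0 <= g x) ->
  \int[leb]_x g x = r%:E * \int[leb]_x g (r * x)%R.
Proof.
move=> r0 mg g0; pose phi (x : mR) : mR := (r * x)%R.
have mphi : measurable_fun setT phi by exact: measurable_funM.
rewrite -(@ge0_integral_pushforward _ _ _ _ _ phi mphi leb setT g)//.
rewrite -(@ge0_integral_mscale _ _ _ _ _ _ (NngNum (ltW r0)))//.
apply: eq_measure_integral => A mA _; apply/lebesgue_measure_unique => //.
move=> _ [[x y]/= ? <-]; rewrite /mscale/= /pushforward.
rewrite (_ : phi @^-1` _ = `](r^-1 * x)%R, (r^-1 * y)%R]%classic); last first.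
  apply/seteqP; split => z /=; rewrite !in_itv/= /phi.
    by rewrite ltr_pdivrMl// ler_pdivlMl.
  by rewrite ltr_pdivrMl// ler_pdivlMl.
rewrite !lebesgue_measure_itv/= !lte_fin ltr_pM2l ?invr_gt0//.
case: ifPn => _; last by rewrite mule0.
by rewrite -!EFinB -EFinM -mulrBr mulVKf// gt_eqF.
Qed.

Lemma ge0_integral_lebesgue_cV_shift n (v : 'cV[R]_n) (g : 'cV[R]_n -> \bar R) :
  measurable_fun setT g -> (forall x, 0 <= g x) ->
  \int[lebesgue_cV n]_x g (x + v)%R = \int[lebesgue_cV n]_x g x.
Proof.
elim: n v g => [v g mg g0|n IH v g mg g0].
  by apply: eq_integral => x _; congr g; apply/colP => -[].
have mgv : measurable_fun setT (fun x : 'cV[R]_n.+1 => g (x + v)%R).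
  by apply: measurableT_comp => //; apply: measurable_addcV.
rewrite (ge0_integral_product_powerS leb mg g0).
rewrite (ge0_integral_product_powerS leb mgv (fun x => g0 _)).
rewrite -(cV_cons_eta v); case: (cV_uncons v) => b w.
transitivity (\int[leb]_a
    \int[product_power leb n]_y g (cV_cons ((a + b)%R, y))).
  apply: eq_integral => a _; rewrite -[RHS](IH w)//.
    by apply: eq_integral => y _; rewrite cV_consD.
  by apply: measurableT_comp => //; exact: measurable_cV_consl.
rewrite (ge0_integral_shift b (g := fun a =>
  \int[product_power leb n]_y g (cV_cons (a, y))))//.
  exact: measurable_integral_cV_cons.
by move=> a; exact: integral_ge0.
Qed.

Lemma ge0_integral_lebesgue_cV_scale n (r : R) (g : 'cV[R]_n -> \bar R) :
  (0 < r)%R -> measurable_fun setT g -> (forall x, 0 <= g x) ->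
  \int[lebesgue_cV n]_x g x = (r ^+ n)%:E * \int[lebesgue_cV n]_x g (r *: x)%R.
Proof.
move=> r0; elim: n g => [g mg g0|n IH g mg g0].
  by rewrite mul1e; apply: eq_integral => x _; congr g; apply/colP => -[].
have mgv : measurable_fun setT (fun x : 'cV[R]_n.+1 => g (r *: x)%R).
  by apply: measurableT_comp => //; apply: measurable_scalecV.
rewrite (ge0_integral_product_powerS leb mg g0).
rewrite (ge0_integral_product_powerS leb mgv (fun x => g0 _)).
rewrite (ge0_integral_scale r0); last 2 first.
  - exact: measurable_integral_cV_cons.
  - by move=> a; exact: integral_ge0.
rewrite exprS EFinM -muleA; congr (_ * _).
rewrite -ge0_integralZl//; last 3 first.
  - exact: (measurable_integral_cV_cons _ mgv).
  - by move=> a _; exact: integral_ge0.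
  - by rewrite lee_fin exprn_ge0// ltW.
apply: eq_integral => a _; rewrite IH//; last first.
  by apply: measurableT_comp => //; exact: measurable_cV_consl.
by congr (_ * _); apply: eq_integral => y _; rewrite cV_consZ.
Qed.

End lebesgue_affine.

Section dotv.
Context {R : realType}.

Lemma dotvE n (x y : 'cV[R]_n) : dotv x y = \sum_i x i 0 * y i 0.
Proof. by rewrite /dotv mxE; apply: eq_bigr => i _; rewrite mxE. Qed.

Lemma dotvC n (x y : 'cV[R]_n) : dotv x y = dotv y x.
Proof. by rewrite !dotvE; apply: eq_bigr => i _; rewrite mulrC. Qed.

Lemma dotvDl n (x y z : 'cV[R]_n) : dotv (x + y) z = dotv x z + dotv y z.
Proof. by rewrite /dotv linearD mulmxDl mxE. Qed.

Lemma dotvZl n a (x y : 'cV[R]_n) : dotv (a *: x) y = a * dotv x y.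
Proof. by rewrite /dotv linearZ -scalemxAl mxE. Qed.

Lemma dotvNl n (x y : 'cV[R]_n) : dotv (- x) y = - dotv x y.
Proof. by rewrite -scaleN1r dotvZl mulN1r. Qed.

Lemma dotvBl n (x y z : 'cV[R]_n) : dotv (x - y) z = dotv x z - dotv y z.
Proof. by rewrite dotvDl dotvNl. Qed.

Lemma dotvDr n (x y z : 'cV[R]_n) : dotv x (y + z) = dotv x y + dotv x z.
Proof. by rewrite !(dotvC x) dotvDl. Qed.

Lemma dotvZr n a (x y : 'cV[R]_n) : dotv x (a *: y) = a * dotv x y.
Proof. by rewrite !(dotvC x) dotvZl. Qed.

Lemma dotvBr n (x y z : 'cV[R]_n) : dotv x (y - z) = dotv x y - dotv x z.
Proof. by rewrite !(dotvC x) dotvBl. Qed.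

Lemma dotv_mulmxl m n (A : 'M[R]_(m, n)) (x : 'cV[R]_n) (y : 'cV[R]_m) :
  dotv (A *m x) y = dotv x (A^T *m y).
Proof. by rewrite /dotv trmx_mul mulmxA. Qed.

Lemma dotv_mulmxr m n (A : 'M[R]_(m, n)) (x : 'cV[R]_n) (y : 'cV[R]_m) :
  dotv y (A *m x) = dotv (A^T *m y) x.
Proof. by rewrite dotvC dotv_mulmxl dotvC. Qed.

Lemma dotv_sumr n (I : Type) (s : seq I) (P : pred I) (F : I -> 'cV[R]_n) x :
  dotv x (\sum_(i <- s | P i) F i) = \sum_(i <- s | P i) dotv x (F i).
Proof.
apply: (big_morph (dotv x) (dotvDr x)).
by rewrite -(scale0r x) dotvZr mul0r.
Qed.

Lemma dotvv_ge0 n (x : 'cV[R]_n) : 0 <= dotv x x.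
Proof. by rewrite dotvE sumr_ge0// => i _; rewrite -expr2 sqr_ge0. Qed.

Lemma dotvv_eq0 n (x : 'cV[R]_n) : (dotv x x == 0) = (x == 0).
Proof.
apply/eqP/eqP => [|->]; last by rewrite -(scale0r (0 : 'cV[R]_n)) dotvZl mul0r.
move=> /eqP; rewrite dotvE psumr_eq0; last by move=> i _; rewrite -expr2 sqr_ge0.
move=> /allP x0; apply/colP => i; rewrite mxE.
by have := x0 i (mem_index_enum i); rewrite /= mulf_eq0 orbb => /eqP.
Qed.

Lemma enorm_ge0 n (x : 'cV[R]_n) : 0 <= enorm x.
Proof. exact: sqrtr_ge0. Qed.

Lemma enorm_sqr n (x : 'cV[R]_n) : enorm x ^+ 2 = dotv x x.
Proof. by rewrite sqr_sqrtr// dotvv_ge0. Qed.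

Lemma enormZ n a (x : 'cV[R]_n) : enorm (a *: x) = `|a| * enorm x.
Proof. by rewrite /enorm dotvZl dotvZr mulrA -expr2 sqrtrM ?sqr_ge0// sqrtr_sqr. Qed.

Lemma enorm_eq0 n (x : 'cV[R]_n) : (enorm x == 0) = (x == 0).
Proof. by rewrite -dotvv_eq0 -enorm_sqr expf_eq0. Qed.

Lemma ler_abs_enorm n (x : 'cV[R]_n) i : `|x i 0| <= enorm x.
Proof.
rewrite -sqrtr_sqr ler_sqrt; last exact: dotvv_ge0.
rewrite dotvE (bigD1 i)//= -expr2 lerDl sumr_ge0// => j _.
by rewrite -expr2 sqr_ge0.
Qed.

Lemma dotv_CS n (x y : 'cV[R]_n) : dotv x y ^+ 2 <= dotv x x * dotv y y.
Proof.
have [->|y0] := eqVneq y 0.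
  by rewrite -(scale0r (0 : 'cV[R]_n)) !dotvZr !mul0r mulr0 expr0n.
have yy : 0 < dotv y y by rewrite lt_neqAle eq_sym dotvv_eq0 y0 dotvv_ge0.
have := dotvv_ge0 (dotv y y *: x - dotv x y *: y).
rewrite !(dotvBl, dotvBr, dotvZl, dotvZr) (dotvC y x).
set a := dotv x x; set b := dotv x y; set c := dotv y y.
rewrite (_ : _ - _ = c * (a * c - b ^+ 2)); last by ring.
by rewrite pmulr_rge0// subr_ge0.
Qed.

Lemma mulmx_orth_dotv n (A : 'M[R]_n) : A^T *m A = 1%:M ->
  forall x y : 'cV[R]_n, dotv (A *m x) (A *m y) = dotv x y.
Proof. by move=> AA x y; rewrite dotv_mulmxl mulmxA AA mul1mx. Qed.

End dotv.

Section lebesgue_orth.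
Context {R : realType}.
Local Open Scope ereal_scope.
Local Notation leb n := (@lebesgue_cV R n).

Let cube n (a b : R) : set 'cV[R]_n := [set x | forall i, a <= x i 0%R <= b]%R.
Arguments cube : clear implicits.

Let cubeS n (a b : R) : cube n.+1 a b = @cV_uncons R n @^-1` (`[a, b] `*` cube n a b).
Proof.
apply/seteqP; split => x /=.
  move=> cx; split; first by rewrite /= in_itv/=; exact: cx.
  by move=> i /=; rewrite mxE; exact: cx.
rewrite in_itv/= => -[x0 xS] i; case: (unliftP ord0 i) => [j|] ->//.
by have := xS j; rewrite mxE.
Qed.

Let measurable_cube n (a b : R) : measurable (cube n a b).
Proof.
rewrite (_ : cube n a b = \bigcap_(i in [set: 'I_n]) ((fun x : 'cV[R]_n => x i 0%R) @^-1` `[a, b])).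
  apply: fin_bigcap_measurable => // i _.
  by rewrite -[X in measurable X]setTI; exact: measurable_coord.
apply/seteqP; split => x /= cx i; first by move=> _ /=; rewrite in_itv/=; exact: cx.
by have := cx i I; rewrite /= in_itv.
Qed.

Lemma lebesgue_cV_cube n (a b : R) : (a <= b)%R ->
  leb n (cube n a b) = ((b - a) ^+ n)%:E.
Proof.
move=> ab; elim: n => [|n IH].
  by rewrite /= diracE mem_set// => -[].
rewrite /= /cV_cons_measure /pushforward cubeS -comp_preimage.
rewrite (_ : _ \o _ = id) ?preimage_id; last first.
  by apply/funext => x /=; rewrite cV_consK.
rewrite product_measure1E//; last exact: measurable_cube.
transitivity (lebesgue_measure `[a, b] * leb n (cube n a b)) => //.
rewrite IH lebesgue_measure_itv/= lte_fin.
have [_|] := ltP a b; first by rewrite -EFinB -EFinM exprS.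
move=> ba; have -> : a = b by apply/eqP; rewrite eq_le ab ba.
by rewrite subrr mul0e expr0n.
Qed.

Let uball n : set 'cV[R]_n := [set x | dotv x x <= 1]%R.
Arguments uball : clear implicits.

Lemma measurable_dotv_le n (r : R) : measurable [set x : 'cV[R]_n | dotv x x <= r]%R.
Proof.
rewrite (_ : [set _ | _] = setT `&` (fun x : 'cV[R]_n => dotv x x) @^-1` [set` `]-oo, r]]).
  by apply: measurable_dotv => //; exact: measurable_id.
by apply/seteqP; split => x /=; rewrite in_itv/= => // -[].
Qed.

(** Finiteness and positivity of the volume of the ball allow it to be cancelled in the proof of
    orthogonal invariance. *)
Lemma lebesgue_cV_uball_fin n : leb n (uball n) < +oo.
Proof.
apply: (@le_lt_trans _ _ (leb n (cube n (-1) 1))); last by rewrite lebesgue_cV_cube ?ltry//; lra.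
apply: le_measure; rewrite ?inE.
- exact: measurable_dotv_le.
- exact: measurable_cube.
move=> x /= xx i; rewrite -ler_norml.
by rewrite (le_trans (ler_abs_enorm _ _))// -(@expr_le1 _ 2) ?enorm_ge0// enorm_sqr.
Qed.

(** The cube [0, 1/(n+1)]^n lies in the ball because x_i^2 <= x_i <= 1/(n+1). Taking n+1 instead of
    n keeps the side meaningful for n = 0. *)
Lemma lebesgue_cV_uball_gt0 n : 0 < leb n (uball n).
Proof.
apply: (@lt_le_trans _ _ (leb n (cube n 0 (n.+1%:R^-1)))).
  by rewrite lebesgue_cV_cube ?lte_fin ?exprn_gt0// ?subr0 ?invr_gt0// invr_ge0.
apply: le_measure; rewrite ?inE.
- exact: measurable_cube.
- exact: measurable_dotv_le.
move=> x /= xc; rewrite /uball/= dotvE.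
apply: (@le_trans _ _ (\sum_(i < n) n.+1%:R^-1)%R).
  apply: ler_sum => i _; have /andP[x0 x1] := xc i.
  apply: (@le_trans _ _ (1 * x i 0%R)%R); last by rewrite mul1r.
  by rewrite ler_wpM2r// (le_trans x1)// invf_le1// ler1n.
rewrite sumr_const card_ord -[leLHS]mulr_natl ler_pdivrMr// mul1r ler_nat.
exact: leqnSn.
Qed.

(* The unit ball B is invariant under A, so integrating
   1_B(x) g(A x + y) over (x, y) in either order, with translation invariance,
   gives vol(B) * \int g and vol(B) * \int g(A x). *)
Lemma ge0_integral_lebesgue_cV_orth n (A : 'M[R]_n) (g : 'cV[R]_n -> \bar R) :
  A^T *m A = 1%:M -> measurable_fun setT g -> (forall x, 0 <= g x) ->
  \int[leb n]_x g (A *m x) = \int[leb n]_x g x.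
Proof.
move=> AA mg g0.
have AA' : A *m A^T = 1%:M by apply: mulmx1C.
pose b (x : 'cV[R]_n) : \bar R := (\1_(uball n) x)%:E.
(* The isometry [A] sends x - A'y to Ax - y, so both sides test the same norm. *)
have bE (x y : 'cV[R]_n) : b (x - A^T *m y)%R = b (y - A *m x)%R.
  rewrite /b !indicE; congr ((nat_of_bool _)%:R%:E).
  have D : dotv (x - A^T *m y) (x - A^T *m y) = dotv (y - A *m x) (y - A *m x).
    rewrite -(mulmx_orth_dotv AA (x - _)%R) mulmxBr mulmxA AA' mul1mx.
    by rewrite -opprB dotvNl dotvC dotvNl opprK.
  by apply/idP/idP; rewrite !inE /uball/= D.
have mb : measurable_fun setT b.
  by apply/measurable_EFinP/measurable_indic; exact: measurable_dotv_le.
have b0 x : 0 <= b x by rewrite lee_fin.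
have mgA : measurable_fun setT (fun x : 'cV[R]_n => g (A *m x)).
  exact: (measurableT_comp mg (measurable_mulmx A)).
pose h (z : 'cV[R]_n * 'cV[R]_n) : \bar R := b z.1 * g (A *m z.1 + z.2)%R.
have mh : measurable_fun setT h.
  apply: emeasurable_funM; first exact: (measurableT_comp mb).
  apply: (measurableT_comp mg); apply: measurable_addcV => //.
  exact: (measurableT_comp (measurable_mulmx A)).
have h0 z : 0 <= h z by rewrite mule_ge0.
have mg2 x : measurable_fun setT (fun y : 'cV[R]_n => g (A *m x + y)%R).
  by apply: (measurableT_comp mg); apply: measurable_addcV.
have V : leb n (uball n) = \int[leb n]_x b x.
  by rewrite integral_indic ?setIT//; exact: measurable_dotv_le.
have E1 : \int[leb n]_x \int[leb n]_y h (x, y) = leb n (uball n) * \int[leb n]_x g x.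
  rewrite V -ge0_integralZr//; last by exact: integral_ge0.
  apply: eq_integral => x _; rewrite /h/= ge0_integralZl//.
  congr (_ * _); under eq_integral do rewrite addrC.
  exact: ge0_integral_lebesgue_cV_shift.
have E2 : \int[leb n]_y \int[leb n]_x h (x, y) = leb n (uball n) * \int[leb n]_x g (A *m x).
  (* Translating x by A'y turns g(Ax + y) into g(Ax) and leaves y in the ball factor alone;
     integrating over y then produces the volume. *)
  transitivity (\int[leb n]_y \int[leb n]_x (b (x - A^T *m y)%R * g (A *m x))).
    apply: eq_integral => y _.
    rewrite -[RHS](ge0_integral_lebesgue_cV_shift (A^T *m y)).
    - apply: eq_integral => x _; rewrite /h/= addrK mulmxDr mulmxA AA' mul1mx.
      by rewrite addrC.
    - apply: emeasurable_funM => //.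
      by apply: (measurableT_comp mb); apply: measurable_addcV.
    - by move=> x; rewrite mule_ge0.
  rewrite -(fubini_tonelli (fun z : 'cV[R]_n * 'cV[R]_n => b (z.1 - A^T *m z.2)%R * g (A *m z.1)))//=; last 2 first.
    - apply: emeasurable_funM; last exact: (measurableT_comp mgA).
      apply: (measurableT_comp mb); apply: measurable_addcV => //.
      under eq_fun do rewrite -mulNmx.
      exact: (measurableT_comp (measurable_mulmx _)).
    - by move=> z; rewrite mule_ge0.
  rewrite -ge0_integralZl//.
  apply: eq_integral => x _; rewrite ge0_integralZr//; last first.
    apply: (measurableT_comp mb); apply: measurable_addcV => //.
    under eq_fun do rewrite -mulNmx.
    exact: measurable_mulmx.
  congr (_ * _).
  rewrite V -(ge0_integral_lebesgue_cV_shift (- (A *m x))%R mb b0).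
  by apply: eq_integral => y _; rewrite bE.
rewrite fubini_tonelli// E2 in E1.
have vfin : leb n (uball n) \is a fin_num.
  by rewrite ge0_fin_numE//; exact: lebesgue_cV_uball_fin.
have v0 : (0 < fine (leb n (uball n)))%R.
  by rewrite fine_gt0// lebesgue_cV_uball_gt0 lebesgue_cV_uball_fin.
move: E1; rewrite -(fineK vfin); set v := fine _ in v0 *.
move=> /(congr1 (fun z => (v^-1)%:E * z)).
by rewrite !muleA -EFinM mulVf ?gt_eqF// !mul1e.
Qed.

End lebesgue_orth.

(** * Cosine transforms and the continuity theorem *)

Section bounded_integrals.
Context d (T : measurableType d) (R : realType).

Lemma integrable_le_bound (mu : {finite_measure set T -> \bar R}) (f : T -> R) (M : R) :
  measurable_fun setT f -> (forall x, `|f x| <= M) ->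
  mu.-integrable setT (EFin \o f).
Proof.
move=> mf fM; apply: measurable_bounded_integrable => //.
  by rewrite -ge0_fin_numE//; exact: fin_num_measure.
by exists M; split; [exact: num_real|move=> y My x _; rewrite /= (le_trans (fM x))// ltW].
Qed.

Lemma EFin_Rintegral (mu : {measure set T -> \bar R}) D (f : T -> R) :
  measurable D -> mu.-integrable D (EFin \o f) ->
  (\int[mu]_(x in D) f x)%:E = (\int[mu]_(x in D) (f x)%:E)%E.
Proof. by move=> mD fi; rewrite fineK//; exact: integrable_fin_num. Qed.

Lemma Rintegral_prob_cst (P : probability T R) (c : R) : \int[P]_x c = c.
Proof. rewrite /Rintegral integral_cst//.
rewrite [X in (_ * X)%E]probability_setT.
 by rewrite mule1. Qed.

Lemma le_Rintegral_prob (P : probability T R) (f g : T -> R) :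
  P.-integrable setT (EFin \o f) -> P.-integrable setT (EFin \o g) ->
  (forall x, f x <= g x) -> \int[P]_x f x <= \int[P]_x g x.
Proof. by move=> fi gi fg; apply: le_Rintegral. Qed.

Lemma Rintegral_prob_le (P : probability T R) (f : T -> R) (c : R) :
  P.-integrable setT (EFin \o f) ->
  (forall x, f x <= c) -> \int[P]_x f x <= c.
Proof.
move=> fi fc; rewrite -[leRHS](Rintegral_prob_cst P).
by apply: le_Rintegral_prob => //; exact: finite_measure_integrable_cst.
Qed.

Lemma Rdominated_cvg (mu : {measure set T -> \bar R}) (f_ : nat -> T -> R)
    (f g : T -> R) :
  (forall n, measurable_fun setT (f_ n)) -> measurable_fun setT f ->
  (forall x, f_ n x @[n --> \oo] --> f x) ->
  mu.-integrable setT (EFin \o g) -> (forall n x, `|f_ n x| <= g x) ->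
  \int[mu]_x f_ n x @[n --> \oo] --> \int[mu]_x f x.
Proof.
move=> mf_ mf f_f gi fg.
have mEf : measurable_fun setT (EFin \o f) by exact/measurable_EFinP.
have mEf_ n : measurable_fun setT (EFin \o f_ n) by exact/measurable_EFinP.
have cE : {ae mu, forall x, setT x -> (EFin \o f_ n) x @[n --> \oo] --> (EFin \o f) x}.
  by apply: aeW => x _; apply: cvg_EFin; [exact: nearW|exact: f_f].
have bE : {ae mu, forall x n, setT x -> (`|(EFin \o f_ n) x| <= (EFin \o g) x)%E}.
  by apply: aeW => x n _; rewrite lee_fin.
have [fi _ c] := dominated_convergence measurableT mEf_ mEf cE gi bE.
apply: fine_cvg; rewrite fineK; first exact: c.
exact: integrable_fin_num.
Qed.

End bounded_integrals.

Section cos_products.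
Context {R : realType}.

Lemma measurable_cos : measurable_fun [set: R] (@cos R).
Proof. by apply: continuous_measurable_fun; exact: continuous_cos. Qed.

Lemma integrable_cos d (T : measurableType d) (P : probability T R) (a : T -> R) c :
  measurable_fun setT a -> P.-integrable setT (EFin \o (fun x => cos (a x + c))).
Proof.
move=> ma; apply: (integrable_le_bound _ (M := 1)) => [|x]; last exact: cos_max.
by apply: (measurableT_comp measurable_cos); exact: measurable_funD.
Qed.

(** The last component supplies the measurability of the averaged functions (bump expectations,
    mollified functions) that are integrated again later. *)
Lemma Rfubini_prob d1 d2 (T1 : measurableType d1) (T2 : measurableType d2)
    (P : probability T1 R) (Q : probability T2 R) (f : T1 * T2 -> R) (M : R) :
  measurable_fun setT f -> (forall z, `|f z| <= M) ->
  \int[(P \x Q)%E]_z f z = \int[P]_x \int[Q]_y f (x, y) /\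
  \int[(P \x Q)%E]_z f z = \int[Q]_y \int[P]_x f (x, y) /\
  measurable_fun setT (fun y => \int[P]_x f (x, y)).
Proof.
move=> mf fM.
have fi : (P \x Q)%E.-integrable setT (EFin \o f).
  apply: measurable_bounded_integrable => //.
    rewrite -[X in ((P \x Q) X < _)%E]setXTT product_measure1E//.
    by rewrite [X in (X * _)%E]probability_setT [X in (_ * X)%E]probability_setT mule1 ltry.
  by exists M; split; [exact: num_real|move=> y My x _; rewrite /= (le_trans (fM x))// ltW].
split; [|split].
- rewrite {1}/Rintegral -integral12_prod_meas1//; congr fine.
  apply: eq_integral => x _; rewrite /fubini_F/= EFin_Rintegral//.
  by apply: (integrable_le_bound _ (M := M)) => //; exact: measurableT_comp.
- rewrite {1}/Rintegral -integral21_prod_meas1//; congr fine.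
  apply: eq_integral => x _; rewrite /fubini_G/= EFin_Rintegral//.
  by apply: (integrable_le_bound _ (M := M)) => //; exact: measurableT_comp.
- have mG : measurable_fun setT (fubini_G P (EFin \o f)) by exact: measurable_fubini_G fi.
  exact: (measurableT_comp _ mG).
Qed.

(* The phase [c] ranges over all reals, so the hypothesis says at once that
   [b] has cosine transform [phi] and vanishing sine transform. *)
Lemma Rintegral_prod_cos d1 d2 (T1 : measurableType d1) (T2 : measurableType d2)
    (P : probability T1 R) (Q : probability T2 R) (a : T1 -> R) (b : T2 -> R) phi :
  measurable_fun setT a -> measurable_fun setT b ->
  (forall c, \int[Q]_y cos (b y + c) = cos c * phi) ->
  forall c, \int[(P \x Q)%E]_z cos (a z.1 + b z.2 + c) =
            (\int[P]_x cos (a x + c)) * phi.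
Proof.
move=> ma mb bphi c.
have mab : measurable_fun setT (fun z : T1 * T2 => cos (a z.1 + b z.2 + c)).
  apply: (measurableT_comp measurable_cos); apply: measurable_funD => //.
  by apply: measurable_funD; [exact: (measurableT_comp ma)|exact: (measurableT_comp mb)].
have [-> _] := Rfubini_prob P Q mab (fun z => cos_max _).
transitivity (\int[P]_x (cos (a x + c) * phi)).
  apply: eq_Rintegral => x _ /=; rewrite -bphi.
  by apply: eq_Rintegral => y _; congr cos; ring.
by rewrite RintegralZr//; exact: integrable_cos.
Qed.

End cos_products.

(** * Sums of independent random vectors *)

Section independent_sum.
Context {R : realType} {d} {Omega : measurableType d} (P : probability Omega R).
Context {d'} {T : measurableType d'}.

(** Factorization on rectangles identifies the joint law of (S, X) with the product of its
    marginals, where [Rintegral_prod_cos] applies. *)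
Lemma independent_cos (S : {RV P >-> measurableTypeR R}) (X : {RV P >-> T}) (a : T -> R) phi :
  measurable_fun setT a ->
  (forall A B, measurable A -> measurable B ->
    P (S @^-1` A `&` X @^-1` B) = (P (S @^-1` A) * P (X @^-1` B))%E) ->
  (forall c, \int[P]_w cos (a (X w) + c) = cos c * phi) ->
  forall c, \int[P]_w cos (S w + a (X w) + c) = (\int[P]_w cos (S w + c)) * phi.
Proof.
move=> ma SX aphi c.
pose SXp w := (S w, X w).
have mSX : measurable_fun setT SXp by exact: measurable_fun_pair.
have SXE C : measurable C ->
    (distribution P S \x distribution P X)%E C = pushforward P SXp C.
  apply: product_measure_unique => A B mA mB.
  by rewrite -SX.
pose F (z : measurableTypeR R * T) := cos (z.1 + a z.2 + c).
have mF : measurable_fun setT F.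
  apply: (measurableT_comp measurable_cos); apply: measurable_funD => //.
  by apply: measurable_funD => //; exact: (measurableT_comp ma).
have pushE d0 (T0 : measurableType d0) (Y : {RV P >-> T0}) (f : T0 -> R) : measurable_fun setT f ->
    (forall x, `|f x| <= 1) -> \int[distribution P Y]_x f x = \int[P]_w f (Y w).
  move=> mf f1; rewrite /Rintegral integral_distribution//.
    exact/measurable_EFinP.
  by apply: (integrable_le_bound _ (M := 1)) => //; exact: (measurableT_comp mf).
have mid : measurable_fun setT (fun x : measurableTypeR R => x) by [].
have <- : \int[distribution P S]_s cos (s + c) = \int[P]_w cos (S w + c).
  apply: pushE => [|x]; last exact: cos_max.
  by apply: (measurableT_comp measurable_cos); exact: measurable_funD.
rewrite -(@Rintegral_prod_cos _ _ _ _ _ (distribution P S) (distribution P X) _ _ _ mid ma); last first.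
  move=> b; rewrite -aphi; apply: (pushE _ _ X (fun y => cos (a y + b))) => [|x]; last exact: cos_max.
  by apply: (measurableT_comp measurable_cos); exact: measurable_funD.
rewrite /Rintegral; congr fine.
transitivity (\int[pushforward P SXp]_z (F z)%:E)%E; last first.
  apply: eq_measure_integral => C mC _; exact/esym/SXE.
rewrite (integral_pushforward mSX)//; first exact/measurable_EFinP.
apply: (integrable_le_bound _ (M := 1)) => [|w]; last exact: cos_max.
exact: (measurableT_comp mF mSX).
Qed.

Let rest n (X : 'I_n -> {RV P >-> T}) k (A : 'I_n -> set T) :=
  [set w | forall i : 'I_n, (k <= i)%N -> A i (X i w)].

(* Induction on k: the law of the k-th partial sum together with the events on
   the remaining variables factorizes. *)
Lemma independent_rest n (X : 'I_n -> {RV P >-> T}) (a : T -> R) :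
  measurable_fun setT a -> mutually_independent X ->
  forall k, (k <= n)%N ->
  forall (B : set (measurableTypeR R)) (A : 'I_n -> set T),
  measurable B -> (forall i, measurable (A i)) ->
  P ([set w | B (\sum_(i < n | (i < k)%N) a (X i w))%R] `&` rest X k A) =
  (P [set w | B (\sum_(i < n | (i < k)%N) a (X i w))%R] *
   \prod_(i < n | (k <= i)%N) P (X i @^-1` A i))%E.
Proof.
move=> ma Xind; elim=> [|k IH] kn B A mB mA.
  have S0 w : \sum_(i < n | (i < 0)%N) a (X i w) = 0 by rewrite big1.
  have PE : P (rest X 0 A) = (\prod_(i < n | (0 <= i)%N) P (X i @^-1` A i))%E.
    have := Xind [set: 'I_n]%SET A mA; rewrite (eq_bigl (fun i : 'I_n => (0 <= i)%N)); last first.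
      by move=> i; rewrite inE.
    move=> <-; congr (P _); apply/seteqP; split => w /= Aw i _; by apply: Aw; rewrite ?inE.
  under [in LHS]eq_set do rewrite S0.
  under [in RHS]eq_set do rewrite S0.
  rewrite -PE; have [B0|B0] := pselect (B 0).
    rewrite (_ : [set w : Omega | B 0] = setT) ?setTI ?probability_setT ?mul1e//.
    by apply/seteqP; split.
  rewrite (_ : [set w : Omega | B 0] = set0) ?set0I ?measure0 ?mul0e//.
  by apply/seteqP; split.
pose K : 'I_n := Ordinal kn.
pose S w := \sum_(i < n | (i < k)%N) a (X i w).
have SS w : \sum_(i < n | (i < k.+1)%N) a (X i w) = S w + a (X K w).
  rewrite (bigD1 K)//= addrC; congr (_ + _); apply: eq_bigl => i.
  by rewrite ltnS -val_eqE/= ltn_neqAle andbC.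
have mS : measurable_fun setT S.
  rewrite /S; under eq_fun do rewrite big_mkcond/=.
  by apply: measurable_sum => i; case: (i < k)%N => //; exact: (measurableT_comp ma).
pose SX w : measurableTypeR R * T := (S w, X K w).
have mSX : measurable_fun setT SX by exact: measurable_fun_pair.
have restS (A0 : 'I_n -> set T) : rest X k A0 = X K @^-1` A0 K `&` rest X k.+1 A0.
  apply/seteqP; split => w /=.
    by move=> Aw; split; [exact: Aw|move=> i ki; apply: Aw; exact: ltnW].
  move=> [AK Aw] i; rewrite leq_eqVlt => /orP[/eqP ki|/Aw//].
  by rewrite (_ : i = K)//; apply: val_inj.
have mrest : measurable (rest X k.+1 A).
  rewrite (_ : rest X k.+1 A = \bigcap_(i in [set i : 'I_n | (k < i)%N]) (X i @^-1` A i)).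
    by apply: fin_bigcap_measurable => // i _; rewrite -[X in measurable X]setTI; exact: measurable_funP.
  by apply/seteqP; split.
have prodS (A0 : 'I_n -> set T) : (\prod_(i < n | (k <= i)%N) P (X i @^-1` A0 i) =
    P (X K @^-1` A0 K) * \prod_(i < n | (k < i)%N) P (X i @^-1` A0 i))%E.
  rewrite (bigD1 K)//=; congr (_ * _)%E; apply: eq_bigl => i.
  by rewrite -val_eqE/= ltn_neqAle eq_sym andbC.
pose r := (\prod_(i < n | (k < i)%N) P (X i @^-1` A i))%E.
have r0 : (0 <= r)%E by rewrite /r prode_ge0.
have rfin : r \is a fin_num.
  apply: prode_fin_num => i _; apply: fin_num_measure.
  by rewrite -[X in measurable X]setTI; exact: measurable_funP.
(* The new event concerns S + a(X_K), which is not a rectangle in (S, X_K). So two finite measures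
   are compared on the generating pi-system of rectangles: the joint law restricted to the later
   events ([m1]), and the joint law scaled by their probability ([m2]). *)
pose C0 : set (set (measurableTypeR R * T)) :=
  [set C | exists B0 A0, [/\ measurable B0, measurable A0 & C = B0 `*` A0]].
pose m1 := pushforward (mrestr P mrest) SX.
pose m2 := pushforward (mscale (NngNum (fine_ge0 r0)) P) SX.
have key C : measurable C -> m1 C = m2 C.
  apply: (measure_unique C0 (fun=> setT)) => //.
  - rewrite measurable_prod_measurableType; congr (<<s _ >>).
    apply/seteqP; split => D /=.
      by move=> [B0 mB0 [A0 mA0 <-]]; exists B0, A0.
    by move=> [B0 [A0 [mB0 mA0 ->]]]; exists B0 => //; exists A0.
  - move=> _ _ [B0 [A0 [mB0 mA0 ->]]] [B1 [A1 [mB1 mA1 ->]]].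
    exists (B0 `&` B1), (A0 `&` A1); split; [exact: measurableI..|].
    by rewrite setXI.
  - by move=> _; exists setT, setT; split => //; rewrite setXTT.
  - by apply/seteqP; split => // x _; exists 0.
  - move=> _ [B0 [A0 [mB0 mA0 ->]]].
    (* The induction hypothesis is used twice: with the later events kept ([A1]) and with them made
       trivial ([A2]). Comparing the two isolates the factor [r]. *)
    pose A1 i := if i == K then A0 else A i.
    have mA1 i : measurable (A1 i) by rewrite /A1; case: ifP.
    pose A2 i := if i == K then A0 else setT.
    have mA2 i : measurable (A2 i) by rewrite /A2; case: ifP.
    have A1E : rest X k A1 = X K @^-1` A0 `&` rest X k.+1 A.
      rewrite restS /A1 eqxx; congr (_ `&` _); apply/seteqP; split => w /= Aw i ki;
      by have := Aw i ki; case: eqP => // iK; move: ki; rewrite iK/= ltnn.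
    have A2E : rest X k A2 = X K @^-1` A0.
      rewrite restS /A2 eqxx; apply/seteqP; split => w /=; first by case.
      by move=> ?; split => // i ki; case: eqP => // iK; move: ki; rewrite iK/= ltnn.
    have := IH (ltnW kn) B0 A1 mB0 mA1; rewrite A1E.
    have := IH (ltnW kn) B0 A2 mB0 mA2; rewrite A2E.
    rewrite !prodS /A1 /A2 eqxx.
    rewrite [X in (_ * (_ * X))%E]big1 ?mule1; last first.
      move=> i ki; rewrite ifF; last by apply/negP => /eqP iK; move: ki; rewrite iK/= ltnn.
      by rewrite preimage_setT probability_setT.
    rewrite [X in _ = (_ * (_ * X))%E](_ : _ = r); last first.
      apply: eq_bigr => i ki; rewrite ifF//.
      by apply/negP => /eqP iK; move: ki; rewrite iK/= ltnn.
    move=> E2 E1.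
    change (m1 (B0 `*` A0) = m2 (B0 `*` A0)).
    rewrite /m1 /m2 /pushforward /mrestr /mscale/= fineK//.
    transitivity (P ([set w | B0 (S w)] `&` (X K @^-1` A0 `&` rest X k.+1 A))).
      by congr (P _); rewrite setIA.
    by rewrite E1 muleA -E2 muleC.
  - move=> _; rewrite (le_lt_trans (y := 1%E)) ?ltry//.
    change (P (SX @^-1` setT `&` rest X k.+1 A) <= 1)%E.
    by rewrite preimage_setT setTI; exact: probability_le1.
under [in LHS]eq_set do rewrite SS.
under [in RHS]eq_set do rewrite SS.
pose C : set (measurableTypeR R * T) := [set z | B (z.1 + a z.2)].
have mC : measurable C.
  have mf : measurable_fun setT (fun z : measurableTypeR R * T => z.1 + a z.2).
    by apply: measurable_funD => //; exact: (measurableT_comp ma).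
  by have := mf measurableT B mB; rewrite setTI.
have := key C mC; rewrite /m1 /m2 /pushforward /mrestr /mscale/= fineK//.
by rewrite muleC.
Qed.

(** With the phase left free, each new summand can be absorbed into it; it contributes the factor
    phi because its sine transform vanishes. *)
Lemma independent_sum_cos n (X : 'I_n -> {RV P >-> T}) (a : T -> R) phi :
  measurable_fun setT a -> mutually_independent X ->
  (forall i c, \int[P]_w cos (a (X i w) + c) = cos c * phi) ->
  forall c, \int[P]_w cos (\sum_i a (X i w) + c) = cos c * phi ^+ n.
Proof.
move=> ma Xind Xphi c.
suff H k : (k <= n)%N ->
    \int[P]_w cos (\sum_(i < n | (i < k)%N) a (X i w) + c) = cos c * phi ^+ k.
  rewrite -H//; apply: eq_Rintegral => w _; congr (cos (_ + _)).
  by apply: eq_bigl => i; rewrite ltn_ord.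
elim: k => [_|k IH kn].
  rewrite expr0 mulr1 -[RHS](Rintegral_prob_cst P); apply: eq_Rintegral => w _.
  by rewrite big1 ?add0r.
pose K : 'I_n := Ordinal kn.
pose S w : measurableTypeR R := \sum_(i < n | (i < k)%N) a (X i w).
have mS : measurable_fun setT S.
  rewrite /S; under eq_fun do rewrite big_mkcond/=.
  by apply: measurable_sum => i; case: (i < k)%N => //; exact: (measurableT_comp ma).
pose Srv : {RV P >-> measurableTypeR R} :=
  HB.pack S (isMeasurableFun.Build _ _ _ _ S mS).
have rect B A0 : measurable B -> measurable A0 ->
    P (Srv @^-1` B `&` X K @^-1` A0) = (P (Srv @^-1` B) * P (X K @^-1` A0))%E.
  move=> mB mA0.
  (* Events that are trivial except at K specialize the joint factorization to independence of the
     partial sum and X_K. *)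
  pose A i := if i == K then A0 else setT.
  have mA i : measurable (A i) by rewrite /A; case: ifP.
  have := independent_rest ma Xind (ltnW kn) mB mA.
  rewrite (bigD1 K)//= big1 ?mule1; last first.
    by move=> i /andP[_ /negPf iK]; rewrite /A iK preimage_setT probability_setT.
  rewrite /A eqxx => <-; congr (P (_ `&` _)); apply/seteqP; split => w /=.
    by move=> Aw i _; case: eqP => // ->.
  by move=> /(_ K (leqnn _)); rewrite eqxx.
transitivity (\int[P]_w cos (Srv w + a (X K w) + c)); last first.
  rewrite (@independent_cos Srv (X K) a phi ma rect (Xphi K)) exprSr mulrA.
  by rewrite -(IH (ltnW kn)).
apply: eq_Rintegral => w _; congr (cos (_ + _)).
rewrite (bigD1 K)//= addrC; congr (_ + _); apply: eq_bigl => i.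
by rewrite ltnS -val_eqE/= ltn_neqAle andbC.
Qed.

End independent_sum.

Section integral_density.
Context d (T : measurableType d) (R : realType).

Lemma integral_density (mu nu : {measure set T -> \bar R}) (h : T -> R)
    (mh : measurable_fun setT h) (h0 : forall x, 0 <= h x)
    (nuE : forall A, measurable A -> nu A = (\int[mu]_(x in A) (h x)%:E)%E)
    (g : T -> R) (mg : measurable_fun setT g) :
  \int[nu]_x g x = \int[mu]_x (g x * h x).
Proof.
have mEg : measurable_fun setT (EFin \o g) by exact/measurable_EFinP.
rewrite /Rintegral integralE [in RHS]integralE; congr (fine (_ - _)).
- rewrite (ge0_integral_density mh h0 nuE)//; last exact: measurable_funepos.
  by apply: eq_integral => x _; rewrite !funeposE /= maxe_pMl ?lee_fin// mul0e.
- rewrite (ge0_integral_density mh h0 nuE)//; last exact: measurable_funeneg.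
  apply: eq_integral => x _; rewrite !funenegE /=.
  by rewrite -mulNr EFinM maxe_pMl ?lee_fin// mul0e.
Qed.

Lemma integrable_density (mu nu : {measure set T -> \bar R}) (h : T -> R)
    (mh : measurable_fun setT h) (h0 : forall x, 0 <= h x)
    (nuE : forall A, measurable A -> nu A = (\int[mu]_(x in A) (h x)%:E)%E)
    (g : T -> R) (mg : measurable_fun setT g) :
  mu.-integrable setT (EFin \o (fun x => g x * h x)) <-> nu.-integrable setT (EFin \o g).
Proof.
have mEg : measurable_fun setT (EFin \o g) by exact/measurable_EFinP.
have mEgh : measurable_fun setT (EFin \o (fun x => g x * h x)).
  by apply/measurable_EFinP; exact: measurable_funM.
have E : (\int[nu]_x `|(EFin \o g) x| = \int[mu]_x `|(EFin \o (fun x => g x * h x)%R) x|)%E.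
  rewrite (ge0_integral_density mh h0 nuE)//; last exact: measurableT_comp.
  by apply: eq_integral => x _; rewrite /= normrM (ger0_norm (h0 x)).
by split=> /integrableP[_ fi]; apply/integrableP; split => //; rewrite ?E// -E.
Qed.

End integral_density.

Section exhaustion.
Context d (T : measurableType d) (R : realType) (mu : {measure set T -> \bar R}).

(** Brings improper integrals back to compact intervals, where the fundamental theorem of calculus
    applies; used on the whole line and on ]-1, 1[, where integrands may blow up at the ends. *)
Lemma cvg_Rintegral_exhaustion (D : set T) (I_ : nat -> set T) (f : T -> R) :
  measurable D -> (forall n, measurable (I_ n)) -> (forall n, I_ n `<=` D) ->
  (forall x, D x -> \forall n \near \oo, I_ n x) ->
  mu.-integrable D (EFin \o f) ->
  \int[mu]_(x in I_ n) f x @[n --> \oo] --> \int[mu]_(x in D) f x.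
Proof.
move=> mD mI ID DI fi.
have mf := measurable_int _ fi.
have fE n : \int[mu]_(x in I_ n) f x = \int[mu]_(x in D) ((f \_ (I_ n)) x).
  by rewrite -Rintegral_mkcondr; congr Rintegral; apply/esym/setIidPr/ID.
under eq_fun do rewrite fE.
have mE n : measurable_fun D (EFin \o (f \_ (I_ n))).
  have : measurable_fun (D `&` I_ n) (EFin \o f) by apply: measurable_funS mf.
  by rewrite -restrict_EFin; move=> /(measurable_restrict _ (mI n) mD).
have cE : {ae mu, forall x, D x -> (EFin \o (f \_ (I_ n))) x @[n --> \oo] --> (EFin \o f) x}.
  apply: aeW => x Dx; apply: cvg_near_cst.
  by apply: filterS (DI x Dx) => n Inx /=; rewrite patchE mem_set.
have bE : {ae mu, forall x n, D x -> (`|(EFin \o (f \_ (I_ n))) x| <= (`|f x|%R)%:E)%E}.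
  apply: aeW => x n _; rewrite /= lee_fin patchE; case: ifP => // _.
  by rewrite normr0.
have gi : mu.-integrable D (EFin \o (fun x => `|f x|)) by exact: integrable_norm.
have [_ _ c] := dominated_convergence mD mE mf cE gi bE.
apply: fine_cvg; rewrite fineK; first exact: c.
exact: integrable_fin_num.
Qed.

End exhaustion.

(** * Gaussian integrals *)

Section real_line.
Context {R : realType}.
Local Notation leb := (@lebesgue_measure R).

Lemma FTC_line (H h : R -> R) :
  (forall x : R, is_derive x (1:R) H (h x)) -> continuous h ->
  leb.-integrable setT (EFin \o h) ->
  H n%:R @[n --> \oo] --> 0 -> H (- n%:R) @[n --> \oo] --> 0 ->
  \int[leb]_x h x = 0.
Proof.
move=> dH ch hi Hp Hn.
(* The successor keeps the interval nondegenerate at n = 0. *)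
pose I_ n : set R := `[- n.+1%:R, n.+1%:R]%classic.
have cI : \int[leb]_(x in I_ n) h x @[n --> \oo] --> \int[leb]_x h x.
  apply: cvg_Rintegral_exhaustion => //; first by move=> n; exact: measurable_itv.
  move=> x _.
  near=> n; rewrite /I_/= in_itv/= -ler_norml.
  near: n; exists (Num.truncn `|x|) => // n /= xn.
  by rewrite (le_trans (ltW (truncnS_gt _)))// ler_nat ltnS.
have E n : \int[leb]_(x in I_ n) h x = H n.+1%:R - H (- n.+1%:R).
  have n0 : (0 : R) < n.+1%:R by [].
  rewrite /Rintegral (@continuous_FTC2 _ h H)//.
  - by rewrite (lt_trans _ n0)// oppr_lt0.
  - exact: continuous_subspaceT.
  - have cH x : {for x, continuous H}.
      by apply: differentiable_continuous; apply/derivable1_diffP; exact: ex_derive.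
    split; [by move=> x _; exact: ex_derive| |].
    + by apply: cvg_at_right_filter; exact: cH.
    + by apply: cvg_at_left_filter; exact: cH.
  - by move=> x _; rewrite derive1E; exact: derive_val.
rewrite -(cvg_lim _ cI)//; apply: cvg_lim => //.
under eq_fun do rewrite E.
rewrite -(subr0 (0:R)); apply: cvgB.
  by have := Hp; rewrite -(cvg_shiftS (fun n => H n%:R)).
by have := Hn; rewrite -(cvg_shiftS (fun n => H (- n%:R))).
Unshelve. all: end_near. Qed.

End real_line.

Lemma cvg0_le (R : realType) (u v : nat -> R) :
  (forall n, `|u n| <= v n) -> v n @[n --> \oo] --> 0 -> u n @[n --> \oo] --> 0.
Proof.
move=> uv v0; have v0' : - v n @[n --> \oo] --> 0 by rewrite -oppr0; exact: cvgN.
apply: (squeeze_cvgr _ v0' v0).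
by near=> n; rewrite -ler_norml.
Unshelve. all: end_near. Qed.

Section gaussian_cf.
Context {R : realType}.
Local Notation leb := (@lebesgue_measure R).
Local Notation N01 := (normal_prob (0:R) 1).
Local Notation w := (normal_pdf (0:R) 1).

Lemma std_normal_pdfE (x : R) : w x = normal_peak 1 * expR (- (x ^+ 2 / 2)).
Proof.
by rewrite normal_pdfE ?oner_eq0// /normal_fun subr0 expr1n mulNr.
Qed.

Lemma is_derive_std_normal_pdf (x : R) : is_derive x (1:R) w (- (x * w x)).
Proof.
have -> : w = (fun x => normal_peak 1 * expR (- (x ^+ 2 / 2))).
  by apply/funext => y; rewrite std_normal_pdfE.
apply: is_derive_eq.
by rewrite /GRing.scale/=; field.
Qed.

(** |x| exp(-x^2/2) <= exp(-x^2/8), because exp(3x^2/8) >= 1 + 3x^2/8 >= |x|; the right side is a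
    multiple of the normal density with standard deviation 2. *)
Lemma integrable_abs_std_normal : N01.-integrable setT (EFin \o (fun x : R => `|x|)).
Proof.
have w0 : forall x : R, 0 <= w x by move=> x; exact: normal_pdf_ge0.
apply/(@integrable_density _ _ _ leb N01 w) => //.
- exact: measurable_normal_pdf.
- exact: normr_measurable.
have i2 := integrable_normal_pdf (0:R) 2.
pose C : R := normal_peak 1 / normal_peak 2.
have : leb.-integrable setT (fun x => C%:E * (normal_pdf 0 2 x)%:E)%E.
  exact: integrableZl.
apply: le_integrable => //.
  apply/measurable_EFinP; apply: measurable_funM => //.
  exact: measurable_normal_pdf.
move=> x _ /=; rewrite lee_fin normrM normr_id (ger0_norm (w0 x)) [leRHS]ger0_norm; last first.
  by apply: mulr_ge0; [apply: divr_ge0; exact: normal_peak_ge0|exact: normal_pdf_ge0].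
have -> : normal_pdf 0 2 x = normal_peak 2 * normal_fun 0 2 x by rewrite normal_pdfE.
rewrite [normal_pdf 0 1 x]std_normal_pdfE /C [leRHS]mulrA divfK ?gt_eqF ?normal_peak_gt0//.
rewrite mulrCA ler_wpM2l ?normal_peak_ge0// /normal_fun subr0.
rewrite (_ : - x ^+ 2 / (2 ^+ 2 *+ 2) = x ^+ 2 / 8 * 3 - x ^+ 2 / 2); last by field.
rewrite expRD ler_wpM2r ?expR_ge0//.
apply: (@le_trans _ _ (1 + x ^+ 2 / 8 * 3)); last exact: expR_ge1Dx.
(* 3x^2/8 - |x| is minimal at |x| = 4/3, with value -2/3 > -1. *)
have : 0 <= (`|x| - 4 / 3) ^+ 2 by exact: sqr_ge0.
by rewrite -(real_normK (num_real x)) sqrrB; lra.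
Qed.

Lemma cvg_std_normal_pdf : w n%:R @[n --> \oo] --> 0.
Proof.
have c0 : normal_peak 1 * 2 * harmonic n @[n --> \oo] --> (0:R).
  by rewrite -[X in _ --> X](mulr0 (normal_peak 1 * 2)); apply: cvgMr; exact: cvg_harmonic.
apply: (squeeze_cvgr _ (cvg_cst 0) c0).
near=> n; apply/andP; split; first exact: normal_pdf_ge0.
  rewrite std_normal_pdfE -mulrA ler_wpM2l ?normal_peak_ge0// expRN /harmonic /=.
  rewrite -[2 in leRHS]invrK -invfM lef_pV2 ?posrE ?expR_gt0 ?mulr_gt0//.
  apply: le_trans (expR_ge1Dx _).
  have : n%:R <= n%:R ^+ 2 :> R by rewrite -natrX ler_nat; rewrite -mulnn; case: (n) => // k; rewrite leq_pmulr.
  move=> nn; rewrite mulrC ler_pdivrMr// mulrDl divfK// -natr1 addrC lerD// mul1r ler1n//.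
Unshelve. all: end_near. Qed.

(** As a function of t, the transform F satisfies F' = -tF: differentiate under the integral, then
    integrate by parts with w' = -xw. Hence F(t) exp(t^2/2) is constant, equal to cos c. *)
Lemma normal_cf (t c : R) : \int[N01]_x cos (t * x + c) = cos c * expR (- (t ^+ 2 / 2)).
Proof.
pose F t := \int[N01]_x cos (t * x + c).
have dF (s : R) : is_derive s (1:R) F (- (s * F s)).
  pose f (u x : R) := cos (u * x + c).
  have fi u : u \in `]s - 1, s + 1[ -> N01.-integrable setT (EFin \o f u).
    move=> _; apply: integrable_cos; exact: measurable_funM.
  have df u (x : R) : is_derive u (1:R) (f ^~ x) (- (x * sin (u * x + c))).
    by rewrite /f; apply: is_derive_eq; rewrite /GRing.scale/=; ring.
  have d1 u x : partial1of2 f u x = - (x * sin (u * x + c)).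
    by rewrite /partial1of2 derive1E; exact: derive_val.
  have fub u x : u \in `]s - 1, s + 1[ -> setT x -> `|partial1of2 f u x| <= `|x|.
    by move=> _ _; rewrite d1 normrN normrM ler_piMr// sin_max.
  have sI : s \in `]s - 1, s + 1[ by rewrite in_itv/=; apply/andP; split; lra.
  have derf u x : u \in `]s - 1, s + 1[ -> setT x -> derivable (f ^~ x) u 1.
    by move=> _ _; exact: ex_derive.
  have D1 := derivable_under_integral measurableT sI fi derf (fun=> normr_ge0 _)
     integrable_abs_std_normal fub.
  have D2 := differentiation_under_integral measurableT sI fi derf (fun=> normr_ge0 _)
     integrable_abs_std_normal fub.
  apply: DeriveDef => //; rewrite -derive1E D2.
  (* [H] vanishes at both infinities and has derivative [h], so the integral of [h] is 0; this is
     the integration by parts. *)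
  pose H (x : R) := sin (s * x + c) * w x.
  pose h (x : R) := s * (cos (s * x + c) * w x) - x * sin (s * x + c) * w x.
  have mw : measurable_fun setT w by exact: measurable_normal_pdf.
  have w0 x : 0 <= w x by exact: normal_pdf_ge0.
  have NE A : measurable A -> N01 A = (\int[leb]_(x in A) (w x)%:E)%E by [].
  have Ni (g : R -> R) : measurable_fun setT g -> N01.-integrable setT (EFin \o g) ->
      leb.-integrable setT (EFin \o (fun x => g x * w x)).
    by move=> mg gi; apply/(@integrable_density _ _ _ leb N01 w).
  have NI (g : R -> R) : measurable_fun setT g -> \int[N01]_x g x = \int[leb]_x (g x * w x).
    by move=> mg; apply: integral_density.
  have mxs : measurable_fun setT (fun x : R => x * sin (s * x + c)).
    apply: measurable_funM => //; apply: measurableT_comp.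
      by apply: continuous_measurable_fun; exact: continuous_sin.
    by apply: measurable_funD => //; exact: measurable_funM.
  have Nsi : N01.-integrable setT (EFin \o (fun x => x * sin (s * x + c))).
    apply: le_integrable integrable_abs_std_normal => //; first exact/measurable_EFinP.
    by move=> x _ /=; rewrite lee_fin normr_id normrM ler_piMr// sin_max.
  have mcs : measurable_fun setT (fun x : R => cos (s * x + c)).
    by apply: (measurableT_comp measurable_cos); apply: measurable_funD => //; exact: measurable_funM.
  have ci : leb.-integrable setT (EFin \o (fun x => cos (s * x + c) * w x)).
    by apply: Ni => //; apply: integrable_cos; exact: measurable_funM.
  have si : leb.-integrable setT (EFin \o (fun x => x * sin (s * x + c) * w x)).
    exact: Ni.
  have sci : leb.-integrable setT (EFin \o (fun x => s * (cos (s * x + c) * w x))).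
    have := integrableZl (mu := leb) measurableT s ci.
    by apply: eq_integrable => // x _.
  have dsin (x : R) : is_derive x (1:R) (fun x => sin (s * x + c)) (s * cos (s * x + c)).
    by apply: is_derive_eq; rewrite /GRing.scale/=; ring.
  have dcos (x : R) : is_derive x (1:R) (fun x => cos (s * x + c)) (- (s * sin (s * x + c))).
    by apply: is_derive_eq; rewrite /GRing.scale/=; ring.
  have ct (g : R -> R) (x : R) : derivable g x 1 -> {for x, continuous g}.
    by move=> ?; apply: differentiable_continuous; apply/derivable1_diffP.
  have H0 : \int[leb]_x h x = 0.
    apply: (@FTC_line _ H).
    - move=> x; apply: is_derive_eq.
        exact: (is_deriveM (dsin x) (is_derive_std_normal_pdf x)).
      by rewrite /GRing.scale/= /h; ring.
    - move=> x.
      have [d1' d2' d3'] : [/\ derivable (fun x => sin (s * x + c)) x 1,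
         derivable (fun x => cos (s * x + c)) x 1 & derivable w x 1].
        split; [exact: (@ex_derive _ _ _ _ _ _ _ (dsin x))|exact: (@ex_derive _ _ _ _ _ _ _ (dcos x))|].
        exact: (@ex_derive _ _ _ _ _ _ _ (is_derive_std_normal_pdf x)).
      apply: cvgB; first by apply: cvgM; [exact: cvg_cst|apply: cvgM; [exact: ct d2'|exact: ct d3']].
      by apply: cvgM; [apply: cvgM; [exact: cvg_id|exact: ct d1']|exact: ct d3'].
    - have := integrableB (mu := leb) measurableT sci si.
      by apply: eq_integrable => // x _.
    - apply: (cvg0_le _ cvg_std_normal_pdf) => n.
      by rewrite normrM (ger0_norm (w0 _)) ler_piMl// sin_max.
    - apply: (cvg0_le _ cvg_std_normal_pdf) => n.
      rewrite normrM (ger0_norm (w0 _)).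
      by rewrite [w (- _)]std_normal_pdfE sqrrN -std_normal_pdfE ler_piMl// sin_max.
  rewrite RintegralB// RintegralZl// in H0.
  have -> : s * F s = \int[leb]_x (x * sin (s * x + c) * w x).
    by rewrite /F NI//; apply/eqP; rewrite -subr_eq0 H0.
  transitivity (\int[N01]_x (- 1 * (x * sin (s * x + c)))).
    by apply: eq_Rintegral => x _; rewrite d1 mulN1r.
  rewrite RintegralZl//; 
  by rewrite mulN1r NI//.
pose G (s : R) := F s * expR (s ^+ 2 / 2).
have dG (s : R) : is_derive s (1:R) G 0.
  have dE : is_derive s (1:R) (fun s => expR (s ^+ 2 / 2)) (s * expR (s ^+ 2 / 2)).
    by apply: is_derive_eq; rewrite /GRing.scale/=; field.
  have D := is_deriveM (dF s) dE; apply: (is_derive_eq D).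
  by rewrite /GRing.scale/=; ring.
have := is_derive_0_is_cst t 0 dG; rewrite /G expr0n/= mul0r expR0 mulr1.
rewrite {2}/F.
rewrite [X in _ = X](_ : _ = \int[N01]_x cos c); last first.
  by apply: eq_Rintegral => x _; rewrite mul0r add0r.
by rewrite Rintegral_prob_cst => <-; rewrite expRN mulfK// gt_eqF// expR_gt0.
Qed.

End gaussian_cf.

Section std_normal_cV.
Context {R : realType}.
Local Notation leb := (@lebesgue_measure R).
Local Notation N01 := (normal_prob (0:R) 1).
Local Notation w := (normal_pdf (0:R) 1).
Local Notation gam n := (@std_normal_cV R n).

Lemma measurable_dotvr n (t : 'cV[R]_n) : measurable_fun setT (fun z => dotv t z).
Proof. by apply: measurable_dotv => //; exact: measurable_id. Qed.

Lemma dotv_cV_cons n (a b : R) (x y : 'cV[R]_n) :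
  dotv (cV_cons (a, x)) (cV_cons (b, y)) = a * b + dotv x y.
Proof.
rewrite !dotvE big_ord_recl !mxE unlift_none/=; congr (_ + _).
by apply: eq_bigr => i _; rewrite !mxE !liftK.
Qed.

Lemma std_normal_cV_cf n (t : 'cV[R]_n) (c : R) :
  \int[gam n]_z cos (dotv t z + c) = cos c * expR (- (dotv t t / 2)).
Proof.
elim: n t c => [|n IH] t c.
  rewrite (_ : dotv t t = 0) ?mul0r ?oppr0 ?expR0 ?mulr1; last by rewrite dotvE big_ord0.
  rewrite -[RHS](Rintegral_prob_cst (gam 0)); apply: eq_Rintegral => z _.
  by rewrite dotvE big_ord0 add0r.
have mf : measurable_fun setT (EFin \o (fun z => cos (dotv t z + c))).
  apply/measurable_EFinP; apply: (measurableT_comp measurable_cos).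
  by apply: measurable_funD => //; exact: measurable_dotvr.
rewrite -(cV_cons_eta t) in mf *; case: (cV_uncons t) mf => b s mf.
have mb : measurable_fun setT (fun a : measurableTypeR R => b * a) by exact: measurable_funM.
transitivity (\int[(N01 \x gam n)%E]_z cos (b * z.1 + dotv s z.2 + c)).
  rewrite /Rintegral; congr fine.
  transitivity (\int[N01 \x gam n]_x (cos (dotv (cV_cons (b, s)) (cV_cons x) + c))%:E)%E.
    apply: (integral_pushforward (@measurable_cV_cons R n) mf) => //.
    rewrite preimage_setT; apply: measurable_bounded_integrable => //.
    - rewrite -[X in ((_ \x _) X < _)%E]setXTT product_measure1E//.
      rewrite [X in (X * _)%E]probability_setT mul1e.
      have gT : gam n setT = 1%E by exact: probability_setT.
      suff : (gam n setT < +oo)%E by []; by rewrite [X in (X < _)%E]gT ltry.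
    - by apply/measurable_EFinP; apply: (measurableT_comp mf); exact: measurable_cV_cons.
    - by exists 1; split => // y y1 x _; rewrite /= (le_trans (cos_max _))// ltW.
  by apply: eq_integral => -[x y] _; rewrite dotv_cV_cons.
rewrite (@Rintegral_prod_cos _ _ _ _ _ N01 (gam n) (fun a => b * a) (dotv s) _ mb (measurable_dotvr s) (IH s)).
rewrite normal_cf -mulrA -expRD dotv_cV_cons; by congr (_ * expR _); field.
Qed.

(** The Lebesgue density of the product of normal laws, needed to turn Gaussian smoothing into a
    Lebesgue integral that can be translated and rescaled. *)
Lemma ge0_integral_std_normal_cV n (g : 'cV[R]_n -> \bar R) :
  measurable_fun setT g -> (forall x, 0 <= g x)%E ->
  (\int[gam n]_z g z = \int[lebesgue_cV n]_z
     (g z * (normal_peak 1 ^+ n * expR (- (dotv z z / 2)))%:E))%E.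
Proof.
elim: n g => [|n IH] g mg g0.
  apply: eq_integral => z _; rewrite dotvE big_ord0 mul0r oppr0 expR0.
  by rewrite expr0 mulr1 mule1.
pose k m (z : 'cV[R]_m) := normal_peak 1 ^+ m * expR (- (dotv z z / 2)).
have mk m : measurable_fun setT (@k m).
  apply: measurable_funM => //; apply: measurableT_comp => //.
  apply: measurableT_comp => //; apply: measurable_funM => //.
  by apply: measurable_dotv; exact: measurable_id.
have k0 m z : 0 <= k m z.
  by rewrite mulr_ge0 ?expR_ge0// exprn_ge0// normal_peak_ge0.
have mgk : measurable_fun setT (fun z => g z * (k n.+1 z)%:E)%E.
  by apply: emeasurable_funM => //; apply/measurable_EFinP; exact: mk.
have gk0 z : (0 <= g z * (k n.+1 z)%:E)%E by rewrite mule_ge0// lee_fin.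
rewrite (ge0_integral_product_powerS leb mgk gk0).
rewrite [LHS](ge0_integral_product_powerS N01 mg g0).
have mw : measurable_fun setT w by exact: measurable_normal_pdf.
have w0 x : 0 <= w x by exact: normal_pdf_ge0.
have mgc a : measurable_fun setT (fun y => g (cV_cons (a, y))).
  exact: (measurableT_comp mg (measurable_cV_consl a)).
rewrite (@ge0_integral_density _ _ _ leb N01 w)//; last 2 first.
- exact: measurable_integral_cV_cons.
- by move=> a; exact: integral_ge0.
apply: eq_integral => a _.
have m1 : measurable_fun setT (fun y => g (cV_cons (a, y)) * (k n y)%:E)%E.
  by apply: emeasurable_funM => //; apply/measurable_EFinP; exact: mk.
have p1 y : (0 <= g (cV_cons (a, y)) * (k n y)%:E)%E.
  by rewrite mule_ge0// lee_fin; exact: k0.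
rewrite [X in (X * _)%E](IH _ (mgc a))//.
rewrite -(ge0_integralZr (lebesgue_cV n) measurableT m1)//; last by rewrite lee_fin.
apply: eq_integral => y _; rewrite -muleA -EFinM; congr (_ * _%:E)%E.
rewrite /k dotv_cV_cons exprS mulrDl opprD expRD std_normal_pdfE -expr2; ring.
Qed.

End std_normal_cV.

Lemma measurable_subcV (R : realType) d (T : measurableType d) n (f g : T -> 'cV[R]_n) :
  measurable_fun setT f -> measurable_fun setT g ->
  measurable_fun setT (fun x => f x - g x).
Proof.
move=> mf mg; apply: measurable_addcV => //.
have -> : (fun x => - g x) = (fun x => (-1) *: g x) by apply/funext => x; rewrite scaleN1r.
exact: measurable_scalecV.
Qed.

(** * Continuity and measurability on R^n *)

Section cV_topology.
Context {R : realType} {n : nat}.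

Lemma nbhs_cVP (x : 'cV[R]_n) (A : set 'cV[R]_n) :
  nbhs x A <-> exists2 e : R, 0 < e & forall y : 'cV[R]_n, (forall i, `|x i 0 - y i 0| < e) -> A y.
Proof.
split.
  move=> /nbhs_ballP[e /= e0 eA]; exists e => // y xy; apply: eA.
  by split => // i j; rewrite ord1; exact: xy.
move=> [e e0 eA]; apply/nbhs_ballP; exists e => //= y [_ xy].
by apply: eA => i; exact: xy.
Qed.

Lemma continuous_cVP (g : 'cV[R]_n -> R) : continuous g <->
  forall (x : 'cV[R]_n) (e : R), 0 < e -> exists2 d : R, 0 < d &
    forall y : 'cV[R]_n, (forall i, `|x i 0 - y i 0| < d) -> `|g x - g y| < e.
Proof.
split=> [cg x e e0|H x].
  by have /cvgrPdist_lt/(_ _ e0)/nbhs_cVP := cg x.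
move=> A /nbhs_ballP[e /= e0 eA]; apply/nbhs_cVP.
by have [d d0 dA] := H x e e0; exists d => // y xy; apply: eA; exact: dA.
Qed.

(** The sigma-algebra is generated by the coordinates, not by the open sets. Rounding x down to the
    grid of mesh 1/(k+1) gives functions with countably many values, each taken on a union of boxes;
    they converge pointwise to [g] by continuity. *)
Lemma measurable_continuous_cV (g : 'cV[R]_n -> R) :
  continuous g -> measurable_fun setT g.
Proof.
move=> /continuous_cVP cg.
pose dk (k : nat) (x : 'cV[R]_n) : 'cV[int]_n := \col_i Num.floor (k.+1%:R * x i 0).
pose ck (k : nat) (m : 'cV[int]_n) : 'cV[R]_n := \col_i ((m i 0)%:~R / k.+1%:R).
have mdk k (m : 'cV[int]_n) : measurable (dk k @^-1` [set m]).
  rewrite (_ : dk k @^-1` [set m] = \bigcap_(i in [set: 'I_n])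
      ((fun x : 'cV[R]_n => x i 0) @^-1` `[(m i 0)%:~R / k.+1%:R, (m i 0 + 1)%:~R / k.+1%:R[)).
    apply: fin_bigcap_measurable => // i _.
    by rewrite -[X in measurable X]setTI; exact: measurable_coord.
  apply/seteqP; split => x /=.
    move=> <- i _ /=; rewrite in_itv/= !mxE ler_pdivrMr// ltr_pdivlMr// (mulrC (x i 0)).
    by rewrite floor_le floorD1_gt.
  move=> xm; apply/colP => i; rewrite !mxE; have := xm i I.
  rewrite /= in_itv/= ler_pdivrMr// ltr_pdivlMr// (mulrC (x i 0)) => xi.
  by apply: floor_def.
apply: (measurable_fun_cvg (h := fun k x => g (ck k (dk k x)))) => //.
- move=> k _ B mB; rewrite setTI.
  rewrite (_ : _ @^-1` B = \bigcup_(m in [set m | B (g (ck k m))]) (dk k @^-1` [set m])).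
    rewrite bigcup_mkcond; apply: countable_bigcupT_measurable => // m.
  by case: ifP.
  apply/seteqP; split => x /=; first by move=> Bx; exists (dk k x).
  by move=> [m Bm /= ->].
- move=> x _; apply/cvgrPdist_lt => e e0.
  have [d d0 xd] := cg x e e0.
  near=> k; apply: xd => i; rewrite !mxE.
  have k0 : (0:R) < k.+1%:R by [].
  have h1 : (Num.floor (k.+1%:R * x i 0))%:~R <= k.+1%:R * x i 0 by exact: floor_le.
  have h2 : k.+1%:R * x i 0 < (Num.floor (k.+1%:R * x i 0))%:~R + 1.
    by rewrite -(intrD _ _ 1); exact: floorD1_gt.
  rewrite ger0_norm; last by rewrite subr_ge0 ler_pdivrMr// [leRHS]mulrC.
  apply: (@lt_trans _ _ (k.+1%:R^-1)).
    by rewrite ltrBlDr -[X in _ < X + _]mul1r -mulrDl ltr_pdivlMr// [ltLHS]mulrC addrC.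
  near: k.
  have /cvgrPdist_lt/(_ _ d0) := @cvg_harmonic R.
  by apply: filterS => k; rewrite sub0r normrN /= ger0_norm.
Unshelve. all: end_near. Qed.

Lemma compact_cV_cube (L : R) : compact [set x : 'cV[R]_n | forall i, `|x i 0| <= L].
Proof.
have := @rV_compact R n (fun=> `[- L, L]%classic) (fun=> @segment_compact R _ _).
move=> cK; have : compact ((fun v : 'rV[R]_n => v^T) @` [set v : 'rV[R]_n | forall i, `[- L, L]%classic (v ord0 i)]).
  apply: continuous_compact => //; apply: continuous_subspaceT => v A /nbhs_cVP[e e0 eA].
  apply/nbhs_ballP; exists e => //= u [_ vu]; apply: eA => i; rewrite !mxE; exact: vu.
congr (compact _); apply/seteqP; split => x /=.
  by move=> [v vL <-] i; rewrite mxE ler_norml; have := vL i; rewrite /= in_itv.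
move=> xL; exists x^T; last by rewrite trmxK.
by move=> i; rewrite mxE /= in_itv/= -ler_norml.
Qed.

End cV_topology.

(** Only x is confined to [K]; y may leave it. This asymmetry is what lets a perturbed statistic y
    be compared with a point x of a compact set. *)
Lemma compact_unif_continuous (R : realType) (T : pseudoMetricType R) (K : set T) (g : T -> R) :
  compact K -> continuous g -> forall e : R, 0 < e -> exists2 d : R, 0 < d &
    forall x y, K x -> ball x d y -> `|g x - g y| < e.
Proof.
move=> /compact_near_coveringP cK cg e e0.
have := cK R (0:R)^'+ (fun d x => forall y, ball x d y -> `|g x - g y| < e) _.
have H x : K x -> \forall x' \near x & i \near 0^'+, forall y, ball x' i y -> `|g x' - g y| < e.
  move=> Kx; have e20 : 0 < e / 2 by rewrite divr_gt0.
  have /cvgrPdist_lt/(_ _ e20)/nbhs_ballP[r /= r0 rA] := cg x.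
  have r20 : 0 < r / 2 by rewrite divr_gt0.
  exists (ball x (r / 2), [set i : R | i < r / 2]); first split => /=.
  - exact: nbhsx_ballx.
  - exact: nbhs_right_lt.
  - move=> [x' i] /= [xx' ir] y x'y.
    have gx' : `|g x - g x'| < e / 2 by apply: rA; apply: le_ball xx'; lra.
    have gy : `|g x - g y| < e / 2.
      apply: rA; rewrite (_ : r = r / 2 + r / 2); last by field.
      by apply: ball_triangle xx' _; apply: le_ball x'y; exact: ltW.
    rewrite (_ : g x' - g y = (g x - g y) - (g x - g x')); last by ring.
    by rewrite (le_lt_trans (ler_normB _ _))// (_ : e = e / 2 + e / 2) ?ltrD//; field.
move=> /(_ _ H) nearP.
near (0:R)^'+ => d; exists d => //.
move=> x y Kx xdy.
have sub : K `<=` (fun x => forall y, ball x d y -> `|g x - g y| < e) by near: d.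
exact: sub Kx _ xdy.
Unshelve. all: end_near. Qed.

(** * Levy's continuity theorem by Gaussian smoothing *)

Section levy.
Context {R : realType} {n : nat}.
Local Notation leb := (@lebesgue_cV R n).
Local Notation gam := (@std_normal_cV R n).
Let K (x : 'cV[R]_n) : R := expR (- (dotv x x / 2)).

Let K01 x : 0 <= K x <= 1.
Proof.
by rewrite expR_ge0/= -[leRHS]expR0 ler_expR oppr_le0 divr_ge0// dotvv_ge0.
Qed.

Let KN x : K (- x) = K x.
Proof. by rewrite /K dotvNl dotvC dotvNl opprK. Qed.

Let mK : measurable_fun setT K.
Proof.
apply: measurableT_comp => //; apply: measurableT_comp => //.
apply: measurable_funM => //; apply: measurable_dotv; exact: measurable_id.
Qed.

Let measurable_KS d (T : measurableType d) (S : T -> 'cV[R]_n) (r : R) (y : 'cV[R]_n) :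
  measurable_fun setT S -> measurable_fun setT (fun w => K (r *: (S w - y))).
Proof.
move=> mS; apply: (measurableT_comp mK); apply: measurable_scalecV => //.
by apply: measurable_addcV.
Qed.

(* The Gaussian bump [K] is the cosine transform of the standard normal law, so its
   expectation only involves the cosine transforms of the law of [S]. *)
Let bump_cf d (T : measurableType d) (P : probability T R) (S : T -> 'cV[R]_n) r y :
  measurable_fun setT S ->
  measurable_fun setT (fun z : 'cV[R]_n => \int[P]_w cos (dotv (r *: z) (S w) + - (r * dotv y z))) /\
  \int[P]_w K (r *: (S w - y)) =
  \int[gam]_z \int[P]_w cos (dotv (r *: z) (S w) + - (r * dotv y z)).
Proof.
move=> mS.
pose f (wz : T * 'cV[R]_n) := cos (dotv (r *: wz.2) (S wz.1) + - (r * dotv y wz.2)).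
have mf : measurable_fun setT f.
  apply: (measurableT_comp measurable_cos); apply: measurable_funD.
    apply: measurable_dotv; last exact: (measurableT_comp mS).
    by apply: measurable_scalecV.
  apply: measurableT_comp => //; apply: measurable_funM => //.
  exact: (measurableT_comp (measurable_dotvr y)).
have [E1 [E2 mG]] := Rfubini_prob P gam mf (fun z => cos_max _).
split => //; rewrite -E2 E1; apply: eq_Rintegral => w _.
have E0 := std_normal_cV_cf (r *: (S w - y)) 0; rewrite cos0 mul1r in E0.
transitivity (expR (- (dotv (r *: (S w - y)) (r *: (S w - y)) / 2))) => //.
rewrite -E0.
apply: eq_Rintegral => z _.
rewrite /f/= addr0 !(dotvZl, dotvBl) mulrBr; congr (cos (_ - _)).
by rewrite dotvC.
Qed.

Section convergence.
Context {d : nat -> measure_display} {Omega : forall k, measurableType (d k)}.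
Variables (P : forall k, probability (Omega k) R) (S : forall k, Omega k -> 'cV[R]_n).
Context {d'} {Omega' : measurableType d'}.
Variables (Q : probability Omega' R) (S' : Omega' -> 'cV[R]_n).
Hypotheses (mS : forall k, measurable_fun setT (@S k)) (mS' : measurable_fun setT S').
Hypothesis cf_cvg : forall t c,
  \int[P k]_w cos (dotv t (@S k w) + c) @[k --> \oo] --> \int[Q]_w cos (dotv t (S' w) + c).

(** Dominated convergence in the Gaussian variable: the inner cosine transforms converge pointwise
    and are bounded by 1. *)
Let bump_cvg r y :
  \int[P k]_w K (r *: (@S k w - y)) @[k --> \oo] --> \int[Q]_w K (r *: (S' w - y)).
Proof.
have [mQ ->] := bump_cf Q r y mS'.
under eq_fun => k do rewrite (bump_cf (P k) r y (@mS k)).2.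
apply: (@Rdominated_cvg _ _ _ _ _ _ (fun=> 1)) => //.
- by move=> k; exact: (bump_cf (P k) r y (@mS k)).1.
- exact: finite_measure_integrable_cst.
- move=> k z; rewrite ler_norml; apply/andP; split.
    rewrite -[leLHS](Rintegral_prob_cst (P k)); apply: le_Rintegral_prob.
    + exact: finite_measure_integrable_cst.
    + by apply: integrable_cos; exact: measurable_dotv.
    + by move=> w; rewrite cos_geN1.
  apply: Rintegral_prob_le; last by move=> w; exact: cos_le1.
  by apply: integrable_cos; exact: measurable_dotv.
Qed.


(** The convolution of h with the normal law of covariance I/r^2. *)
Let mollify (r : R) (h : 'cV[R]_n -> R) x := \int[gam]_z h (x + r^-1 *: z).

(* Smoothing by Gaussian noise of scale 1/r writes the expectation as an integral
   over y of bump expectations, to which [bump_cvg] applies. *)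
Let mollifyE d0 (T : measurableType d0) (P0 : probability T R) (S0 : T -> 'cV[R]_n)
    (r M : R) (h : 'cV[R]_n -> R) :
  0 < r -> measurable_fun setT S0 -> measurable_fun setT h ->
  (forall x, 0 <= h x <= M) ->
  ((\int[P0]_w mollify r h (S0 w))%:E =
   (normal_peak 1 ^+ n * r ^+ n)%:E *
   \int[leb]_y (h y * \int[P0]_w K (r *: (S0 w - y)))%:E)%E.
Proof.
move=> r0 mS0 mh hM.
have h0 x : 0 <= h x by have /andP[] := hM x.
have hE x : `|h x| <= M by rewrite ger0_norm//; have /andP[] := hM x.
have Kg0 x : 0 <= K x by have /andP[] := K01 x.
have rV0 : 0 < r^-1 by rewrite invr_gt0.
have c0 : 0 <= normal_peak 1 ^+ n * r ^+ n :> R.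
  by rewrite mulr_ge0 ?exprn_ge0 ?normal_peak_ge0// ltW.
have E1 x : ((mollify r h x)%:E = (normal_peak 1 ^+ n * r ^+ n)%:E *
    \int[leb]_y (h y * K (r *: (x - y)))%:E)%E.
  have mhx (s : R) : measurable_fun setT (fun z : 'cV[R]_n => h (x + s *: z)).
    by apply: (measurableT_comp mh); apply: measurable_addcV => //; exact: measurable_scalecV.
  rewrite EFin_Rintegral//; last by apply: (integrable_le_bound _ (M := M)).
  rewrite ge0_integral_std_normal_cV//; last 2 first.
  - exact/measurable_EFinP.
  - by move=> z; rewrite lee_fin.
  have mg : measurable_fun setT (fun z : 'cV[R]_n => (h (x + z)%R * K (r *: z))%:E).
    apply/measurable_EFinP; apply: measurable_funM.
      by apply: (measurableT_comp mh); exact: measurable_addcV.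
    by apply: (measurableT_comp mK); exact: measurable_scalecV.
  have g0 z : (0 <= (h (x + z)%R * K (r *: z))%:E)%E by rewrite lee_fin mulr_ge0.
  have mg2 : measurable_fun setT (fun y : 'cV[R]_n => (h y * K (r *: (x - y)))%:E).
    apply/measurable_EFinP; apply: measurable_funM => //.
    apply: (measurableT_comp mK); apply: measurable_scalecV => //.
    exact: measurable_subcV.
  have g20 y : (0 <= (h y * K (r *: (x - y)))%:E)%E by rewrite lee_fin mulr_ge0.
  transitivity ((normal_peak 1 ^+ n)%:E * \int[leb]_z (h (x + r^-1 *: z) * K z)%:E)%E.
    rewrite -ge0_integralZl//.
    - by apply: eq_integral => z _; rewrite -!EFinM; congr EFin; rewrite /K; ring.
    - by apply/measurable_EFinP; apply: measurable_funM.
    - by move=> z _; rewrite lee_fin mulr_ge0.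
    - by rewrite lee_fin exprn_ge0// normal_peak_ge0.
  rewrite EFinM -muleA; congr (_ * _)%E.
  rewrite -(ge0_integral_lebesgue_cV_shift x mg2 g20).
  transitivity ((r ^+ n)%:E * \int[leb]_z (h (x + z) * K (r *: z))%:E)%E; last first.
    have -> : (\int[leb]_z (h (z + x) * K (r *: (x - (z + x))))%:E =
               \int[leb]_z (h (x + z) * K (r *: z))%:E)%E.
      apply: eq_integral => z _; rewrite (addrC z x) opprD addrA subrr sub0r.
      by rewrite scalerN KN.
    by [].
  rewrite (ge0_integral_lebesgue_cV_scale rV0 mg g0) muleA -EFinM.
  rewrite -exprMn divff ?gt_eqF// expr1n mul1e.
  by apply: eq_integral => z _; rewrite scalerA divff ?gt_eqF// scale1r.
have mmol : measurable_fun setT (fun w => mollify r h (S0 w)).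
  have mf : measurable_fun setT (fun zw : 'cV[R]_n * T => h (S0 zw.2 + r^-1 *: zw.1)).
    apply: (measurableT_comp mh); apply: measurable_addcV.
      exact: (measurableT_comp mS0).
    by apply: measurable_scalecV.
  by have [_ [_]] := Rfubini_prob gam P0 mf (fun z => hE _).
have mol_le x : 0 <= mollify r h x <= M.
  have mhx : measurable_fun setT (fun z : 'cV[R]_n => h (x + r^-1 *: z)).
    by apply: (measurableT_comp mh); apply: measurable_addcV => //; exact: measurable_scalecV.
  apply/andP; split; first exact: Rintegral_ge0.
  apply: Rintegral_prob_le; first by apply: (integrable_le_bound _ (M := M)).
  by move=> z; have /andP[] := hM (x + r^-1 *: z).
rewrite EFin_Rintegral//; last first.
  apply: (integrable_le_bound _ (M := M)) => // w.
  by have /andP[m0 mM] := mol_le (S0 w); rewrite ger0_norm.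
under eq_integral do rewrite E1.
pose F (wy : T * 'cV[R]_n) : \bar R := (h wy.2 * K (r *: (S0 wy.1 - wy.2)))%:E.
have mF : measurable_fun setT F.
  apply/measurable_EFinP; apply: measurable_funM; first exact: (measurableT_comp mh).
  apply: (measurableT_comp mK); apply: measurable_scalecV => //.
  by apply: measurable_subcV => //; exact: (measurableT_comp mS0).
have F0 z : (0 <= F z)%E by rewrite lee_fin mulr_ge0.
rewrite ge0_integralZl//; last 2 first.
- exact: (measurable_fun_fubini_tonelli_F F mF F0).
- by move=> w _; apply: integral_ge0 => y _; exact: (F0 (w, y)).
congr (_ * _)%E.
rewrite (fubini_tonelli F mF F0).
apply: eq_integral => y _; rewrite EFinM EFin_Rintegral//; last first.
  apply: (integrable_le_bound _ (M := 1)) => [|w]; first exact: measurable_KS.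
  by have /andP[k0 k1] := K01 (r *: (S0 w - y)); rewrite ger0_norm.
rewrite -ge0_integralZl// ?lee_fin//.
- by apply/measurable_EFinP; exact: measurable_KS.
- by move=> w _; rewrite lee_fin.
Qed.

(** Bump expectations lie in [0, 1], so the integrand in y is dominated by [h] itself; this is where
    integrability of [h] enters. *)
Let mollify_cvg (r M : R) (h : 'cV[R]_n -> R) : 0 < r -> measurable_fun setT h ->
  (forall x, 0 <= h x <= M) -> leb.-integrable setT (EFin \o h) ->
  \int[P k]_w mollify r h (@S k w) @[k --> \oo] --> \int[Q]_w mollify r h (S' w).
Proof.
move=> r0 mh hM hi.
have h0 x : 0 <= h x by have /andP[] := hM x.
pose c : R := normal_peak 1 ^+ n * r ^+ n.
pose I_ d0 (T : measurableType d0) (P0 : probability T R) (S0 : T -> 'cV[R]_n) y :=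
  h y * \int[P0]_w K (r *: (S0 w - y)).
have IB d0 (T : measurableType d0) (P0 : probability T R) (S0 : T -> 'cV[R]_n) :
    measurable_fun setT S0 -> [/\ measurable_fun setT (I_ _ _ P0 S0),
      forall y, `|I_ _ _ P0 S0 y| <= h y & 
      \int[P0]_w mollify r h (S0 w) = c * \int[leb]_y I_ _ _ P0 S0 y].
  move=> mS0.
  have mI : measurable_fun setT (I_ _ _ P0 S0).
    apply: measurable_funM => //.
    pose f (wy : T * 'cV[R]_n) := K (r *: (S0 wy.1 - wy.2)).
    have mf : measurable_fun setT f.
      apply: (measurableT_comp mK); apply: measurable_scalecV => //.
      by apply: measurable_subcV => //; exact: (measurableT_comp mS0).
    have f1 z : `|f z| <= 1.
      by have /andP[k0 k1] := K01 (r *: (S0 z.1 - z.2)); rewrite ger0_norm.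
    by have [_ [_]] := Rfubini_prob P0 gam mf f1.
  have Ih y : `|I_ _ _ P0 S0 y| <= h y.
    have I0 : 0 <= \int[P0]_w K (r *: (S0 w - y)).
      by apply: Rintegral_ge0 => w _; have /andP[] := K01 (r *: (S0 w - y)).
    rewrite ger0_norm ?mulr_ge0// ler_piMr//.
    apply: Rintegral_prob_le; last by move=> w; have /andP[] := K01 (r *: (S0 w - y)).
    apply: (integrable_le_bound _ (M := 1)) => [|w]; first exact: measurable_KS.
    by have /andP[k0 k1] := K01 (r *: (S0 w - y)); rewrite ger0_norm.
  split => //.
  have Ii : leb.-integrable setT (EFin \o I_ _ _ P0 S0).
    apply: le_integrable hi => //; first exact/measurable_EFinP.
    by move=> y _ /=; rewrite lee_fin (ger0_norm (h0 y)).
  apply: EFin_inj; rewrite (mollifyE P0 r0 mS0 mh hM) [RHS]EFinM.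
  by rewrite (EFin_Rintegral measurableT Ii).
have [mQ bQ ->] := IB _ _ Q S' mS'.
under eq_fun => k do (have [_ _ ->] := IB _ _ (P k) (@S k) (@mS k)).
apply: cvgMr; apply: (Rdominated_cvg _ mQ _ hi).
- by move=> k; have [] := IB _ _ (P k) (@S k) (@mS k).
- by move=> y; apply: cvgMr; exact: bump_cvg.
- by move=> k y; have [_ + _] := IB _ _ (P k) (@S k) (@mS k); exact.
Qed.

(** For small Gaussian z the shift stays below the modulus of continuity; for large z the error is
    at most M, on an event whose probability tends to 0 as r grows, uniformly in x. *)
Let mollify_close (M : R) (h : 'cV[R]_n -> R) : measurable_fun setT h ->
  (forall x, 0 <= h x <= M) ->
  (forall e : R, 0 < e -> exists2 d : R, 0 < d &
    forall x y : 'cV[R]_n, (forall i, `|x i 0 - y i 0| < d) -> `|h x - h y| < e) ->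
  forall e : R, 0 < e -> exists2 r : R, 0 < r & forall x, `|mollify r h x - h x| <= e.
Proof.
move=> mh hM ucont e e0.
have [del del0 hd] := ucont (e / 2) (divr_gt0 e0 (ltr0n _ 2)).
have M0 : 0 <= M by have /andP[/le_trans] := hM 0; apply.
(* [en k] bounds the error at scale r = k+1, split at |z| = (k+1) del, that is where the shift
   z/(k+1) has length del. *)
pose en (k : nat) (z : 'cV[R]_n) : R := if enorm z < k.+1%:R * del then e / 2 else M.
have men k : measurable_fun setT (en k).
  apply: measurable_fun_ifT => //.
  by apply: measurable_fun_ltr => //; exact: measurable_enorm.
have en_cvg : \int[gam]_z en k z @[k --> \oo] --> \int[gam]_z (e / 2).
  apply: (@Rdominated_cvg _ _ _ _ _ _ (fun=> e / 2 + M)) => //.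
  - move=> z; apply: cvg_near_cst.
    exists (Num.truncn (enorm z / del)) => // k /= xk.
    rewrite /en ifT// -ltr_pdivrMr// (lt_le_trans (truncnS_gt _))//.
    by rewrite ler_nat ltnS.
  - exact: finite_measure_integrable_cst.
  - by move=> k z; rewrite /en; case: ifP => _; rewrite ger0_norm ?lerDl ?lerDr// divr_ge0// ltW.
rewrite Rintegral_prob_cst in en_cvg.
have /cvgrPdist_lt/(_ _ (divr_gt0 e0 (ltr0n _ 2)))[k _ /(_ k (leqnn k))] := en_cvg.
rewrite distrC => /ltr_normlW ek.
have k0 : (0:R) < k.+1%:R by [].
exists k.+1%:R => // x.
have hE y : `|h y| <= M by have /andP[h0 hm] := hM y; rewrite ger0_norm.
have mhx : measurable_fun setT (fun z : 'cV[R]_n => h (x + k.+1%:R^-1 *: z)).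
  by apply: (measurableT_comp mh); apply: measurable_addcV => //; exact: measurable_scalecV.
have i1 : gam.-integrable setT (EFin \o (fun z : 'cV[R]_n => h (x + k.+1%:R^-1 *: z))).
  by apply: (integrable_le_bound _ (M := M)).
have i2 : gam.-integrable setT (EFin \o (fun z : 'cV[R]_n => h x)).
  exact: finite_measure_integrable_cst.
have -> : mollify k.+1%:R h x - h x = \int[gam]_z (h (x + k.+1%:R^-1 *: z) - h x).
  by rewrite RintegralB// Rintegral_prob_cst.
have mB : measurable_fun setT (fun z : 'cV[R]_n => h (x + k.+1%:R^-1 *: z) - h x).
  exact: measurable_funB.
have bB y : `|h y - h x| <= M.
  have /andP[a1 a2] := hM y; have /andP[b1 b2] := hM x.
  by rewrite ler_norml; apply/andP; split; lra.
have iB : gam.-integrable setT (EFin \o (fun z : 'cV[R]_n => h (x + k.+1%:R^-1 *: z) - h x)).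
  by apply: (integrable_le_bound _ (M := M)).
apply: (le_trans (le_normr_Rintegral measurableT iB)).
apply: (@le_trans _ _ (\int[gam]_z en k z)); last by lra.
apply: le_Rintegral_prob.
- by apply: (integrable_le_bound _ (M := M)) => [|z]; [exact: measurableT_comp|rewrite normr_id].
- apply: (integrable_le_bound _ (M := e / 2 + M)) => // z.
  by rewrite /en; case: ifP => _; rewrite ger0_norm ?lerDl ?lerDr// divr_ge0// ltW.
move=> z; rewrite /en; case: ifP => // zk.
rewrite distrC ltW// hd// => i; rewrite !mxE opprD addrA subrr sub0r normrN.
rewrite normrM gtr0_norm ?invr_gt0// mulrC ltr_pdivrMr// mulrC.
exact: le_lt_trans (ler_abs_enorm _ _) zk.
Qed.

(** Three errors of e/3: mollification on the side of [P k], on the side of [Q], and convergence of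
    the mollified expectations. The first bound is uniform in k. *)
Let ucont_cvg (M : R) (h : 'cV[R]_n -> R) : measurable_fun setT h ->
  (forall x, 0 <= h x <= M) -> leb.-integrable setT (EFin \o h) ->
  (forall e : R, 0 < e -> exists2 d : R, 0 < d &
    forall x y : 'cV[R]_n, (forall i, `|x i 0 - y i 0| < d) -> `|h x - h y| < e) ->
  \int[P k]_w h (@S k w) @[k --> \oo] --> \int[Q]_w h (S' w).
Proof.
move=> mh hM hi ucont; apply/cvgrPdist_le => e e0.
have e30 : 0 < e / 3 by rewrite divr_gt0.
have [r r0 hr] := mollify_close mh hM ucont e30.
have hE y : `|h y| <= M by have /andP[h0 hm] := hM y; rewrite ger0_norm.
have close d0 (T : measurableType d0) (P0 : probability T R) (S0 : T -> 'cV[R]_n) :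
    measurable_fun setT S0 ->
    `|\int[P0]_w mollify r h (S0 w) - \int[P0]_w h (S0 w)| <= e / 3.
  move=> mS0.
  have mmol : measurable_fun setT (fun w => mollify r h (S0 w)).
    have mf : measurable_fun setT (fun zw : 'cV[R]_n * T => h (S0 zw.2 + r^-1 *: zw.1)).
      apply: (measurableT_comp mh); apply: measurable_addcV.
        exact: (measurableT_comp mS0).
      by apply: measurable_scalecV.
    by have [_ [_]] := Rfubini_prob gam P0 mf (fun z => hE _).
  have mhS : measurable_fun setT (fun w => h (S0 w)) by exact: (measurableT_comp mh).
  have ihS : P0.-integrable setT (EFin \o (fun w => h (S0 w))).
    by apply: (integrable_le_bound _ (M := M)).
  have imol : P0.-integrable setT (EFin \o (fun w => mollify r h (S0 w))).
    apply: (integrable_le_bound _ (M := M + e / 3)) => // w.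
    rewrite -(subrK (h (S0 w)) (mollify _ _ _)) (le_trans (ler_normD _ _))//.
    by rewrite addrC lerD.
  rewrite -RintegralB//.
  have iB : P0.-integrable setT (EFin \o (fun w => mollify r h (S0 w) - h (S0 w))).
    apply: (integrable_le_bound _ (M := e / 3)) => //; exact: measurable_funB.
  apply: (le_trans (le_normr_Rintegral measurableT iB)).
  apply: Rintegral_prob_le => //.
  apply: (integrable_le_bound _ (M := e / 3)) => [|w]; last by rewrite normr_id.
  by apply: measurableT_comp => //; exact: measurable_funB.
have /cvgrPdist_le/(_ _ e30) := mollify_cvg r0 mh hM hi.
apply: filterS => k.
have := close _ _ Q S' mS'; have := close _ _ (P k) (@S k) (@mS k).
rewrite !ler_norml => /andP[a1 a2] /andP[b1 b2] /andP[c1 c2].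
apply/andP; split; lra.
Qed.

(** A Lipschitz cutoff between the balls of radius L and L+1. *)
Let chi (L : nat) (x : 'cV[R]_n) : R := Num.max 0 (Num.min 1 (L.+1%:R - enorm x)).

Let chi01 L x : 0 <= chi L x <= 1.
Proof. by rewrite /chi le_max lexx/= ge_max ler01 ge_min lexx. Qed.

Let continuous_chi L : continuous (chi L).
Proof.
have cd : continuous (fun x : 'cV[R]_n => \sum_i x i 0 * x i 0).
  apply: continuous_big => [|i _ x]; first exact: add_continuous.
  exact: (cvgM (@coord_continuous R _ _ i 0 x) (@coord_continuous R _ _ i 0 x)).
have ce : continuous (@enorm R n).
  have -> : @enorm R n = Num.sqrt \o (fun x => \sum_i x i 0 * x i 0).
    by apply/funext => x /=; rewrite /enorm dotvE.
  by move=> x; apply: continuous_comp; [exact: cd|exact: sqrt_continuous].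
move=> x; apply: (@continuous_max R _ (fun=> 0) (fun x => Num.min 1 (L.+1%:R - enorm x)) x).
  exact: cst_continuous.
apply: (@continuous_min R _ (fun=> 1) (fun x => L.+1%:R - enorm x) x); first exact: cst_continuous.
by apply: continuousB; [exact: cst_continuous|exact: ce].
Qed.

Let chi_eq0 L x : L.+1%:R <= enorm x -> chi L x = 0.
Proof.
move=> Lx; rewrite /chi; apply/max_idPl; rewrite ge_min subr_le0 Lx orbT//.
Qed.

(** The cutoff gives compact support, hence the integrability and uniform continuity that
    [ucont_cvg] asks for. *)
Let compact_cvg (L : nat) (M : R) (G : 'cV[R]_n -> R) : continuous G ->
  (forall x, 0 <= G x <= M) ->
  \int[P k]_w (G (@S k w) * chi L (@S k w)) @[k --> \oo] --> \int[Q]_w (G (S' w) * chi L (S' w)).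
Proof.
move=> cG GM; pose h x := G x * chi L x.
have ch : continuous h by move=> x; exact: (cvgM (cG x) (@continuous_chi L x)).
have mh := measurable_continuous_cV ch.
have hM x : 0 <= h x <= M.
  have /andP[G0 G1] := GM x; have /andP[c0 c1] := chi01 L x.
  by rewrite /h mulr_ge0//= (le_trans _ G1)// ler_piMr.
have h0 i (x : 'cV[R]_n) : L.+1%:R <= `|x i 0| -> h x = 0.
  by move=> Lx; rewrite /h chi_eq0 ?mulr0// (le_trans Lx)// ler_abs_enorm.
apply: (ucont_cvg mh hM).
- pose C := [set x : 'cV[R]_n | forall i, - L.+1%:R <= x i 0 <= L.+1%:R].
  have mC : measurable C.
    rewrite (_ : C = \bigcap_(i in [set: 'I_n]) ((fun x : 'cV[R]_n => x i 0) @^-1` `[- L.+1%:R, L.+1%:R])).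
      apply: fin_bigcap_measurable => // i _.
      by rewrite -[X in measurable X]setTI; exact: measurable_coord.
    apply/seteqP; split => x /= cx i; first by move=> _ /=; rewrite in_itv/=; exact: cx.
    by have := cx i I; rewrite /= in_itv.
  have Cfin : (leb C < +oo)%E by rewrite lebesgue_cV_cube ?ltry// (le_trans (y := 0))// oppr_le0.
  have : leb.-integrable setT (fun x => M%:E * (\1_C x)%:E)%E.
    apply: integrableZl => //; apply/integrableP; split.
      by apply/measurable_EFinP; exact: measurable_indic.
    under eq_integral do rewrite gee0_abs ?lee_fin//.
    by rewrite integral_indic ?setIT.
  apply: le_integrable => //; first exact/measurable_EFinP.
  move=> x _ /=; rewrite lee_fin; have /andP[hx0 hxM] := hM x.
  have M0 := le_trans hx0 hxM.
  rewrite (ger0_norm hx0) [leRHS]ger0_norm ?mulr_ge0//.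
  rewrite indicE; have [xC|xC] := boolP (x \in C); first by rewrite mulr1.
  have [i xi] : exists i, L.+1%:R <= `|x i 0|.
    apply: contrapT => H; move/negP: xC; apply; rewrite inE => i.
    rewrite -ler_norml; have [//|/ltW xi] := leP; exfalso; apply: H; exists i.
    exact: xi.
  by rewrite (h0 i)// mulr0.
- move=> e e0.
  (* The margins L+2 and 1 are chosen so that if x lies outside the cube of half-side L+2, every y
     within distance 1 still has norm at least L+1; [h] then vanishes at both points. *)
  have [r r0 hr] := compact_unif_continuous (@compact_cV_cube R n L.+2%:R) ch e0.
  exists (Num.min r 1) => [|x y xy]; first by rewrite lt_min r0 ltr01.
  have [xK|xK] := pselect (forall i, `|x i 0| <= L.+2%:R).
    apply: hr => //; split => // i j; rewrite ord1.
    by have := xy i; rewrite lt_min => /andP[].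
  have [i xi] : exists i, L.+2%:R < `|x i 0|.
    apply: contrapT => H; apply: xK => i; have [//|xi] := leP; exfalso; apply: H; exists i.
    exact: xi.
  have yi : L.+1%:R <= `|y i 0|.
    have := xy i; rewrite lt_min => /andP[_ xyi].
    have := ler_normD (y i 0) (x i 0 - y i 0); rewrite addrC subrK.
    by move: xi; rewrite -(natr1 L.+1); lra.
  by rewrite (h0 i x) ?(h0 i y) ?subrr ?normr0// (le_trans _ (ltW xi))// ler_nat.
Qed.

(** Tightness is deduced: testing against [chi L] shows that the mass left outside the ball under
    [P k] is eventually close to that under [Q], which is small for L large. Adding M makes [g]
    nonnegative, as the previous steps require. *)
Theorem levy_continuity (g : 'cV[R]_n -> R) (M : R) : continuous g ->
  (forall x, `|g x| <= M) ->
  \int[P k]_w g (@S k w) @[k --> \oo] --> \int[Q]_w g (S' w).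
Proof.
move=> cg gM; apply/cvgrPdist_le => e e0.
have M0 : 0 <= M by exact: le_trans (normr_ge0 _) (gM 0).
have mg := measurable_continuous_cV cg.
pose G x := g x + M.
have cG : continuous G by move=> x; exact: (cvgD (cg x) (cvg_cst M)).
have GM x : 0 <= G x <= 2 * M.
  by have := gM x; rewrite ler_norml /G => /andP[? ?]; apply/andP; split; lra.
(* The errors are e' from G chi and at most 2M e' and 4M e' from the two tails, within (2 + 6M) e' =
   e. *)
pose e' := e / (1 + 6 * M + 1).
have e'0 : 0 < e' by rewrite divr_gt0//; lra.
have c1 : \int[Q]_w chi L (S' w) @[L --> \oo] --> \int[Q]_w (1:R).
  apply: (@Rdominated_cvg _ _ _ _ _ _ (fun=> 1)) => //.
  - move=> L; apply: (measurableT_comp _ mS').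
    by apply: measurable_continuous_cV; exact: continuous_chi.
  - move=> w; apply: cvg_near_cst; exists (Num.truncn (enorm (S' w))).+1 => // L /= wL.
    have e1 : 1 <= L.+1%:R - enorm (S' w).
      rewrite lerBrDr -natr1 addrC lerD2r (le_trans (ltW (truncnS_gt _)))//.
      by rewrite ler_nat.
    by rewrite /chi (min_idPl e1); apply/max_idPr; exact: ler01.
  - exact: finite_measure_integrable_cst.
  - by move=> L w; have /andP[? ?] := chi01 L (S' w); rewrite ger0_norm.
rewrite Rintegral_prob_cst in c1.
have /cvgrPdist_le/(_ _ e'0)[L _ /(_ L (leqnn L))] := c1.
rewrite /= => /ler_normlW HL.
have := @compact_cvg L _ G cG GM; move=> /cvgrPdist_le/(_ _ e'0) A1.
have : \int[P k]_w chi L (@S k w) @[k --> \oo] --> \int[Q]_w chi L (S' w).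
  have := @compact_cvg L 1 (fun=> 1) (fun x => @cst_continuous _ _ (1:R) x).
  under eq_fun do under eq_Rintegral do rewrite mul1r.
  under eq_Rintegral do rewrite mul1r.
  by apply => x; rewrite ler01 lexx.
move=> /cvgrPdist_le/(_ _ e'0) A2.
(* Writes g = G chi + G (1 - chi) - M; [b] is the integral of the middle term, with 0 <= G <= 2M. *)
have split0 d0 (T : measurableType d0) (P0 : probability T R) (S0 : T -> 'cV[R]_n) :
    measurable_fun setT S0 -> exists2 b : R,
      \int[P0]_w g (S0 w) = \int[P0]_w (G (S0 w) * chi L (S0 w)) + b - M &
      0 <= b <= 2 * M * (1 - \int[P0]_w chi L (S0 w)).
  move=> mS0.
  have mc : measurable_fun setT (fun w => chi L (S0 w)).
    apply: (measurableT_comp _ mS0).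
    by apply: measurable_continuous_cV; exact: continuous_chi.
  have mgS : measurable_fun setT (fun w => g (S0 w)) by exact: (measurableT_comp mg).
  have mGS : measurable_fun setT (fun w => G (S0 w)) by exact: measurable_funD.
  have ig : P0.-integrable setT (EFin \o (fun w => g (S0 w))).
    by apply: (integrable_le_bound _ (M := M)).
  have ic : P0.-integrable setT (EFin \o (fun w => chi L (S0 w))).
    apply: (integrable_le_bound _ (M := 1)) => // w.
    by have /andP[? ?] := chi01 L (S0 w); rewrite ger0_norm.
  have i1 c : P0.-integrable setT (EFin \o (fun w : T => (c : R))).
    exact: finite_measure_integrable_cst.
  have iGc : P0.-integrable setT (EFin \o (fun w => G (S0 w) * chi L (S0 w))).
    apply: (integrable_le_bound _ (M := 2 * M)) => [|w]; first exact: measurable_funM.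
    have /andP[? ?] := chi01 L (S0 w); have /andP[? ?] := GM (S0 w).
    by rewrite ger0_norm ?mulr_ge0// -[leRHS]mulr1 ler_pM.
  have i1c : P0.-integrable setT (EFin \o (fun w => 1 - chi L (S0 w))).
    apply: (integrable_le_bound _ (M := 1)) => [|w]; first exact: measurable_funB.
    by have /andP[? ?] := chi01 L (S0 w); rewrite ger0_norm; lra.
  have iM1c : P0.-integrable setT (EFin \o (fun w => 2 * M * (1 - chi L (S0 w)))).
    apply: (integrable_le_bound _ (M := 2 * M)) => [|w].
      by apply: measurable_funM => //; exact: measurable_funB.
    have /andP[? ?] := chi01 L (S0 w).
    by rewrite ger0_norm ?mulr_ge0 ?subr_ge0// ler_piMr ?mulr_ge0// gerBl.
  have iG1c : P0.-integrable setT (EFin \o (fun w => G (S0 w) * (1 - chi L (S0 w)))).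
    apply: (integrable_le_bound _ (M := 2 * M)) => [|w].
      by apply: measurable_funM => //; exact: measurable_funB.
    have /andP[? ?] := chi01 L (S0 w); have /andP[? ?] := GM (S0 w).
    by rewrite ger0_norm ?mulr_ge0 ?subr_ge0// -[leRHS]mulr1 ler_pM ?subr_ge0// gerBl.
  exists (\int[P0]_w (G (S0 w) * (1 - chi L (S0 w)))).
    rewrite -RintegralD// -[X in _ - X](Rintegral_prob_cst P0) -RintegralB//.
      by apply: eq_Rintegral => w _; rewrite /G; ring.
    apply: (integrable_le_bound _ (M := 2 * M)) => [|w].
      apply: measurable_funD; apply: measurable_funM => //; exact: measurable_funB.
    rewrite -mulrDr addrC subrK mulr1.
    by have /andP[? ?] := GM (S0 w); rewrite ger0_norm.
  apply/andP; split.
    apply: Rintegral_ge0 => w _; rewrite mulr_ge0 ?subr_ge0//.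
      by have /andP[] := GM (S0 w).
    by have /andP[] := chi01 L (S0 w).
  rewrite -[X in X - _](Rintegral_prob_cst P0) -RintegralB// -RintegralZl//.
  apply: le_Rintegral_prob => // w.
  rewrite ler_wpM2r ?subr_ge0//; first by have /andP[] := chi01 L (S0 w).
  by have /andP[] := GM (S0 w).
have [b -> /andP[b0 b1]] := split0 _ _ Q S' mS'.
apply: filterS2 A1 A2 => k A1 A2.
have [bk -> /andP[bk0 bk1]] := split0 _ _ (P k) (@S k) (@mS k).
move: A1 A2 b1 bk1 HL; set a := \int[Q]_w _; set ak := \int[P k]_w (_ * _).
set c := \int[Q]_w _; set ck := \int[P k]_w _.
rewrite !ler_norml => /andP[A1 A1'] /andP[A2 A2'] b1 bk1 HL.
have M20 : 0 <= 2 * M by rewrite mulr_ge0.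
have h1 : 2 * M * (1 - c) <= 2 * M * e' by rewrite ler_wpM2l.
have h2 : 2 * M * (1 - ck) <= 2 * M * (2 * e') by rewrite ler_wpM2l//; lra.
have eE : e = e' * 2 + 6 * (M * e').
  by rewrite /e'; field; rewrite gt_eqF//; lra.
have Me : 0 <= M * e' by rewrite mulr_ge0// ltW.
apply/andP; split; lra.
Qed.

End convergence.
End levy.

(** * Surface measure and rotationally symmetric laws *)

Section orthogonal.
Context {R : realType} {p : nat}.

(** Reflection in the hyperplane orthogonal to v. At v = 0 the formula gives the identity, so
    [householder_swap] includes the case x = y. *)
Definition householder (v : 'cV[R]_p) : 'M[R]_p :=
  1%:M - (2 / dotv v v) *: (v *m v^T).

Lemma householderE v x : householder v *m x = x - (2 * dotv v x / dotv v v) *: v.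
Proof.
rewrite mulmxBl mul1mx -scalemxAl -mulmxA; congr (_ - _).
have -> : v^T *m x = (dotv v x)%:M by rewrite /dotv [LHS]mx11_scalar.
by rewrite mul_mx_scalar scalerA; congr (_ *: _); ring.
Qed.

Lemma householder_tr v : (householder v)^T = householder v.
Proof. by rewrite /householder linearB linearZ /= trmx1 trmx_mul trmxK. Qed.

Lemma householder_orth v : (householder v)^T *m householder v = 1%:M.
Proof.
rewrite householder_tr.
have [->|v0] := eqVneq v 0.
  by rewrite /householder mul0mx scaler0 subr0 mulmx1.
have vv : dotv v v != 0 by rewrite dotvv_eq0.
rewrite {2}/householder mulmxBr mulmx1 -scalemxAr mulmxA householderE.
rewrite mulfK// (_ : v - 2 *: v = - v); last by rewrite -{1}(scale1r v) -scalerBl (_ : 1 - 2 = -1) ?scaleN1r//; ring.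
by rewrite mulNmx scalerN opprK /householder subrK.
Qed.

(** Equal norms give 2 (x - y)'x = |x - y|^2, so the reflection subtracts exactly x - y from x. *)
Lemma householder_swap x y : dotv x x = dotv y y -> householder (x - y) *m x = y.
Proof.
move=> xy; have [->|] := eqVneq x y.
  by rewrite /householder subrr mul0mx scaler0 subr0 mul1mx.
rewrite -subr_eq0 => d0; have dd : dotv (x - y) (x - y) != 0 by rewrite dotvv_eq0.
rewrite householderE (_ : 2 * _ / _ = 1) ?scale1r ?subKr//.
rewrite -[RHS](divff dd); congr (_ / _).
by rewrite !(dotvBl, dotvBr) -xy (dotvC y x); ring.
Qed.

Lemma householder_fix v x : dotv v x = 0 -> householder v *m x = x.
Proof. by move=> vx; rewrite householderE vx mulr0 mul0r scale0r subr0. Qed.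

Lemma enorm_orth (H : 'M[R]_p) (x : 'cV[R]_p) : H^T *m H = 1%:M -> enorm (H *m x) = enorm x.
Proof. by move=> HH; rewrite /enorm mulmx_orth_dotv. Qed.

Lemma normalize_orth (H : 'M[R]_p) (x : 'cV[R]_p) :
  H^T *m H = 1%:M -> normalize (H *m x) = H *m normalize x.
Proof. by move=> HH; rewrite /normalize enorm_orth// scalemxAr. Qed.

End orthogonal.

(** * Integration over the sphere *)

Section cone.
Context {R : realType} {p : nat}.
Local Notation leb n := (@lebesgue_cV R n).
Local Open Scope ereal_scope.

Definition punctured_ball n : set 'cV[R]_n := [set x | (0 < enorm x <= 1)%R].
Arguments punctured_ball : clear implicits.

Lemma measurable_punctured_ball n : measurable (punctured_ball n).
Proof.
rewrite (_ : punctured_ball n = setT `&` @enorm R n @^-1` [set` `]0%R, 1%R]]).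
  exact: measurable_enorm.
by apply/seteqP; split => x /=; rewrite in_itv/= => // -[].
Qed.

(** Surface measure is the image under [normalize] of p times Lebesgue measure on the punctured
    ball. All later work on the sphere happens in the ball, where orthogonal invariance and slicing
    are available. *)
Lemma ge0_integral_surface (g : 'cV[R]_p -> \bar R) :
  measurable_fun setT g -> (forall x, 0 <= g x) ->
  \int[@surface_measure R p]_x g x =
  p%:R%:E * \int[leb p]_(x in punctured_ball p) g (normalize x).
Proof.
move=> mg g0; have mD := @measurable_punctured_ball p.
have -> : \int[@surface_measure R p]_x g x =
    \int[pushforward (mscale (NngNum (ler0n R p)) (mrestr (leb p) mD)) (@normalize R p)]_x g x.
  apply: eq_measure_integral => A mA _.
  rewrite /pushforward /mscale/=; congr (_ * lebesgue_cV p _).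
  by apply/seteqP; split => x [].
rewrite (ge0_integral_pushforward (@measurable_normalize R p))//.
have mgn : measurable_fun setT (g \o @normalize R p).
  by apply: (measurableT_comp mg); exact: measurable_normalize.
rewrite preimage_setT ge0_integral_mscale//=; congr (_ * _).
rewrite (@ge0_integral_density _ _ _ (leb p) _ \1_(punctured_ball p))//.
- rewrite [RHS]integral_mkcond epatch_indic; apply: eq_integral => x _ //.
- by move=> A mA; rewrite integral_indic// setIC.
Qed.

Lemma surface_density_integral (P : probability 'cV[R]_p R) (rho : 'cV[R]_p -> R) (g : 'cV[R]_p -> \bar R) :
  measurable_fun setT rho -> (forall x, 0 <= rho x)%R ->
  (forall A, measurable A -> P A = \int[@surface_measure R p]_(x in A) (rho x)%:E) ->
  measurable_fun setT g -> (forall x, 0 <= g x) ->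
  \int[P]_x g x = p%:R%:E * \int[leb p]_(x in punctured_ball p) (g (normalize x) * (rho (normalize x))%:E).
Proof.
move=> mrho rho0 PE mg g0.
rewrite (ge0_integral_density mrho rho0 PE)// (@ge0_integral_surface (fun x => g x * (rho x)%:E))//.
  by apply: emeasurable_funM => //; exact/measurable_EFinP.
by move=> x; rewrite mule_ge0// lee_fin.
Qed.

Lemma ge0_integral_ball_orth (H : 'M[R]_p) (g : 'cV[R]_p -> \bar R) :
  H^T *m H = 1%:M -> measurable_fun setT g -> (forall x, 0 <= g x) ->
  \int[leb p]_(x in punctured_ball p) g (H *m normalize x) =
  \int[leb p]_(x in punctured_ball p) g (normalize x).
Proof.
move=> HH mg g0; have mD := @measurable_punctured_ball p.
rewrite integral_mkcond [RHS]integral_mkcond.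
rewrite -[RHS](ge0_integral_lebesgue_cV_orth HH)//.
- apply: eq_integral => x _; rewrite !patchE.
  rewrite normalize_orth//; congr (if _ then _ else _); apply: asbool_equiv_eq.
  by rewrite /punctured_ball/= enorm_orth.
- apply/(measurable_restrictT _ mD); apply: measurable_funTS.
  by apply: (measurableT_comp mg); exact: measurable_normalize.
- by move=> x; rewrite patchE; case: ifP.
Qed.

End cone.


Section density_measure.
Context d (T : measurableType d) (R : realType).
Local Open Scope ereal_scope.
Variables (mu : {measure set T -> \bar R}) (h : T -> R).

(** The proofs are arguments so that the measure structure can be attached to the term itself. *)
Definition density_measure (_ : measurable_fun setT h) (_ : forall x, (0 <= h x)%R)
  (A : set T) : \bar R := \int[mu]_(x in A) (h x)%:E.

Hypotheses (mh : measurable_fun setT h) (h0 : forall x, (0 <= h x)%R).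
Local Notation nu := (density_measure mh h0).

Let nu0 : nu set0 = 0.
Proof. by rewrite /density_measure integral_set0. Qed.

Let nu_ge0 A : 0 <= nu A.
Proof. by apply: integral_ge0 => x _; rewrite lee_fin. Qed.

Let nu_sigma_additive : semi_sigma_additive nu.
Proof.
move=> F mF tF mUF; rewrite /density_measure ge0_integral_bigcup//.
- by apply: is_cvg_nneseries => n _ _; exact: nu_ge0.
- by apply/measurable_EFinP; exact: measurable_funTS.
- by move=> x _; rewrite lee_fin.
Qed.

HB.instance Definition _ := isMeasure.Build _ _ _ nu nu0 nu_ge0 nu_sigma_additive.

Lemma ge0_integral_density_measure (g : T -> \bar R) :
  measurable_fun setT g -> (forall x, 0 <= g x) ->
  \int[nu]_x g x = \int[mu]_x (g x * (h x)%:E).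
Proof. by move=> mg g0; exact: ge0_integral_density. Qed.

End density_measure.

Section FTC_is_derive.
Context {R : realType}.
Local Notation leb := (@lebesgue_measure R).

Lemma FTC_segment (F f : R -> R) (a b : R) : a < b ->
  (forall x, a <= x <= b -> is_derive x (1 : R) F (f x)) ->
  (forall x, a <= x <= b -> {for x, continuous f}) ->
  (\int[leb]_(x in `[a, b]) (f x)%:E = (F b - F a)%:E)%E.
Proof.
move=> ab dF cf.
have cF x : a <= x <= b -> {for x, continuous F}.
  move=> xab; apply: differentiable_continuous; apply/derivable1_diffP.
  by have := dF _ xab => ?; exact: ex_derive.
rewrite (@continuous_FTC2 _ f F)//.
- apply: continuous_in_subspaceT => x /set_mem/=; rewrite in_itv/=; exact: cf.
- split; [move=> x|apply: cvg_at_right_filter|apply: cvg_at_left_filter].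
  + rewrite in_itv/= => /andP[ax xb].
    by have := dF x; rewrite (ltW ax) (ltW xb) => /(_ isT) ?; exact: ex_derive.
  + by apply: cF; rewrite lexx ltW.
  + by apply: cF; rewrite lexx ltW.
- move=> x; rewrite in_itv/= => /andP[ax xb].
  have := dF x; rewrite (ltW ax) (ltW xb) => /(_ isT) ?.
  by rewrite derive1E; exact: derive_val.
Qed.

End FTC_is_derive.

(** * Slicing the ball along an axis *)

Section line_to_interval.
Context {R : realType}.
Local Notation leb := (@lebesgue_measure R).
Local Notation mR := (measurableTypeR R).

(** The cotangent of an angle as a function of its cosine; [psi] is its inverse, and [w] its
    derivative extended by 0 outside ]-1, 1[. *)
Let phi (s : R) : R := s * (1 - s ^+ 2) `^ (- (1 / 2)).
Let psi (x : R) : R := x * (1 + x ^+ 2) `^ (- (1 / 2)).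
Let w (s : R) : R := (\1_(`]-1, 1[%classic : set R) s) * (1 - s ^+ 2) `^ (- (3 / 2)).

Let w0 s : 0 <= w s.
Proof. by rewrite /w mulr_ge0// powR_ge0. Qed.

Let sq1 (s : R) : -1 < s < 1 -> 0 < 1 - s ^+ 2.
Proof. by move=> /andP[s1 s2]; rewrite subr_gt0 expr2; nra. Qed.

Let is_derive_phi (s : R) : -1 < s < 1 ->
  is_derive s (1:R) phi ((1 - s ^+ 2) `^ (- (3 / 2))).
Proof.
move=> /sq1 s0.
have d1 : is_derive s (1:R) (fun s => 1 - s ^+ 2) (- (2 * s)).
  by apply: is_derive_eq; rewrite /GRing.scale/=; ring.
have d2 := @is_derive1_powR R (- (1 / 2)) _ s0.
have d3 := @is_derive1_comp R (fun x : R => x `^ (- (1 / 2))) (fun s : R => 1 - s ^+ 2) _ _ _ d2 d1.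
have d4 := is_deriveM (@is_derive_id _ _ s (1 : R)) d3.
apply: (is_derive_eq d4).
rewrite /GRing.scale/=.
have e1 : (1 - s ^+ 2) `^ (- (1 / 2)) = (1 - s ^+ 2) * (1 - s ^+ 2) `^ (- (3 / 2)).
  rewrite -[X in _ = X * _](powRr1 (ltW s0)) -powRD; last by rewrite (gt_eqF s0) implybT.
  by congr (_ `^ _); field.
have e2 : - (1 / 2) - 1 = - (3 / 2) :> R by field.
by rewrite e2 e1; field.
Qed.

Let sqr_root (a : R) : 0 < a -> (a `^ (- (1 / 2))) ^+ 2 = a^-1.
Proof.
move=> a0; rewrite -powR_mulrn ?powR_ge0// -powRrM -(powR_inv1 (ltW a0)).
by congr (_ `^ _); field.
Qed.

Let root_inv (a : R) : 0 < a -> a `^ (- (1 / 2)) * (a^-1) `^ (- (1 / 2)) = 1.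
Proof.
by move=> a0; rewrite -powRM ?invr_ge0 ?ltW// divff ?gt_eqF// powR1.
Qed.

Let add1sq (x : R) : 0 < 1 + x ^+ 2.
Proof. by have := sqr_ge0 x; lra. Qed.

Let one_psi x : 1 - psi x ^+ 2 = (1 + x ^+ 2)^-1.
Proof.
have r0 := add1sq x.
by rewrite /psi exprMn sqr_root//; field; rewrite gt_eqF.
Qed.

Let one_phi s : -1 < s < 1 -> 1 + phi s ^+ 2 = (1 - s ^+ 2)^-1.
Proof.
move=> /sq1 r0.
by rewrite /phi exprMn sqr_root//; field; rewrite gt_eqF.
Qed.

Let psi_bound x : -1 < psi x < 1.
Proof.
have r0 := add1sq x.
have : 0 < 1 - psi x ^+ 2 by rewrite one_psi invr_gt0.
rewrite expr2 => h; apply/andP; split; nra.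
Qed.

Let psiK x : phi (psi x) = x.
Proof. by rewrite /phi one_psi /psi -mulrA root_inv ?mulr1. Qed.

Let phiK s : -1 < s < 1 -> psi (phi s) = s.
Proof.
by move=> s1; rewrite /psi one_phi// /phi -mulrA root_inv ?mulr1// sq1.
Qed.

Let cont_w (s : R) : -1 < s < 1 -> {for s, continuous (fun s : R => (1 - s ^+ 2) `^ (- (3 / 2)))}.
Proof.
move=> /sq1 s0; apply: differentiable_continuous; apply/derivable1_diffP.
have d1 : is_derive s (1:R) (fun s => 1 - s ^+ 2) (- (2 * s)).
  by apply: is_derive_eq; rewrite /GRing.scale/=; ring.
have d2 := @is_derive1_powR R (- (3 / 2)) _ s0.
have d3 := @is_derive1_comp R (fun x : R => x `^ (- (3 / 2))) (fun s : R => 1 - s ^+ 2) _ _ _ d2 d1.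
exact: (@ex_derive _ _ _ _ _ _ _ d3).
Qed.

Let integral_w s t : -1 < s -> s < t -> t < 1 ->
  (\int[leb]_(x in `[s, t]) ((1 - x ^+ 2) `^ (- (3 / 2)))%:E = (phi t - phi s)%:E)%E.
Proof.
move=> s1 st t1.
have in1 x : s <= x <= t -> -1 < x < 1.
  by move=> /andP[sx xt]; rewrite (lt_le_trans s1)// (le_lt_trans xt).
by apply: FTC_segment => // x /in1; [exact: is_derive_phi|exact: cont_w].
Qed.

Let phi_lt s t : -1 < s < 1 -> -1 < t < 1 -> s < t -> phi s < phi t.
Proof.
move=> s1 t1 st; rewrite lt_neqAle; apply/andP; split.
  apply/eqP => /(congr1 psi); rewrite !phiK// => e.
  by rewrite e ltxx in st.
rewrite -subr_ge0 -lee_fin -integral_w//; [|by case/andP: s1|by case/andP: t1].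
by apply: integral_ge0 => x _; rewrite lee_fin powR_ge0.
Qed.

Let phi_le s t : -1 < s < 1 -> -1 < t < 1 -> (phi s <= phi t) = (s <= t).
Proof.
move=> s1 t1; apply/idP/idP => st.
  by rewrite leNgt; apply/negP => /(phi_lt t1 s1); rewrite ltNge st.
by move: st; rewrite le_eqVlt => /predU1P[->//|/(phi_lt s1 t1)/ltW].
Qed.

Let psi_le a b : (psi a <= psi b) = (a <= b).
Proof. by rewrite -(phi_le (psi_bound a) (psi_bound b)) !psiK. Qed.

Let phi_itv s a b : -1 < s < 1 -> (phi s \in `]a, b]) = (s \in `]psi a, psi b]).
Proof.
move=> s1; rewrite !in_itv/=; congr (_ && _).
  by rewrite !ltNge; congr (~~ _); rewrite -[RHS](phi_le s1 (psi_bound a)) psiK.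
by rewrite -[RHS](phi_le s1 (psi_bound b)) psiK.
Qed.

Let msq (a : R) : measurable_fun setT ((fun s : R => (1 - s ^+ 2) `^ a) : mR -> R).
Proof.
apply: (@measurableT_comp _ _ _ _ _ _ (fun x : R => x `^ a)); first exact: measurable_powR.
by apply: measurable_funB => //; exact: measurable_funX.
Qed.

Let mphi : measurable_fun setT (phi : mR -> mR).
Proof. by apply: measurable_funM => //; exact: msq. Qed.

Let mw : measurable_fun setT (w : mR -> R).
Proof.
apply: measurable_funM; last exact: msq.
by apply: measurable_indic; exact: measurable_itv.
Qed.

(* Substitution x = s / sqrt(1 - s^2), under which s is the cosine of the angle
   between (x, 1) and the first axis. *)
Lemma ge0_integral_line_interval (g : R -> \bar R) :
  measurable_fun setT g -> (forall x, (0 <= g x)%E) ->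
  (\int[leb]_x g x =
   \int[leb]_(s in `](-1)%R, 1%R[) (g (s * (1 - s ^+ 2) `^ (- (1 / 2)))%R * ((1 - s ^+ 2) `^ (- (3 / 2)))%:E))%E.
Proof.
move=> mg g0.
pose nu := density_measure (leb : {measure set mR -> \bar R}) mw w0.
(* Checked on half-open intervals ]a, b]: inside ]-1, 1[ the preimage is ]psi a, psi b], over which
   the derivative of [phi] integrates to b - a. *)
have E : forall A, measurable A -> leb A = pushforward nu (phi : mR -> mR) A.
  move=> A mA; apply: lebesgue_measure_unique => //= _ [[a b] /= ab <-].
  rewrite lebesgue_measure_itv/= lte_fin.
  rewrite /pushforward /nu /density_measure.
  transitivity (\int[leb]_(x in `]psi a, psi b]) ((1 - x ^+ 2) `^ (- (3 / 2)))%:E)%E; last first.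
    rewrite [LHS]integral_mkcond [RHS]integral_mkcond; apply: eq_integral => s _.
    rewrite !patchE /w indicE.
    have [s1|s1] := boolP (s \in `]-1, 1[%classic); last first.
      rewrite mul0r if_same ifF//; apply: contraNF s1 => /set_mem/=; rewrite in_itv/= => /andP[as1 sb].
      rewrite inE/= in_itv/= (lt_trans _ as1) ?(le_lt_trans sb)//.
        by case/andP: (psi_bound b).
      by case/andP: (psi_bound a).
    move: s1; rewrite inE/= in_itv/= => s1.
    rewrite mul1r; congr (if _ then _ else _); apply: asbool_equiv_eq => /=.
    by rewrite -phi_itv.
  have [ba|ab'] := leP b a.
    rewrite set_itv_ge ?integral_set0//.
    by rewrite bnd_simp -leNgt psi_le.
  rewrite integral_itv_obnd_cbnd; last first.
    by apply/measurable_EFinP/measurable_funTS; exact: msq.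
  rewrite integral_w ?psiK//.
  - by case/andP: (psi_bound a).
  - by rewrite ltNge psi_le -ltNge.
  - by case/andP: (psi_bound b).
transitivity (\int[pushforward nu (phi : mR -> mR)]_x g x)%E.
  by apply: eq_measure_integral => A mA _; exact: E.
rewrite (ge0_integral_pushforward mphi)// preimage_setT.
rewrite (ge0_integral_density_measure _ mw w0 (g := g \o phi) (measurableT_comp mg mphi) (fun x => g0 _)).
rewrite [RHS]integral_mkcond; apply: eq_integral => s _.
rewrite patchE [w s]/w indicE; case: ifP => _.
  by rewrite [X in (_ * X%:E)%E = _]mul1r.
by rewrite mul0r mule0.
Qed.

End line_to_interval.

Section ball_coordinate.
Context {R : realType}.
Local Notation leb := (@lebesgue_measure R).
Local Notation mR := (measurableTypeR R).
Local Notation lebv n := (@lebesgue_cV R n).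
Local Open Scope ereal_scope.

(** The substitution a = |y| t degenerates at y = 0, so this point must be negligible. *)
Lemma lebesgue_cV_set0 n : (0 < n)%N -> lebv n [set 0%R] = 0.
Proof.
case: n => // n _; have := @lebesgue_cV_cube R n.+1 0 0 (lexx _).
rewrite subrr expr0n/= => e; rewrite -[RHS]e; congr (lebv _ _); apply/seteqP; split => x /=.
  by move=> -> i; rewrite mxE lexx.
move=> x0; apply/colP => i; rewrite mxE; apply/eqP; rewrite eq_le.
by have := x0 i; rewrite andbC.
Qed.

Lemma measurable_cV_set1 n (v : 'cV[R]_n) : measurable [set v].
Proof.
rewrite (_ : [set v] = \bigcap_(i in [set: 'I_n]) [set x : 'cV[R]_n | x i 0%R = v i 0%R]).
  apply: fin_bigcap_measurable; first exact: finite_finset.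
  move=> i _; rewrite (_ : [set _ | _] = setT `&` (fun x : 'cV[R]_n => x i 0%R) @^-1` [set v i 0%R]); last by rewrite setTI.
  exact: (@measurable_coord R n i).
apply/seteqP; split => x /=; first by move=> -> i.
by move=> xv; apply/colP => i; exact: xv.
Qed.

(** The factor |z| is the Jacobian of a = |y| t; this constant is what remains once the slices are
    rescaled to the unit ball. *)
Let coef n := \int[lebv n]_z (enorm z * \1_[set z : 'cV[R]_n | (enorm z <= 1)%R] z)%:E.

Let measurable_enorm_le n r : measurable [set z : 'cV[R]_n | (enorm z <= r)%R].
Proof.
rewrite (_ : [set _ | _] = setT `&` @enorm R n @^-1` [set` `]-oo, r]%R]).
  exact: measurable_enorm.
by apply/seteqP; split => x /=; rewrite in_itv/= => // -[].
Qed.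

Let mball n r : measurable_fun setT (fun z : 'cV[R]_n => enorm z * \1_[set z : 'cV[R]_n | (enorm z <= r)%R] z)%R.
Proof.
apply: measurable_funM; first exact: measurable_enorm.
by apply: measurable_indic; exact: measurable_enorm_le.
Qed.

(** Volume gives r^n and the integrand one more r. With r = sqrt(1 - s^2) and the Jacobian (1 -
    s^2)^(-3/2), the exponent becomes (p - 3)/2 for p = n + 1. *)
Let ball_scale n r : (0 < r)%R ->
  \int[lebv n]_z (enorm z * \1_[set z : 'cV[R]_n | (enorm z <= r)%R] z)%:E = (r ^+ n.+1)%:E * coef n.
Proof.
move=> r0; rewrite (ge0_integral_lebesgue_cV_scale r0).
- rewrite exprSr EFinM -muleA; congr (_ * _).
  rewrite -ge0_integralZl//.
  + apply: eq_integral => x _; rewrite !indicE enormZ (gtr0_norm r0) -EFinM mulrA.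
    by congr ((_ * (nat_of_bool _)%:R)%:E); apply: asbool_equiv_eq; rewrite /= enormZ (gtr0_norm r0) ger_pMr.
  + by apply/measurable_EFinP; exact: mball.
  + by move=> x _; rewrite lee_fin mulr_ge0 ?enorm_ge0.
  + by rewrite lee_fin ltW.
- by apply/measurable_EFinP; exact: mball.
- by move=> x; rewrite lee_fin mulr_ge0 ?enorm_ge0.
Qed.

Let enorm_cons n (a : R) (y : 'cV[R]_n) : dotv (cV_cons (a, y)) (cV_cons (a, y)) = (a ^+ 2 + dotv y y)%R.
Proof. by rewrite dotv_cV_cons expr2. Qed.

(* For x = (a, y), substitute a = |y| s / sqrt(1 - s^2): then s is the first
   coordinate of x/|x|, and |x| <= 1 iff |y| <= sqrt(1 - s^2). *)
Lemma ge0_integral_ball_coord n (Phi : R -> \bar R) : (0 < n)%N ->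
  measurable_fun setT Phi -> (forall s, 0 <= Phi s) ->
  \int[lebv n.+1]_(x in @punctured_ball R n.+1) Phi (normalize x ord0 0%R) =
  coef n * \int[leb]_(s in `](-1)%R, 1%R[) (Phi s * ((1 - s ^+ 2) `^ ((n.+1%:R - 3) / 2))%:E).
Proof.
move=> n0 mPhi Phi0.
have mD := @measurable_punctured_ball R n.+1.
pose g (x : 'cV[R]_n.+1) := Phi (normalize x ord0 0%R) * (\1_(@punctured_ball R n.+1) x)%:E.
have mg : measurable_fun setT g.
  apply: emeasurable_funM.
    apply: (measurableT_comp mPhi); apply: (measurableT_comp (@measurable_coord R n.+1 ord0)).
    exact: measurable_normalize.
  by apply/measurable_EFinP; exact: measurable_indic.
have g0 x : 0 <= g x by rewrite mule_ge0// lee_fin.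
transitivity (\int[lebv n.+1]_x g x).
  rewrite integral_mkcond epatch_indic//.
rewrite (ge0_integral_product_powerS_swap _ mg g0).
pose w (s : R) := (\1_(`]-1, 1[%classic : set R) s * (1 - s ^+ 2) `^ (- (3 / 2)))%R.
pose B : set (mR * 'cV[R]_n) := [set z | (enorm z.2 <= Num.sqrt (1 - z.1 ^+ 2))%R].
pose H (z : mR * 'cV[R]_n) := Phi z.1 * (w z.1 * (enorm z.2 * \1_B z))%:E.
have mp (a : R) : measurable_fun setT ((fun s : R => (1 - s ^+ 2) `^ a)%R : mR -> R).
  apply: (@measurableT_comp _ _ _ _ _ _ (fun x : R => (x `^ a)%R)); first exact: measurable_powR.
  by apply: measurable_funB => //; exact: measurable_funX.
have inner y : (y != 0)%R -> \int[leb]_a g (cV_cons (a, y)) = \int[leb]_s H (s, y).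
  move=> y0; have r0 : (0 < enorm y)%R by rewrite lt_neqAle eq_sym enorm_eq0 y0 enorm_ge0.
  have mgy : measurable_fun setT (fun a : mR => g (cV_cons (a, y))).
    by apply: (measurableT_comp mg); exact: (measurableT_comp (@measurable_cV_cons R n) (measurable_pair2 y)).
  rewrite (ge0_integral_scale r0 mgy); last by move=> a; exact: g0.
  rewrite (@ge0_integral_line_interval _ (fun t => g (cV_cons (enorm y * t, y)%R))); last 2 first.
  - apply: (measurableT_comp mgy).
    exact: (measurable_funM (measurable_cst _) (@measurable_id _ _ _)).
  - by move=> t; exact: g0.
  rewrite -ge0_integralZl//; last 3 first.
  - apply: measurable_funTS; apply: emeasurable_funM.
      apply: (measurableT_comp mgy).
      exact: (measurable_funM (measurable_cst _) (measurable_funM (@measurable_id _ _ _) (mp _))).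
    by apply/measurable_EFinP; exact: mp.
  - by move=> s _; rewrite mule_ge0// lee_fin powR_ge0.
  - by rewrite lee_fin ltW.
  rewrite integral_mkcond; apply: eq_integral => s _.
  rewrite patchE /H /= /w indicE; case: ifPn => [|_]; last by rewrite !mul0r mule0.
  rewrite inE/= in_itv/= => s1; rewrite mul1r.
  have a0 : (0 < 1 - s ^+ 2)%R by move/andP: s1 => [s1 s2]; rewrite subr_gt0 expr2; nra.
  have ra0 : (0 < Num.sqrt (1 - s ^+ 2))%R by rewrite sqrtr_gt0.
  set c := powR _ (- (3 / 2)).
  rewrite powRN powR12_sqrt ?ltW//.
  have e1 : enorm (cV_cons (enorm y * (s / Num.sqrt (1 - s ^+ 2)), y)%R) = (enorm y / Num.sqrt (1 - s ^+ 2))%R.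
    rewrite {1}/enorm enorm_cons -enorm_sqr.
    rewrite (_ : _ + _ = (enorm y / Num.sqrt (1 - s ^+ 2)) ^+ 2)%R ?sqrtr_sqr ?gtr0_norm ?divr_gt0//.
    have := sqr_sqrtr (ltW a0); move: (Num.sqrt _) ra0 => q q0 qE.
    rewrite !exprMn !exprVn qE; field; lra.
  have e2 : (normalize (cV_cons (enorm y * (s / Num.sqrt (1 - s ^+ 2)), y)%R)) ord0 0%R = s.
    rewrite mxE e1 mxE unlift_none/=; field.
    by rewrite !gt_eqF.
  rewrite /g e2 muleCA -muleA; congr (_ * _).
  rewrite -!EFinM; congr EFin; rewrite !indicE.
  rewrite (_ : (_ \in B) = (cV_cons (enorm y * (s / Num.sqrt (1 - s ^+ 2)), y)%R \in @punctured_ball R n.+1)); first by ring.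
  apply: asbool_equiv_eq; rewrite /punctured_ball /B/= e1.
  by rewrite divr_gt0//= ler_pdivrMr// mul1r.
have mB : measurable B.
  rewrite (_ : B = setT `&` (fun z : mR * 'cV[R]_n => (enorm z.2 <= Num.sqrt (1 - z.1 ^+ 2))%R) @^-1` [set true]).
    apply: measurable_fun_ler => //.
      exact: (measurableT_comp (@measurable_enorm R n) measurable_snd).
    apply: (@measurableT_comp _ _ _ _ _ _ (@Num.sqrt R)).
      by apply: continuous_measurable_fun; exact: sqrt_continuous.
    by apply: measurable_funB => //; apply: measurable_funX; exact: measurable_fst.
  by rewrite setTI; apply/seteqP; split => z /=.
have mw (a : R) : measurable_fun setT ((fun s : R => \1_(`]-1, 1[%classic : set R) s * (1 - s ^+ 2) `^ a)%R : mR -> R).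
  by apply: measurable_funM => //; apply: measurable_indic; exact: measurable_itv.
have mH : measurable_fun setT H.
  apply: emeasurable_funM; first exact: (measurableT_comp mPhi measurable_fst).
  apply/measurable_EFinP; apply: measurable_funM; first exact: (measurableT_comp (mw _) measurable_fst).
  apply: measurable_funM; last exact: measurable_indic.
  exact: (measurableT_comp (@measurable_enorm R n) measurable_snd).
have w0 a s : (0 <= \1_(`]-1, 1[%classic : set R) s * (1 - s ^+ 2) `^ a)%R by rewrite mulr_ge0// powR_ge0.
have H0 z : 0 <= H z.
  by rewrite mule_ge0// lee_fin mulr_ge0 ?w0// mulr_ge0 ?enorm_ge0.
transitivity (\int[lebv n]_y \int[leb]_s H (s, y)).
  apply: ge0_ae_eq_integral => //.
  - apply: (@measurable_fun_fubini_tonelli_G _ _ _ _ R leb (fun z => g (cV_cons z))) => //.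
    by apply: (measurableT_comp mg); exact: measurable_cV_cons.
  - exact: (@measurable_fun_fubini_tonelli_G _ _ _ _ R leb H).
  - by move=> y _; apply: integral_ge0.
  - by move=> y _; apply: integral_ge0.
  exists [set 0%R]; split; [exact: measurable_cV_set1|exact: lebesgue_cV_set0|].
  move=> y /= h; apply/eqP; apply: contra_notT h => y0 _; exact: inner.
rewrite -(fubini_tonelli H)//.
transitivity (\int[leb]_s (coef n * (Phi s * (\1_(`]-1, 1[%classic : set R) s * (1 - s ^+ 2) `^ ((n.+1%:R - 3) / 2))%:E))).
  apply: eq_integral => s _.
  rewrite /H/= /w indicE; have [|_] := boolP (s \in _); last first.
    by under eq_integral do rewrite !mul0r mule0; rewrite integral0 mul0r !mule0.
  rewrite inE/= in_itv/= => s1; rewrite !mul1r.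
  have a0 : (0 < 1 - s ^+ 2)%R by move/andP: s1 => [s1 s2]; rewrite subr_gt0 expr2; nra.
  have ra0 : (0 < Num.sqrt (1 - s ^+ 2))%R by rewrite sqrtr_gt0.
  under eq_integral do rewrite EFinM.
  have mHs : measurable_fun setT (fun y : 'cV[R]_n => (enorm y * \1_B (s, y))%:E).
    apply/measurable_EFinP; apply: measurable_funM; first exact: measurable_enorm.
    exact: (measurableT_comp (measurable_indic mB) (measurable_pair1 s)).
  have Hs0 (y : 'cV[R]_n) : 0 <= (enorm y * \1_B (s, y))%:E by rewrite lee_fin mulr_ge0 ?enorm_ge0.
  rewrite ge0_integralZl//; last 2 first.
  - exact: emeasurable_funM.
  - by move=> y _; rewrite mule_ge0// lee_fin powR_ge0.
  rewrite ge0_integralZl//; last first.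
  - by rewrite lee_fin powR_ge0.
  rewrite -[X in _ * (_ * X)](_ : \int[lebv n]_z (enorm z * \1_[set z : 'cV[R]_n | (enorm z <= Num.sqrt (1 - s ^+ 2))%R] z)%:E = _); last first.
    by apply: eq_integral => y _; rewrite !indicE.
  rewrite ball_scale// [RHS]muleCA; congr (_ * _).
  rewrite muleA muleC -EFinM; congr (_ * (_)%:E).
  rewrite -powR12_sqrt ?ltW// -[X in (_ * X)%R](powR_mulrn _ (powR_ge0 _ _)) -powRrM -powRD; last by rewrite (gt_eqF a0) implybT.
  by congr powR; field.
rewrite ge0_integralZl//.
- congr (_ * _); rewrite [RHS]integral_mkcond epatch_indic; apply: eq_integral => s _.
  by rewrite EFinM muleAC muleA -muleA.
- by apply: emeasurable_funM => //; apply/measurable_EFinP; exact: mw.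
- by move=> s _; rewrite mule_ge0// lee_fin.
- by apply: integral_ge0 => z _; rewrite lee_fin mulr_ge0 ?enorm_ge0.
Qed.

End ball_coordinate.

Lemma Rintegral_sum d (T : measurableType d) (R : realType)
    (mu : {measure set T -> \bar R}) (I : Type) (s : seq I) (f : I -> T -> R) :
  (forall i, mu.-integrable setT (EFin \o f i)) ->
  \int[mu]_x (\sum_(i <- s) f i x) = \sum_(i <- s) \int[mu]_x f i x.
Proof.
move=> fi; suff [//] : mu.-integrable setT (EFin \o (fun x => \sum_(i <- s) f i x)) /\
  \int[mu]_x (\sum_(i <- s) f i x) = \sum_(i <- s) \int[mu]_x f i x.
elim: s => [|i s [IH1 IH2]].
  rewrite big_nil; split.
    by under eq_fun do rewrite big_nil; exact: integrable0.
  under eq_Rintegral do rewrite big_nil.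
  by rewrite /Rintegral integral0.
rewrite big_cons -IH2; split.
  under eq_fun do rewrite big_cons.
  by have := integrableD measurableT (fi i) IH1; apply: eq_integrable.
under eq_Rintegral do rewrite big_cons.
by rewrite RintegralD.
Qed.

(** * Symmetries and marginal of the law of one observation *)

Section rotsym_law.
Context {R : realType} {p : nat} d (Omega : measurableType d) (P : probability Omega R).
Local Notation leb := (@lebesgue_measure R).
Variables (theta : 'cV[R]_p) (F : R -> R) (X : {RV P >-> 'cV[R]_p}).
Hypotheses (theta1 : dotv theta theta = 1) (mF : measurable_fun setT F)
  (F0 : forall s, 0 <= F s) (X1 : forall w, dotv (X w) (X w) = 1)
  (dX : forall A, measurable A ->
    (distribution P X A = \int[@surface_measure R p]_(x in A) (F (dotv x theta))%:E)%E).
Local Open Scope ereal_scope.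

Let mFd : measurable_fun setT (fun x => F (dotv x theta)).
Proof. by apply: (measurableT_comp mF); exact: measurable_dotv. Qed.

Let integral_lawE (g : 'cV[R]_p -> \bar R) :
  measurable_fun setT g -> (forall x, 0 <= g x) ->
  \int[P]_w g (X w) = p%:R%:E * \int[@lebesgue_cV R p]_(x in @punctured_ball R p)
    (g (normalize x) * (F (dotv (normalize x) theta))%:E).
Proof.
move=> mg g0.
rewrite -(surface_density_integral (rho := fun x => F (dotv x theta)) (P := distribution P X))//.
by rewrite -(ge0_integral_distribution X mg).
Qed.

(** A reflection carries the first axis to theta, after which the ball is sliced along that axis.
    The constant does not depend on [Phi]. *)
Lemma rotsym_law_dot : (2 <= p)%N -> exists2 C : R, (0 < C)%R &
  forall Phi : R -> \bar R, measurable_fun setT Phi -> (forall s, 0 <= Phi s) ->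
  \int[P]_w Phi (dotv (X w) theta) =
  C%:E * \int[leb]_(s in `](-1)%R, 1%R[) (Phi s * (F s * (1 - s ^+ 2) `^ ((p%:R - 3) / 2))%:E).
Proof.
case: p theta X theta1 X1 dX mFd integral_lawE => [//|[//|n]] t Y t1 Y1 dY mFt lawE _.
pose e1 : 'cV[R]_n.+2 := delta_mx ord0 0%R.
have e1dot x : dotv x e1 = x ord0 0%R.
  rewrite dotvE (bigD1 ord0)//= mxE !eqxx mulr1 big1 ?addr0// => i i0.
  by rewrite mxE (negbTE i0) mulr0.
have tt : dotv e1 e1 = dotv t t by rewrite e1dot t1 mxE !eqxx.
have HH := householder_orth (e1 - t)%R.
have He := householder_swap tt.
set H := householder _ in HH He.
have Hdot x : dotv (H *m x) t = x ord0 0%R by rewrite -{1}He (mulmx_orth_dotv HH) e1dot.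
pose Kn := n.+2%:R%:E * \int[@lebesgue_cV R n.+1]_z (enorm z * \1_[set z : 'cV[R]_n.+1 | (enorm z <= 1)%R] z)%:E.
have law Phi : measurable_fun setT Phi -> (forall s, 0 <= Phi s) ->
  \int[P]_w Phi (dotv (Y w) t) =
  Kn * \int[leb]_(s in `](-1)%R, 1%R[) (Phi s * (F s * (1 - s ^+ 2) `^ ((n.+2%:R - 3) / 2))%:E).
  move=> mPhi Phi0; rewrite (lawE (fun x => Phi (dotv x t)))//; last first.
    by apply: (measurableT_comp mPhi); exact: measurable_dotv.
  rewrite -(ge0_integral_ball_orth (g := fun x => Phi (dotv x t) * (F (dotv x t))%:E) HH); last 2 first.
  - apply: emeasurable_funM; first by apply: (measurableT_comp mPhi); exact: measurable_dotv.
    by apply/measurable_EFinP.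
  - by move=> x; rewrite mule_ge0// lee_fin.
  under eq_integral do rewrite Hdot.
  rewrite (@ge0_integral_ball_coord _ n.+1 (fun s => Phi s * (F s)%:E))//; last 2 first.
  - by apply: emeasurable_funM => //; exact/measurable_EFinP.
  - by move=> x; rewrite mule_ge0// lee_fin.
  rewrite muleA; congr (_ * _); apply: eq_integral => s _.
  by rewrite EFinM muleA.
(* Total mass one says that the constant times the mass integral is 1, which rules out both 0 and
   +oo for the constant. *)
have := law (cst 1) (measurable_cst _) (fun=> lee01).
rewrite integral_cst// mul1e [X in X = _]probability_setT.
under eq_integral do rewrite mul1e.
set I := \int[leb]_(_ in _) _ => KI.
have Kn0 : 0 <= Kn.
  rewrite mule_ge0// ?lee_fin//; apply: integral_ge0 => z _.
  by rewrite lee_fin mulr_ge0 ?enorm_ge0.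
have I0 : 0 <= I.
  by apply: integral_ge0 => s _; rewrite lee_fin mulr_ge0// powR_ge0.
have : 0 < Kn.
  rewrite lt_neqAle Kn0 andbT; apply/eqP => K0; move: KI; rewrite -K0 mul0e => /eqP.
  by rewrite eqe oner_eq0.
have : Kn < +oo.
  rewrite ltey; apply/eqP => Koo; move: KI; rewrite Koo.
  move: I0; rewrite le_eqVlt => /predU1P[<-|I0].
    by rewrite mule0 => /eqP; rewrite eqe oner_eq0.
  by rewrite gt0_mulye.
case: Kn law {KI Kn0} => // C law _ C0.
by exists C.
Qed.

(** The density depends on x through x'theta = (Hx)'(H theta) = (Hx)'theta, and the ball integral
    representing the law is invariant under [H]. *)
Lemma rotsym_law_orth (H : 'M[R]_p) (g : 'cV[R]_p -> R) :
  H^T *m H = 1%:M -> H *m theta = theta -> measurable_fun setT g ->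
  (\int[P]_w g (H *m X w) = \int[P]_w g (X w))%R.
Proof.
move=> HH Ht mg; congr fine.
have mgE : measurable_fun setT (EFin \o g) by exact/measurable_EFinP.
have ge0 (h : 'cV[R]_p -> \bar R) : measurable_fun setT h -> (forall x, 0 <= h x) ->
    \int[P]_w h (H *m X w) = \int[P]_w h (X w).
  move=> mh h0.
  have mH : measurable_fun setT (fun x : 'cV[R]_p => H *m x) by exact: measurable_mulmx.
  rewrite (integral_lawE (g := fun x => h (H *m x)))//; last exact: measurableT_comp.
  rewrite integral_lawE//; congr (_ * _).
  rewrite -[RHS](ge0_integral_ball_orth HH (g := fun x => h x * (F (dotv x theta))%:E)).
  - by apply: eq_integral => x _; rewrite -[in RHS]Ht mulmx_orth_dotv.
  - by apply: emeasurable_funM => //; apply/measurable_EFinP.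
  - by move=> x; rewrite mule_ge0// lee_fin.
rewrite integralE [RHS]integralE; congr (_ - _).
  have e (Y : Omega -> 'cV[R]_p) : \int[P]_w (fun w => (g (Y w))%:E)^\+ w = \int[P]_w (funepos (EFin \o g)) (Y w).
    by apply: eq_integral => w _; rewrite !funeposE.
  by rewrite !e ge0//; exact: measurable_funepos.
have e (Y : Omega -> 'cV[R]_p) : \int[P]_w (fun w => (g (Y w))%:E)^\- w = \int[P]_w (funeneg (EFin \o g)) (Y w).
  by apply: eq_integral => w _; rewrite !funenegE.
by rewrite !e ge0//; exact: measurable_funeneg.
Qed.

Local Close Scope ereal_scope.

Let mdX v : measurable_fun setT (fun w => dotv v (X w)).
Proof. by apply: measurable_dotv => //; exact: measurable_funP. Qed.

(* The reflection of v fixes theta and maps v to -v, which kills the sine part. *)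
Lemma rotsym_cos v c : dotv v theta = 0 ->
  \int[P]_w cos (dotv v (X w) + c) = cos c * \int[P]_w cos (dotv v (X w)).
Proof.
move=> vt.
(* The map used is minus the reflection along theta: it fixes theta and negates its whole orthogonal
   complement. Averaging cos(x + c) and cos(-x + c) then leaves cos c cos x. *)
have trN : (- householder theta)^T = - householder theta.
  by rewrite -[in RHS]householder_tr; apply/matrixP => i j; rewrite !mxE.
have HH : (- householder theta)^T *m (- householder theta) = 1%:M.
  by rewrite trN mulNmx mulmxN opprK -{1}householder_tr householder_orth.
have Ht : (- householder theta) *m theta = theta.
  rewrite mulNmx householderE theta1 mulr1 divr1.
  by apply/colP => i; rewrite !mxE; ring.
have Hv : (- householder theta)^T *m v = - v.
  by rewrite trN mulNmx householder_fix// dotvC.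
have := rotsym_law_orth (g := fun x => cos (dotv v x + c)) HH Ht.
under eq_Rintegral do rewrite dotv_mulmxr Hv dotvNl.
move=> /(_ _) e.
have ic a : P.-integrable setT (EFin \o (fun w => cos (dotv v (X w) + a))).
  exact: integrable_cos.
have ic' : P.-integrable setT (EFin \o (fun w => cos (- dotv v (X w) + c))).
  apply: (@integrable_cos R _ _ P (fun w => - dotv v (X w))).
  by have := mdX (- v); under eq_fun do rewrite dotvNl.
apply: (@mulfI _ 2); first by rewrite pnatr_eq0.
rewrite mulr2n mulrDl mul1r -{1}e; last first.
  apply: measurableT_comp; first exact: measurable_cos.
  by apply: measurable_funD => //; exact: measurable_dotvr.
rewrite -RintegralD// mulrA -RintegralZl//; last first.
  by have := ic 0; under eq_fun do rewrite addr0.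
apply: eq_Rintegral => w _; rewrite !cosD cosN sinN; ring.
Qed.

Let iV v : P.-integrable setT (EFin \o (fun w => dotv v (X w) ^+ 2)).
Proof.
apply: (integrable_le_bound _ (M := dotv v v)).
  by apply: measurable_funX; exact: mdX.
by move=> w; rewrite ger0_norm ?sqr_ge0// (le_trans (dotv_CS _ _))// X1 mulr1.
Qed.

(* Reflections show that E(v' X)^2 / |v|^2 is the same for all v orthogonal to
   theta; sum over the projections of the canonical basis. *)
Lemma rotsym_sqr v : dotv v theta = 0 ->
  (p%:R - 1) * \int[P]_w (dotv v (X w) ^+ 2) =
  dotv v v * \int[P]_w (1 - dotv (X w) theta ^+ 2).
Proof.
pose V v := \int[P]_w (dotv v (X w) ^+ 2).
have VZ c u : V (c *: u) = c ^+ 2 * V u.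
  rewrite /V -(RintegralZl _ _ (iV u))//; apply: eq_Rintegral => w _.
  by rewrite dotvZl exprMn.
have Vswap u u' : dotv u theta = 0 -> dotv u' theta = 0 -> dotv u u = dotv u' u' -> V u = V u'.
  move=> ut ut' uu.
  have HH := householder_orth (u - u').
  have Ht : householder (u - u') *m theta = theta.
    by rewrite householder_fix// dotvBl ut ut' subrr.
  rewrite /V -(rotsym_law_orth (g := fun x => dotv u x ^+ 2) HH Ht).
    apply: eq_Rintegral => w _.
    by rewrite dotv_mulmxr householder_tr householder_swap.
  by apply: measurable_funX; exact: measurable_dotvr.
have VV u u' : dotv u theta = 0 -> dotv u' theta = 0 -> dotv u' u' * V u = dotv u u * V u'.
  move=> ut ut'; rewrite -!enorm_sqr -!VZ; apply: Vswap.
  - by rewrite dotvZl ut mulr0.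
  - by rewrite dotvZl ut' mulr0.
  - by rewrite !dotvZl !dotvZr -!enorm_sqr; ring.
move=> vt.
pose e i : 'cV[R]_p := delta_mx i 0 - theta i 0 *: theta.
have edot i x : dotv (e i) x = x i 0 - theta i 0 * dotv x theta.
  rewrite /e dotvBl dotvZl (dotvC theta); congr (_ - _).
  rewrite dotvE (bigD1 i)//= mxE !eqxx mul1r big1 ?addr0// => j ji.
  by rewrite mxE (negbTE ji) mul0r.
have et i : dotv (e i) theta = 0 by rewrite edot theta1 mulr1 subrr.
have sumsq x : \sum_i (dotv (e i) x) ^+ 2 = dotv x x - dotv x theta ^+ 2.
  transitivity (\sum_i (x i 0 * x i 0 + (- 2 * dotv x theta) * (x i 0 * theta i 0) +
      dotv x theta ^+ 2 * (theta i 0 * theta i 0))).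
    by apply: eq_bigr => i _; rewrite edot; ring.
  by rewrite !big_split/= -!mulr_sumr -!dotvE theta1; ring.
(* The trace of the projection orthogonal to theta, where the factor p - 1 comes from. *)
have sumee : \sum_i dotv (e i) (e i) = p%:R - 1.
  under eq_bigr do rewrite edot et mulr0 subr0 !mxE eqxx/=.
  rewrite sumrB sumr_const card_ord; congr (_ - _).
  by rewrite -theta1 dotvE.
rewrite -sumee mulr_suml; under eq_bigr => i _ do rewrite VV//.
rewrite -mulr_sumr; congr (_ * _).
rewrite /V -Rintegral_sum//.
transitivity (\int[P]_w \sum_i (dotv (e i) (X w) ^+ 2)) => //.
by apply: eq_Rintegral => w _; rewrite sumsq X1.
Qed.

End rotsym_law.

(** * Asymptotics of the law of theta' X *)

Section integrable_EFin.
Context d (T : measurableType d) (R : realType) (mu : {measure set T -> \bar R}).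
Variables (D : set T) (mD : measurable D).

Lemma integrable_EFinZl (k : R) (f : T -> R) : mu.-integrable D (EFin \o f) ->
  mu.-integrable D (EFin \o (fun x => k * f x)).
Proof. by move=> fi; have := integrableZl mD k fi; apply: eq_integrable. Qed.

Lemma integrable_EFinD (f g : T -> R) : mu.-integrable D (EFin \o f) ->
  mu.-integrable D (EFin \o g) -> mu.-integrable D (EFin \o (fun x => f x + g x)).
Proof. by move=> fi gi; have := integrableD mD fi gi; apply: eq_integrable. Qed.

Lemma integrable_EFinB (f g : T -> R) : mu.-integrable D (EFin \o f) ->
  mu.-integrable D (EFin \o g) -> mu.-integrable D (EFin \o (fun x => f x - g x)).
Proof. by move=> fi gi; have := integrableB mD fi gi; apply: eq_integrable. Qed.

End integrable_EFin.

(** * Moments under the exponential weight *)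

Section tilted_jacobi.
Context {R : realType}.
Local Notation leb := (@lebesgue_measure R).
Local Notation mR := (measurableTypeR R).
Local Notation D := (`]-1, 1[%classic : set R).

(** The ultraspherical weight, used with a = (p - 3)/2. For p = 2 the exponent is -1/2 and the
    weight is singular at both ends, hence the exhaustion by compact intervals below. *)
Definition jacobi (a s : R) : R := (1 - s ^+ 2) `^ a.

Lemma jacobi_ge0 a s : 0 <= jacobi a s. Proof. exact: powR_ge0. Qed.

Lemma onem_sqr_gt0 (s : R) : -1 < s < 1 -> 0 < 1 - s ^+ 2.
Proof. by move=> /andP[s1 s2]; rewrite subr_gt0 expr2; nra. Qed.

Lemma jacobiS a s : -1 < s < 1 -> jacobi (a + 1) s = (1 - s ^+ 2) * jacobi a s.
Proof.
move=> /onem_sqr_gt0 s0; rewrite /jacobi powRD; last by rewrite (gt_eqF s0) implybT.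
by rewrite powRr1 ?ltW// mulrC.
Qed.

Lemma measurable_jacobi a : measurable_fun setT (jacobi a).
Proof.
apply: (@measurableT_comp _ _ _ _ _ _ (fun x : R => x `^ a)); first exact: measurable_powR.
by apply: measurable_funB => //; exact: measurable_funX.
Qed.

Lemma is_derive_jacobi (a s : R) : -1 < s < 1 -> is_derive s (1 : R) (jacobi a) (- (2 * a) * s * jacobi (a - 1) s).
Proof.
move=> /onem_sqr_gt0 s0.
have d1 : is_derive s (1:R) (fun s => 1 - s ^+ 2) (- (2 * s)).
  by apply: is_derive_eq; rewrite /GRing.scale/=; ring.
have d2 := @is_derive1_powR R a _ s0.
have d3 := @is_derive1_comp R (fun x : R => x `^ a) (fun s : R => 1 - s ^+ 2) _ _ _ d2 d1.
by apply: (is_derive_eq d3); rewrite /jacobi; ring.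
Qed.

Lemma continuous_jacobi (a s : R) : -1 < s < 1 -> {for s, continuous (jacobi a)}.
Proof.
move=> /(is_derive_jacobi a) d; apply: differentiable_continuous; apply/derivable1_diffP.
exact: ex_derive.
Qed.

(** The shift by 2 gives b_0 = 1/2, so that no interval of the exhaustion is degenerate. *)
Let b_ (n : nat) : R := 1 - n.+2%:R^-1.
Let I_ n : set R := `[- b_ n, b_ n].

Let mI n : measurable (I_ n : set mR).
Proof. exact: measurable_itv. Qed.

Let b_bound n : 0 < b_ n < 1.
Proof.
rewrite /b_ subr_gt0 invf_lt1 ?ltr0n// ltr1n/= ltrBlDr ltrDl invr_gt0 ltr0n//.
Qed.

Let b_ge n : - b_ n < b_ n.
Proof. by have /andP[b0 _] := b_bound n; lra. Qed.

Let I_D n s : - b_ n <= s <= b_ n -> -1 < s < 1.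
Proof. by have /andP[b0 b1] := b_bound n; move=> /andP[? ?]; apply/andP; split; lra. Qed.

Let D_I s : D s -> \forall n \near \oo, I_ n s.
Proof.
rewrite /= in_itv/= -ltr_norml => s1.
have s0 : 0 < 1 - `|s| by rewrite subr_gt0.
near=> n; rewrite /I_/= in_itv/= -ler_norml /b_ lerBrDr -lerBrDl.
rewrite -[leRHS]invrK lef_pV2 ?posrE ?invr_gt0 ?ltr0n//.
near: n; exists (Num.truncn (1 - `|s|)^-1) => // n /= xn.
by rewrite (le_trans (ltW (truncnS_gt _)))// ler_nat ltnS ltnW.
Unshelve. all: by end_near. Qed.

Let I_nd : nondecreasing_seq I_.
Proof.
move=> m n mn; apply/subsetPset => s; rewrite /I_/= !in_itv/= -!ler_norml => /le_trans; apply.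
by rewrite lerB// lef_pV2 ?posrE ?ltr0n// ler_nat !ltnS.
Qed.

Let bigcup_I : \bigcup_n I_ n = D.
Proof.
apply/seteqP; split => s.
  by move=> [n _ /=]; rewrite !in_itv/=; exact: I_D.
by move=> /D_I[n _ /(_ n (leqnn _)) Is]; exists n.
Qed.

Let jacobi_b a n : jacobi a (- b_ n) = jacobi a (b_ n).
Proof. by rewrite /jacobi sqrrN. Qed.

Let FTC_I (F f : R -> R) (n : nat) :
  (forall x : R, -1 < x < 1 -> is_derive x (1 : R) F (f x)) ->
  (forall x : R, -1 < x < 1 -> {for x, continuous f}) ->
  (\int[leb]_(x in I_ n) (f x)%:E = (F (b_ n) - F (- b_ n))%:E)%E.
Proof.
by move=> dF cf; apply: FTC_segment => // x /I_D; [exact: dF|exact: cf].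
Qed.

Lemma cvg_jacobi_endpoint a : 0 < a -> jacobi a (1 - n.+2%:R^-1) @[n --> \oo] --> 0.
Proof.
move=> a0; have /cvg_at_rightP := powR_cvg0 a0.
move=> /(_ (fun n => 1 - b_ n ^+ 2)); apply; split.
  move=> n; have /andP[b0 b1] := b_bound n; apply: onem_sqr_gt0.
  by rewrite b1 andbT (lt_trans _ b0).
rewrite -[X in _ --> X](subrr (1 : R)); apply: cvgB; first exact: cvg_cst.
rewrite -[X in _ --> X](expr1n R 2); rewrite expr2; under eq_fun do rewrite expr2.
apply: cvgM; (rewrite -[X in _ --> X](subr0 (1 : R)); apply: cvgB; first exact: cvg_cst);
  by have := @cvg_harmonic R; rewrite -cvg_shiftS.
Qed.

Lemma FTC_open (H h : R -> R) :
  (forall x : R, -1 < x < 1 -> is_derive x (1 : R) H (h x)) ->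
  (forall x : R, -1 < x < 1 -> {for x, continuous h}) ->
  leb.-integrable D (EFin \o h) ->
  H (1 - n.+2%:R^-1) @[n --> \oo] --> 0 -> H (- (1 - n.+2%:R^-1)) @[n --> \oo] --> 0 ->
  \int[leb]_(x in D) h x = 0.
Proof.
move=> dH ch hi Hp Hn.
have cI : \int[leb]_(x in I_ n) h x @[n --> \oo] --> \int[leb]_(x in D) h x.
  exact: cvg_Rintegral_exhaustion.
rewrite -(cvg_lim _ cI)//; apply: cvg_lim => //.
under eq_fun do rewrite /Rintegral (FTC_I _ dH ch)//.
by have := cvgB Hp Hn; rewrite subr0; exact.
Qed.

(** The derivative of s (1 - s^2)^(a+1) is (2a+3)(1 - s^2)^(a+1) - (2a+2)(1 - s^2)^a. Its boundary
    terms on a symmetric interval are nonnegative and (1 - s^2)^(a+1) is at most 1, which bounds the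
    truncated integrals by [M]. *)
Lemma integrable_jacobi a : -1 < a -> leb.-integrable D (EFin \o jacobi a).
Proof.
move=> a1; apply/integrableP; split.
  by apply/measurable_EFinP; apply: measurable_funTS; exact: measurable_jacobi.
under eq_integral do rewrite /= ger0_norm ?jacobi_ge0//.
have mjI n b : measurable_fun (I_ n) (fun s => (jacobi b s)%:E).
  by apply/measurable_EFinP; apply: measurable_funTS; exact: measurable_jacobi.
have c : (\int[leb]_(x in I_ n) (jacobi a x)%:E @[n --> \oo] --> \int[leb]_(x in D) (jacobi a x)%:E)%E.
  rewrite -bigcup_I; apply: (@ge0_nondecreasing_set_cvg_integral _ mR R I_ (fun s => (jacobi a s)%:E) leb I_nd) => //.
  - by move=> n; exact: mjI.
  - by move=> n x _; rewrite lee_fin jacobi_ge0.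
pose M := (2 * a + 3) * 2 / (2 * a + 2).
apply: (@le_lt_trans _ _ M%:E); last exact: ltry.
rewrite -(cvg_lim _ c)//; apply: lime_le; first by apply/cvg_ex; eexists; exact: c.
near=> n.
pose h s := (2 * a + 3) * jacobi (a + 1) s - (2 * a + 2) * jacobi a s.
have dh (x : R) : -1 < x < 1 -> is_derive x (1 : R) (fun s => s * jacobi (a + 1) s) (h x).
  move=> x1; have d := is_deriveM (@is_derive_id _ _ x (1 : R)) (is_derive_jacobi (a + 1) x1).
  apply: (is_derive_eq d); rewrite /h /GRing.scale/= addrK jacobiS//; ring.
have ch (x : R) : -1 < x < 1 -> {for x, continuous h}.
  move=> x1; apply: cvgB; (apply: cvgM; [exact: cvg_cst|exact: continuous_jacobi]).
have [b0 b1] : 0 < b_ n /\ b_ n < 1 by apply/andP.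
have iI e : leb.-integrable (I_ n) (EFin \o jacobi e).
  apply: continuous_compact_integrable; first exact: segment_compact.
  by apply: continuous_in_subspaceT => x /set_mem; rewrite /I_/= in_itv/= => /I_D; exact: continuous_jacobi.
have mIn := mI n.
have := FTC_I n dh ch.
rewrite -EFin_Rintegral//; last first.
  by apply: integrable_EFinB => //; exact: integrable_EFinZl.
rewrite /h RintegralB//; [|exact: integrable_EFinZl|exact: integrable_EFinZl].
rewrite !RintegralZl// -EFin_Rintegral// jacobi_b => -[].
have B2 : \int[leb]_(x in I_ n) jacobi (a + 1) x <= 2.
  apply: (@le_trans _ _ (\int[leb]_(x in I_ n) 1)).
    apply: le_Rintegral => //.
      by have := iI 0; apply: eq_integrable => // x _; rewrite /= /jacobi powRr0.
    move=> x; rewrite /I_/= in_itv/= => /I_D x1; have := onem_sqr_gt0 x1 => x0.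
    suff : jacobi (a + 1) x <= 1 `^ (a + 1) by rewrite powR1.
    apply: ge0_ler_powR; rewrite ?nnegrE//; [lra|exact: ltW|].
    by rewrite gerBl sqr_ge0.
  rewrite Rintegral_cst// mul1r.
  have -> : fine (leb (I_ n)) = b_ n - - b_ n.
    by rewrite /I_/= lebesgue_measure_itv/= lte_fin b_ge.
  lra.
have := jacobi_ge0 (a + 1) (b_ n).
set A := (\int[leb]_(x in I_ n) jacobi a x); set B := (\int[leb]_(x in I_ n) jacobi (a + 1) x) in B2 *.
move=> j0 e; rewrite lee_fin /M ler_pdivlMr; last by lra.
nra.
Unshelve. all: by end_near. Qed.


Lemma integrable_jacobiM (a M : R) (g : R -> R) : -1 < a -> measurable_fun setT g ->
  (forall s, -1 < s < 1 -> `|g s| <= M) ->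
  leb.-integrable D (EFin \o (fun s => g s * jacobi a s)).
Proof.
move=> a1 mg gM.
have iM : leb.-integrable D (EFin \o (fun s => M * jacobi a s)).
  by apply: integrable_EFinZl => //; exact: integrable_jacobi.
apply: le_integrable iM => //.
  apply/measurable_EFinP; apply: measurable_funTS; apply: measurable_funM => //.
  exact: measurable_jacobi.
move=> s /=; rewrite in_itv/= => s1; rewrite lee_fin !normrM ler_wpM2r//.
by rewrite (le_trans (gM _ s1))// ler_norm.
Qed.

Definition tilt (l s : R) : R := expR (l * (s - 1)).

Lemma tilt_le1 l s : 0 <= l -> -1 < s < 1 -> tilt l s <= 1.
Proof.
move=> l0 /andP[_ s1]; rewrite /tilt -[leRHS]expR0 ler_expR.
by rewrite mulr_ge0_le0// subr_le0 ltW.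
Qed.

Lemma measurable_tilt l : measurable_fun setT (tilt l).
Proof.
apply: (@measurableT_comp _ _ _ _ _ _ (@expR R)); first exact: measurable_expR.
by apply: measurable_funM => //; exact: measurable_funB.
Qed.

(* [tilt0] and [tilt1] are the moments of order 0 and 1 of 1 - s under the weight
   exp(l (s - 1)) (1 - s^2)^a. *)
Definition tilt0 a l := \int[leb]_(s in D) (tilt l s * jacobi a s).
Definition tilt1 a l := \int[leb]_(s in D) ((1 - s) * tilt l s * jacobi a s).

Lemma integrable_tilt0 a l : -1 < a -> 0 <= l ->
  leb.-integrable D (EFin \o (fun s => tilt l s * jacobi a s)).
Proof.
move=> a1 l0; apply: (@integrable_jacobiM _ 1) => //; first exact: measurable_tilt.
by move=> s s1; rewrite ger0_norm ?expR_ge0// tilt_le1.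
Qed.

Lemma integrable_tilt1 a l : -1 < a -> 0 <= l ->
  leb.-integrable D (EFin \o (fun s => (1 - s) * tilt l s * jacobi a s)).
Proof.
move=> a1 l0; apply: (@integrable_jacobiM _ 2) => //.
  by apply: measurable_funM; [exact: measurable_funB|exact: measurable_tilt].
move=> s s1; rewrite normrM (ger0_norm (expR_ge0 _)) -[leRHS]mulr1 ler_pM ?expR_ge0 ?tilt_le1//.
by case/andP: s1 => ? ?; rewrite ger0_norm; lra.
Qed.

(* Integration by parts of the derivative of exp(l (s - 1)) (1 - s^2)^(a+1). *)
Lemma tilt0_rec a l : -1 < a -> 0 <= l ->
  l * tilt0 (a + 1) l = 2 * (a + 1) * (tilt0 a l - tilt1 a l).
Proof.
move=> a1 l0; have a2 : -1 < a + 1 by lra.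
have iJ1 := integrable_tilt0 a2 l0; have iJ := integrable_tilt0 a1 l0; have iK := integrable_tilt1 a1 l0.
pose H s := tilt l s * jacobi (a + 1) s.
pose h s := l * (tilt l s * jacobi (a + 1) s) - 2 * (a + 1) * (tilt l s * jacobi a s - (1 - s) * tilt l s * jacobi a s).
have de (x : R) : is_derive x (1 : R) (tilt l) (l * tilt l x).
  have d1 : is_derive x (1:R) (fun s => l * (s - 1)) l.
    by apply: is_derive_eq; rewrite /GRing.scale/=; ring.
  have d3 := @is_derive1_comp R (@expR R) (fun s : R => l * (s - 1)) _ _ _ (is_derive_expR _) d1.
  by apply: (is_derive_eq d3); rewrite mulrC.
have ce (x : R) : {for x, continuous (tilt l)}.
  apply: differentiable_continuous; apply/derivable1_diffP.
  by have := de x => ?; exact: ex_derive.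
have := @FTC_open H h.
have dH (x : R) : -1 < x < 1 -> is_derive x (1 : R) H (h x).
  move=> x1; have d := is_deriveM (de x) (is_derive_jacobi (a + 1) x1).
  by apply: (is_derive_eq d); rewrite /h /GRing.scale/= addrK; ring.
move=> /(_ dH).
have i1 : leb.-integrable D (EFin \o (fun s => l * (tilt l s * jacobi (a + 1) s))).
  exact: integrable_EFinZl.
have i2 : leb.-integrable D (EFin \o (fun s => tilt l s * jacobi a s - (1 - s) * tilt l s * jacobi a s)).
  exact: integrable_EFinB.
have i3 : leb.-integrable D (EFin \o (fun s => 2 * (a + 1) * (tilt l s * jacobi a s - (1 - s) * tilt l s * jacobi a s))).
  exact: integrable_EFinZl.
have -> : \int[leb]_(x in D) h x = l * tilt0 (a + 1) l - 2 * (a + 1) * (tilt0 a l - tilt1 a l).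
  by rewrite /h RintegralB// !RintegralZl// RintegralB.
have cv : jacobi (a + 1) (1 - n.+2%:R^-1) @[n --> \oo] --> 0 by apply: cvg_jacobi_endpoint; lra.
move=> fin; apply/eqP; rewrite -subr_eq0; apply/eqP; apply: fin.
- move=> x x1; apply: cvgB; first by apply: cvgM; [exact: cvg_cst|apply: cvgM; [exact: ce|exact: continuous_jacobi]].
  apply: cvgM; first exact: cvg_cst.
  apply: cvgB; first by apply: cvgM; [exact: ce|exact: continuous_jacobi].
  apply: cvgM; last exact: continuous_jacobi.
  by apply: cvgM; [apply: cvgB; [exact: cvg_cst|exact: cvg_id]|exact: ce].
- exact: integrable_EFinB.
- apply: cvg0_le cv => n; rewrite normrM !ger0_norm ?expR_ge0 ?jacobi_ge0//.
  rewrite ler_piMl ?jacobi_ge0// tilt_le1//.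
  by have /andP[b0 b1] := b_bound n; apply/andP; split => //; rewrite (lt_trans _ b0).
- apply: cvg0_le cv => n; rewrite normrM !ger0_norm ?expR_ge0 ?jacobi_ge0//.
  rewrite jacobi_b ler_piMl ?jacobi_ge0// tilt_le1//.
  by apply: (@I_D n); rewrite -/(b_ n) lexx ltW.
Qed.

(** The absolute value covers both signs of the exponent, since (p - 3)/2 is negative for p = 2. *)
Lemma powR_ge_half (a q : R) : 2^-1 <= q <= 2 -> 2 `^ (- `|a|) <= q `^ a.
Proof.
move=> /andP[q1 q2]; have q0 : 0 < q by rewrite (lt_le_trans _ q1).
rewrite /powR !gt_eqF//; rewrite ler_expR.
have l1 : ln q <= ln 2 by rewrite ler_ln// posrE.
have l2 : - ln 2 <= ln q :> R by rewrite -lnV ?posrE// ler_ln ?posrE.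
have : `|a * ln q| <= `|a| * ln 2.
  by rewrite normrM ler_wpM2l// ler_norml l2.
by rewrite ler_norml => /andP[+ _]; rewrite mulNr.
Qed.

(* Restrict the integral to the interval where 1/(2m) <= 1 - s <= 1/m. *)
Lemma tilt0_ge a l m : -1 < a -> 0 <= l -> 1 <= m ->
  (2 * m)^-1 * (2 `^ (- `|a|) * m `^ (- a) * expR (- (l / m))) <= tilt0 a l.
Proof.
move=> a1 l0 m1; have m0 : 0 < m by lra.
pose x := 1 - m^-1; pose y := 1 - (2 * m)^-1.
have mm : m^-1 = 2 * (2 * m)^-1 by field; lra.
have i0 : 0 < (2 * m)^-1 by rewrite invr_gt0; lra.
have i1 : m^-1 <= 1 by rewrite invf_le1.
rewrite -lee_fin EFin_Rintegral//; last exact: integrable_tilt0.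
set c := 2 `^ _ * _ * _.
have mJ : measurable_fun setT (fun s => (tilt l s * jacobi a s)%:E).
  by apply/measurable_EFinP; apply: measurable_funM; [exact: measurable_tilt|exact: measurable_jacobi].
apply: (@le_trans _ _ (\int[leb]_(s in `[x, y]) (tilt l s * jacobi a s)%:E)%E); last first.
  apply: ge0_subset_integral => //.
  - exact: measurable_funTS.
  - by move=> s _; rewrite lee_fin mulr_ge0 ?expR_ge0 ?jacobi_ge0.
  - by move=> s /=; rewrite !in_itv/= /x /y => /andP[? ?]; apply/andP; split; lra.
apply: (@le_trans _ _ (\int[leb]_(s in `[x, y]) c%:E)%E).
  rewrite integral_cst//= lebesgue_measure_itv/= lte_fin.
  rewrite (_ : x < y); last by rewrite /x /y; lra.
  by rewrite -EFinB -EFinM lee_fin mulrC ler_wpM2l ?mulr_ge0 ?powR_ge0 ?expR_ge0// /x /y; lra.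
apply: ge0_le_integral => //.
- by move=> s _; rewrite lee_fin !mulr_ge0 ?powR_ge0 ?expR_ge0.
- exact: measurable_funTS.
move=> s /=; rewrite in_itv/= /x /y => /andP[xs sy]; rewrite lee_fin /c mulrC.
apply: ler_pM; rewrite ?mulr_ge0 ?powR_ge0 ?expR_ge0//.
  rewrite /tilt ler_expR -mulrN ler_wpM2l//; lra.
have ms1 : 2^-1 <= m * (1 - s) <= 1.
  have -> : 2^-1 = m * (2 * m)^-1 :> R by field; lra.
  have e : 1 = m * m^-1 by rewrite divff//; lra.
  by rewrite [X in _ <= _ <= X]e !ler_pM2l//; apply/andP; split; lra.
(* On the chosen window m(1 - s) lies in [1/2, 1] and 1 + s in [1, 2]. *)
have q12 : 2^-1 <= m * (1 - s ^+ 2) <= 2.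
  have -> : m * (1 - s ^+ 2) = m * (1 - s) * (1 + s) by ring.
  have s0 : 0 <= s by lra.
  have s1 : s <= 1 by lra.
  case/andP: ms1; move: (m * (1 - s)) => q h1 h2; apply/andP; split; nra.
have -> : jacobi a s = (m * (1 - s ^+ 2)) `^ a * m `^ (- a).
  have s0 : 0 <= 1 - s ^+ 2.
    by rewrite -(pmulr_rge0 _ m0); case/andP: q12 => h _; rewrite (le_trans _ h).
  rewrite powRM// ?ltW// mulrAC -powRD ?subrr ?powRr0 ?mul1r//.
  by rewrite (gt_eqF m0) implybT.
by rewrite ler_wpM2r ?powR_ge0// powR_ge_half.
Qed.

(* 1 - s is at most 1 - s^2 for s >= 0, and the weight is at most e^(-l) for
   s <= 0. *)
Lemma tilt1_le a l : -1 < a -> 0 <= l ->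
  tilt1 a l <= tilt0 (a + 1) l + 2 * expR (- l) * \int[leb]_(s in D) jacobi a s.
Proof.
move=> a1 l0; have a2 : -1 < a + 1 by lra.
have i1 := integrable_tilt0 a2 l0; have i2 := integrable_jacobi a1.
have i3 : leb.-integrable D (EFin \o (fun s => 2 * expR (- l) * jacobi a s)) by exact: integrable_EFinZl.
rewrite -RintegralZl// -RintegralD//.
apply: le_Rintegral => //; [exact: integrable_tilt1|exact: integrable_EFinD|].
move=> s /=; rewrite in_itv/= => s1; rewrite jacobiS//.
have e0 := expR_ge0 (l * (s - 1)); have e0' := expR_ge0 (- l); have j0 := jacobi_ge0 a s.
rewrite [X in _ <= X + _]mulrA -mulrDl ler_wpM2r// /tilt.
have [s0|s0] := leP 0 s.
  rewrite -[leLHS]addr0 lerD ?mulr_ge0//.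
  rewrite mulrC ler_wpM2l//; case/andP: s1 => _ s1; rewrite expr2; nra.
have h1 : expR (l * (s - 1)) <= expR (- l).
  by rewrite ler_expR; nra.
have h2 : 0 <= expR (l * (s - 1)) * (1 - s ^+ 2).
  by rewrite mulr_ge0// ltW// onem_sqr_gt0.
case/andP: s1 => s1 _; nra.
Qed.

Lemma tilt1_ge0 a l : 0 <= tilt1 a l.
Proof.
apply: Rintegral_ge0 => s /=; rewrite in_itv/= => /andP[_ s1].
by rewrite !mulr_ge0 ?expR_ge0 ?jacobi_ge0// subr_ge0 ltW.
Qed.

Lemma tilt0_gt0 a l : -1 < a -> 0 <= l -> 0 < tilt0 a l.
Proof.
move=> a1 l0; apply: (lt_le_trans _ (tilt0_ge a1 l0 (lexx 1))).
by rewrite !mulr_gt0 ?invr_gt0 ?powR_gt0 ?expR_gt0.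
Qed.

Lemma tilt0_le a l : -1 < a -> 0 <= l -> l * tilt0 (a + 1) l <= 2 * (a + 1) * tilt0 a l.
Proof.
move=> a1 l0; rewrite tilt0_rec// ler_wpM2l//; first lra.
by have := tilt1_ge0 a l; lra.
Qed.

(** Take m = l in [tilt0_ge]: the window 1 - s of order 1/l alone carries mass of order l^-(a+1).
    The error in condition (iv) is measured against this. *)
Lemma tilt0_ge_powR a : -1 < a -> exists2 c : R, 0 < c &
  forall l, 1 <= l -> c / l `^ (a + 1) <= tilt0 a l.
Proof.
move=> a1; exists (2^-1 * 2 `^ (- `|a|) * expR (- 1)).
  by rewrite !mulr_gt0 ?invr_gt0 ?powR_gt0 ?expR_gt0.
move=> l l1; have l0 : 0 < l by lra.
apply: le_trans (tilt0_ge a1 (ltW l0) l1).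
rewrite divff ?gt_eqF// powRD; last by rewrite (gt_eqF l0) implybT.
rewrite (powRr1 (ltW l0)) (powRN l) le_eqVlt; apply/orP; left; apply/eqP.
by field; rewrite !gt_eqF ?powR_gt0.
Qed.

(** The term e^(-l) of [tilt1_le] is absorbed by a cruder lower bound: m = 2 in [tilt0_ge] gives
    tilt0 >= c e^(-l/2), and the other half satisfies e^(-l/2) <= 2/l. The remaining term is
    controlled by [tilt0_le]. *)
Lemma tilt1_tilt0 a : -1 < a -> exists2 C : R, 0 <= C &
  forall l, 1 <= l -> tilt1 a l <= C / l * tilt0 a l.
Proof.
move=> a1; set B := \int[leb]_(s in D) jacobi a s.
have B0 : 0 <= B by apply: Rintegral_ge0 => s _; exact: jacobi_ge0.
pose c : R := (2 * 2)^-1 * (2 `^ (- `|a|) * 2 `^ (- a)).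
have c0 : 0 < c by rewrite !mulr_gt0 ?invr_gt0 ?powR_gt0 ?mulr_gt0.
exists (2 * (a + 1) + 4 * B / c).
  by rewrite addr_ge0// ?divr_ge0 ?mulr_ge0// ?ltW//; lra.
move=> l l1; have l0 : 0 < l by lra.
apply: (le_trans (tilt1_le a1 (ltW l0))); rewrite [_ / l]mulrDl [leRHS]mulrDl; apply: lerD.
  by rewrite mulrAC ler_pdivlMr// mulrC tilt0_le// ltW.
have h : c * expR (- (l / 2)) <= tilt0 a l.
  have h2 : (1 : R) <= 2 by rewrite ler1n.
  by apply: le_trans (tilt0_ge a1 (ltW l0) h2); rewrite /c !mulrA.
have e2 : expR (- l) = expR (- (l / 2)) * expR (- (l / 2)).
  by rewrite -expRD; congr expR; field.
have e3 : expR (- (l / 2)) <= 2 / l.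
  rewrite expRN -[leRHS]invrK lef_pV2 ?posrE ?invr_gt0 ?divr_gt0 ?expR_gt0//.
  rewrite invf_div; apply: le_trans (expR_ge1Dx _); lra.
rewrite -/B.
have -> : 4 * B / c / l * tilt0 a l = (2 * B) * ((2 / l) * (tilt0 a l / c)) by field; rewrite !gt_eqF.
have -> : 2 * expR (- l) * B = (2 * B) * (expR (- (l / 2)) * expR (- (l / 2))) by rewrite -e2; ring.
rewrite ler_wpM2l ?mulr_ge0// ler_pM ?expR_ge0// ler_pdivlMr// mulrC//.
Qed.

End tilted_jacobi.

(** * From the exponential weight to f *)

Section classF_asymptotics.
Context {R : realType}.
Local Notation leb := (@lebesgue_measure R).
Local Notation mR := (measurableTypeR R).
Local Notation D := (`]-1, 1[%classic : set R).
Variables (f : R -> R) (fF : classF f).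

Lemma classF_mono : {homo f : x y / x <= y}.
Proof.
have fp : {in `[0, +oo[ &, {homo f : x y / x <= y}}.
  move=> x y x0 y0; rewrite le_eqVlt => /predU1P[->//|xy].
  by apply: ltW; apply: (classF_increasing fF).
move=> x y xy; have [x0|x0] := leP x 0; have [y0|y0] := leP y 0.
- by apply: (classF_nondecreasing fF) => //; rewrite in_itv/=.
- apply: (@le_trans _ _ (f 0)).
    by apply: (classF_nondecreasing fF) => //; rewrite in_itv/=.
  by apply: fp; rewrite ?in_itv/= ?andbT ?lexx// ltW.
- by have := lt_le_trans x0 (le_trans xy y0); rewrite ltxx.
- by apply: fp; rewrite ?in_itv/= ?andbT ?lexx// ltW.
Qed.

Lemma classF_gt0 k : 0 < k -> 0 < f k.
Proof.
move=> k0; apply: (le_lt_trans (classF_ge0 fF 0)); apply: (classF_increasing fF) => //.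
- by rewrite in_itv/= lexx.
- by rewrite in_itv/= ltW.
Qed.

Lemma measurable_classF : measurable_fun setT f.
Proof. by apply: nondecreasing_measurable => // x y; exact: classF_mono. Qed.

Lemma measurable_classF_scale k : measurable_fun setT ((fun s => f (k * s)) : mR -> R).
Proof. by apply: (measurableT_comp measurable_classF); exact: measurable_funM. Qed.

Lemma classF_le k s : 0 < k -> -1 < s < 1 -> f (k * s) <= f k.
Proof. by move=> k0 /andP[_ s1]; apply: classF_mono; rewrite ger_pMr// ltW. Qed.

(** Includes x = 0, where log 0 = -oo makes both sides 0; f may vanish on the negative half-line. *)
Lemma expeR_lne_div (x y : R) : 0 <= x -> 0 < y ->
  expeR (lne x%:E - lne y%:E) = (x / y)%:E.
Proof.
move=> x0 y0; rewrite (lne_EFin y0); move: x0; rewrite le_eqVlt => /predU1P[<-|x0].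
  by rewrite mul0r le0_lneNy.
by rewrite (lne_EFin x0) -EFinB /= expRD expRN !lnK.
Qed.

Definition lam k := k * varphi f k.

(** The absolute value is moved outside the integral and the end points are dropped, so condition
    (iv) becomes a comparison of two integrals against the weight [u]. *)
Lemma classF_close (xi zeta : R) (u : R -> R) : -1 < xi -> -1 < zeta ->
  (forall s, -1 < s < 1 -> u s = (1 - s) `^ xi * (1 + s) `^ zeta) ->
  measurable_fun setT u -> leb.-integrable D (EFin \o u) ->
  forall eps, 0 < eps -> \forall k \near +oo,
  `|(\int[leb]_(s in D) (u s * f (k * s))) / f k - \int[leb]_(s in D) (tilt (lam k) s * u s)|
    <= eps / (lam k) `^ (xi + 1).
Proof.
move=> xi1 zeta1 uE mu iu eps eps0.
have u0 s : -1 < s < 1 -> 0 <= u s by move=> s1; rewrite uE// mulr_ge0 ?powR_ge0.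
have h := classF_littleo fF xi1 zeta1 eps0.
near=> k.
have k0 : 0 < k by near: k; exact: nbhs_pinfty_gt.
have l0 : 0 <= lam k.
  near: k; have := classF_cvgy fF => /cvgryPge/(_ 0); apply.
have fk := classF_gt0 k0.
have i1 : leb.-integrable D (EFin \o (fun s => u s * f (k * s))).
  apply: le_integrable (integrable_EFinZl _ (f k) iu) => //.
    apply/measurable_EFinP; apply: measurable_funTS; apply: measurable_funM => //.
    exact: measurable_classF_scale.
  move=> s /=; rewrite in_itv/= => s1; rewrite lee_fin !normrM mulrC ler_wpM2r//.
  by rewrite !ger0_norm ?(classF_ge0 fF)// classF_le.
have i2 : leb.-integrable D (EFin \o (fun s => tilt (lam k) s * u s)).
  apply: le_integrable iu => //.
    apply/measurable_EFinP; apply: measurable_funTS; apply: measurable_funM => //.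
    exact: measurable_tilt.
  move=> s /=; rewrite in_itv/= => s1; rewrite lee_fin !normrM ler_piMl//.
  by rewrite ger0_norm ?expR_ge0// tilt_le1.
have mD : measurable (D : set mR) by exact: measurable_itv.
have i3 := integrable_EFinZl mD (f k)^-1 i1.
rewrite mulrC -RintegralZl// -RintegralB//.
have i4 := integrable_EFinB mD i3 i2.
rewrite (le_trans (le_normr_Rintegral _ i4))//.
rewrite -lee_fin EFin_Rintegral//; last exact: integrable_norm.
have hk : (\int[leb]_(s in `[(-1)%R, 1%R]) (((1 - s) `^ xi * (1 + s) `^ zeta) *
    `|f (k * s) / f k - tilt (lam k) s|)%:E <= (eps * (1 / (lam k) `^ (xi + 1)))%:E)%E.
  have : (\int[leb]_(s in `[(-1)%R, 1%R])
         (((1 - s) `^ xi * (1 + s) `^ zeta)%:E *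
          `| expeR (lne (f (k * s)%R)%:E - lne (f k)%:E)
             - (expR ((s - 1) * (k * varphi f k)))%:E |)
       <= (eps * (1 / (k * varphi f k) `^ (xi + 1)))%:E)%E by near: k.
  apply: le_trans; rewrite le_eqVlt; apply/orP; left; apply/eqP.
  apply: eq_integral => s _; rewrite expeR_lne_div ?(classF_ge0 fF)//.
  by rewrite -EFinB /= -EFinM /tilt [(s - 1) * _]mulrC.
move: hk; rewrite div1r; apply: le_trans.
apply: (@le_trans _ _ (\int[leb]_(s in D) (((1 - s) `^ xi * (1 + s) `^ zeta) *
    `|f (k * s) / f k - tilt (lam k) s|)%:E)%E).
  rewrite le_eqVlt; apply/orP; left; apply/eqP.
  apply: eq_integral => s /set_mem/=; rewrite in_itv/= => s1; congr EFin.
  rewrite -uE// -[in RHS](ger0_norm (u0 _ s1)) -normrM; congr (`|_|); ring.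
apply: ge0_subset_integral => //.
- apply: measurable_funTS; apply/measurable_EFinP; apply: measurable_funM.
    apply: measurable_funM.
      apply: (@measurableT_comp _ _ _ _ _ _ (fun x : R => x `^ xi)); first exact: measurable_powR.
      exact: measurable_funB.
    apply: (@measurableT_comp _ _ _ _ _ _ (fun x : R => x `^ zeta)); first exact: measurable_powR.
    exact: measurable_funD.
  apply: measurableT_comp => //; apply: measurable_funB; last exact: measurable_tilt.
  by apply: measurable_funM => //; exact: measurable_classF_scale.
- by move=> s _; rewrite lee_fin mulr_ge0// mulr_ge0 ?powR_ge0.
- by move=> s /=; rewrite !in_itv/= => /andP[/ltW -> /ltW ->].
Unshelve. all: by end_near. Qed.

(** The exponent a + n gives an error eps c / lam^(a+n+1); dividing by tilt0 >= c / lam^(a+1) leaves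
    eps / lam^n, which the factor lam^n turns into eps. *)
Lemma classF_close_tilt0 (a : R) (n : nat) (zeta : R) (u : R -> R) : -1 < a -> -1 < zeta ->
  (forall s, -1 < s < 1 -> u s = (1 - s) `^ (a + n%:R) * (1 + s) `^ zeta) ->
  measurable_fun setT u -> leb.-integrable D (EFin \o u) ->
  forall eps, 0 < eps -> \forall k \near +oo,
  `|lam k ^+ n * ((\int[leb]_(s in D) (u s * f (k * s))) / f k / tilt0 a (lam k)) -
    lam k ^+ n * ((\int[leb]_(s in D) (tilt (lam k) s * u s)) / tilt0 a (lam k))| <= eps.
Proof.
move=> a1 zeta1 uE mu iu eps eps0.
have [c c0 cJ] := tilt0_ge_powR a1.
have an : -1 < a + n%:R by rewrite (lt_le_trans a1)// lerDl.
have ec0 : 0 < eps * c by exact: mulr_gt0.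
have h := classF_close an zeta1 uE mu iu ec0.
near=> k.
have l1 : 1 <= lam k.
  near: k; have := classF_cvgy fF => /cvgryPge/(_ 1); apply.
have l0 : 0 < lam k by lra.
have J0 := tilt0_gt0 a1 (ltW l0).
rewrite -mulrBr -mulrBl normrM normrM normfV.
rewrite (ger0_norm (exprn_ge0 _ (ltW l0))) (gtr0_norm J0) mulrA ler_pdivrMr//.
have : `|(\int[leb]_(s in D) (u s * f (k * s))) / f k - \int[leb]_(s in D) (tilt (lam k) s * u s)|
    <= eps * c / (lam k) `^ (a + n%:R + 1) by near: k.
have -> : a + n%:R + 1 = n%:R + (a + 1) by ring.
rewrite powRD; last by rewrite (gt_eqF l0) implybT.
rewrite powR_mulrn ?(ltW l0)// invfM => hh.
apply: (le_trans (ler_wpM2l (exprn_ge0 _ (ltW l0)) hh)).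
rewrite [leLHS](_ : _ = eps * (c / lam k `^ (a + 1))); last first.
  by field; rewrite !gt_eqF ?exprn_gt0 ?powR_gt0.
by rewrite ler_wpM2l ?(ltW eps0)// cJ.
Unshelve. all: by end_near. Qed.


(* For a = (p - 3)/2 this is the expectation of Phi(theta' X) at concentration k. *)
Definition wmean (a : R) (Phi : R -> R) (k : R) : R :=
  (\int[leb]_(s in D) (Phi s * jacobi a s * f (k * s))) / \int[leb]_(s in D) (jacobi a s * f (k * s)).

Section moments.
Variables (a : R) (a1 : -1 < a).

(** Integrals against f, and below ([y]) against the exponential weight, both normalized by the same
    total mass [tilt0] and magnified by lam^n. A moment is then a ratio [x n Phi] over
    [x 0 (cst 1)]. *)
Let x (n : nat) (Phi : R -> R) k :=
  lam k ^+ n * ((\int[leb]_(s in D) (Phi s * jacobi a s * f (k * s))) / f k / tilt0 a (lam k)).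

Let y (n : nat) (Phi : R -> R) k :=
  lam k ^+ n * ((\int[leb]_(s in D) (tilt (lam k) s * (Phi s * jacobi a s))) / tilt0 a (lam k)).

(** The displayed form of Phi means that it vanishes to order n at s = 1, which matches the
    magnification lam^n. *)
Let close n zeta (Phi : R -> R) : -1 < zeta -> measurable_fun setT Phi ->
  (forall s, -1 < s < 1 -> `|Phi s| <= 2) ->
  (forall s, -1 < s < 1 -> Phi s * jacobi a s = (1 - s) `^ (a + n%:R) * (1 + s) `^ zeta) ->
  forall eps, 0 < eps -> \forall k \near +oo, `|x n Phi k - y n Phi k| <= eps.
Proof.
move=> z1 mPhi PhiM uE; apply: (classF_close_tilt0 a1 z1 uE).
- by apply: measurable_funM => //; exact: measurable_jacobi.
- exact: (integrable_jacobiM a1 mPhi PhiM).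
Qed.

Let jacobiM (s : R) : -1 < s < 1 -> jacobi a s = (1 - s) `^ a * (1 + s) `^ a.
Proof.
move=> /andP[s1 s2]; rewrite /jacobi -powRM; [congr powR; ring|lra|lra].
Qed.

Let powRn (b t : R) (n : nat) : 0 < t -> t `^ (b + n%:R) = t ^+ n * t `^ b.
Proof.
move=> t0; rewrite powRD; last by rewrite (gt_eqF t0) implybT.
by rewrite powR_mulrn ?ltW// mulrC.
Qed.

Let onesq (s : R) : -1 < s < 1 -> 0 < 1 - s ^+ 2 <= 1.
Proof. by move=> s1; rewrite onem_sqr_gt0// gerBl sqr_ge0. Qed.

Let msq : measurable_fun setT ((fun s : R => 1 - s ^+ 2) : mR -> R).
Proof. by apply: measurable_funB => //; exact: measurable_funX. Qed.

Let close0 eps : 0 < eps -> \forall k \near +oo, `|x 0 (cst 1) k - y 0 (cst 1) k| <= eps.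
Proof.
apply: (close a1) => //; first by move=> s _; rewrite /= normr1; lra.
by move=> s s1; rewrite mul1r addr0 jacobiM.
Qed.

Let close1 eps : 0 < eps -> \forall k \near +oo,
  `|x 1 (fun s => 1 - s ^+ 2) k - y 1 (fun s => 1 - s ^+ 2) k| <= eps.
Proof.
apply: (@close 1 (a + 1%:R)) => //; first by rewrite (lt_le_trans a1)// lerDl.
  by move=> s /onesq /andP[? ?]; rewrite gtr0_norm//; lra.
move=> s s1; have /andP[? ?] := s1; rewrite jacobiM// !powRn; [ring|lra|lra].
Qed.

Let close2 eps : 0 < eps -> \forall k \near +oo,
  `|x 2 (fun s => (1 - s ^+ 2) ^+ 2) k - y 2 (fun s => (1 - s ^+ 2) ^+ 2) k| <= eps.
Proof.
apply: (@close 2 (a + 2%:R)) => //; first by rewrite (lt_le_trans a1)// lerDl.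
- exact: measurable_funX.
- move=> s /onesq /andP[? ?]; rewrite ger0_norm ?sqr_ge0// expr2; nra.
move=> s s1; have /andP[? ?] := s1; rewrite jacobiM// !powRn; [ring|lra|lra].
Qed.

Let close3 eps : 0 < eps -> \forall k \near +oo,
  `|x 1 (fun s => 1 - s) k - y 1 (fun s => 1 - s) k| <= eps.
Proof.
apply: (@close 1 a) => //; first exact: measurable_funB.
  by move=> s /andP[? ?]; rewrite ger0_norm; lra.
move=> s s1; have /andP[? ?] := s1; rewrite jacobiM// !powRn; [ring|lra].
Qed.

Let lam_ge M : \forall k \near +oo, M <= lam k.
Proof. by have := classF_cvgy fF => /cvgryPge/(_ M); apply. Qed.

Let y0 k : 0 <= lam k -> y 0 (cst 1) k = 1.
Proof.
move=> l0; rewrite /y expr0 mul1r -[RHS](divff (lt0r_neq0 (tilt0_gt0 a1 l0))); congr (_ / _).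
by apply: eq_Rintegral => s _; rewrite mul1r.
Qed.

Let y1 k : 0 <= lam k -> y 1 (fun s => 1 - s ^+ 2) k = lam k * (tilt0 (a + 1) (lam k) / tilt0 a (lam k)).
Proof.
move=> l0; rewrite /y expr1; congr (_ * (_ / _)).
by apply: eq_Rintegral => s; rewrite inE/= in_itv/= => s1; rewrite jacobiS.
Qed.

Let y2 k : 0 <= lam k -> y 2 (fun s => (1 - s ^+ 2) ^+ 2) k = lam k ^+ 2 * (tilt0 (a + 2) (lam k) / tilt0 a (lam k)).
Proof.
move=> l0; rewrite /y; congr (_ * (_ / _)).
apply: eq_Rintegral => s; rewrite inE/= in_itv/= => s1.
by rewrite (_ : a + 2 = a + 1 + 1) ?jacobiS//; ring.
Qed.

Let y3 k : 0 <= lam k -> y 1 (fun s => 1 - s) k = lam k * (tilt1 a (lam k) / tilt0 a (lam k)).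
Proof.
move=> l0; rewrite /y expr1; congr (_ * (_ / _)).
by apply: eq_Rintegral => s _; ring.
Qed.

Let x0_cvg : x 0 (cst 1) k @[k --> +oo] --> (1 : R).
Proof.
apply/cvgrPdist_le => e e0; near=> k.
have l0 : 0 <= lam k by near: k; exact: lam_ge.
by rewrite distrC -[X in _ - X](y0 l0); near: k; exact: close0.
Unshelve. all: by end_near. Qed.

(** By [tilt0_rec] the exponential counterpart equals 2(a+1)(1 - tilt1/tilt0), and the ratio is
    O(1/lam). The limit 2(a+1) is p - 1. *)
Let x1_cvg : x 1 (fun s => 1 - s ^+ 2) k @[k --> +oo] --> 2 * (a + 1).
Proof.
have [C C0 KC] := tilt1_tilt0 a1.
apply/cvgrPdist_le => e e0; near=> k.
have l1 : 1 <= lam k by near: k; exact: lam_ge.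
have l0 : 0 < lam k by lra.
have J0 := tilt0_gt0 a1 (ltW l0).
have h1 : `|x 1 (fun s => 1 - s ^+ 2) k - y 1 (fun s => 1 - s ^+ 2) k| <= e / 2.
  by near: k; apply: close1; rewrite divr_gt0.
have h2 : `|2 * (a + 1) - y 1 (fun s => 1 - s ^+ 2) k| <= e / 2.
  rewrite (y1 (ltW l0)) mulrA (tilt0_rec a1 (ltW l0)).
  have -> : 2 * (a + 1) - 2 * (a + 1) * (tilt0 a (lam k) - tilt1 a (lam k)) / tilt0 a (lam k) =
      2 * (a + 1) * (tilt1 a (lam k) / tilt0 a (lam k)) by field; rewrite gt_eqF.
  have a2 : 0 <= 2 * (a + 1) by have := a1; lra.
  rewrite ger0_norm; last by rewrite mulr_ge0// divr_ge0 ?tilt1_ge0 ?(ltW J0).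
  have : tilt1 a (lam k) / tilt0 a (lam k) <= C / lam k by rewrite ler_pdivrMr// KC.
  move=> /(ler_wpM2l a2)/le_trans; apply.
  rewrite mulrA ler_pdivrMr// -ler_pdivrMl ?divr_gt0//.
  by near: k; exact: lam_ge.
rewrite (le_trans (ler_distD (y 1 (fun s => 1 - s ^+ 2) k) _ _))//.
rewrite [leRHS](_ : e = e / 2 + e / 2); last by field.
by rewrite lerD// distrC.
Unshelve. all: by end_near. Qed.

Let wmeanE n Phi k : 0 < k -> 0 <= lam k -> lam k ^+ n * wmean a Phi k = x n Phi k / x 0 (cst 1) k.
Proof.
move=> k0 l0; rewrite /x /wmean expr0 mul1r.
have fk := classF_gt0 k0; have J0 := tilt0_gt0 a1 l0.
under [X in _ = _ / (X / _ / _)]eq_Rintegral do rewrite mul1r.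
set A := \int[leb]_(s in D) _; set B := \int[leb]_(s in D) _.
rewrite -!mulrA; congr (_ * (_ * _)).
have := lt0r_neq0 fk; have := lt0r_neq0 J0; move: (f k) (tilt0 _ _) => b c c0 b0.
rewrite !invfM !invrK.
have -> : b^-1 * (c^-1 * (B^-1 * (b * c))) = (b^-1 * b) * (c^-1 * c) * B^-1 by ring.
by rewrite !mulVf// !mul1r.
Qed.

Lemma cvg_wmean_sqr : lam k * wmean a (fun s => 1 - s ^+ 2) k @[k --> +oo] --> 2 * (a + 1).
Proof.
have c : x 1 (fun s => 1 - s ^+ 2) k / x 0 (cst 1) k @[k --> +oo] --> 2 * (a + 1).
  rewrite -[X in _ --> X]divr1; apply: cvgM; first exact: x1_cvg.
  by apply: cvgV; [exact: oner_neq0|exact: x0_cvg].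
apply: cvg_trans c; apply: near_eq_cvg; near=> k.
have k0 : 0 < k by near: k; exact: nbhs_pinfty_gt.
have l0 : 0 <= lam k by near: k; exact: lam_ge.
by rewrite -wmeanE ?expr1.
Unshelve. all: by end_near. Qed.

(** Eventually the numerator is at most M + 1 and the denominator at least 1/2, whence the factor
    2. *)
Let bounded n Phi M (M0 : 0 <= M) : (forall eps, 0 < eps -> \forall k \near +oo, `|x n Phi k - y n Phi k| <= eps) ->
  (\forall k \near +oo, y n Phi k <= M) ->
  \forall k \near +oo, lam k ^+ n * wmean a Phi k <= 2 * (M + 1).
Proof.
move=> xy yM; near=> k.
have k0 : 0 < k by near: k; exact: nbhs_pinfty_gt.
have l0 : 0 <= lam k by near: k; exact: lam_ge.
rewrite wmeanE//.
have h1 : `|x n Phi k - y n Phi k| <= 1 by near: k; exact: xy.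
have h2 : y n Phi k <= M by near: k.
have h3 : `|x 0 (cst 1) k - y 0 (cst 1) k| <= 1 / 2 by near: k; apply: close0; lra.
move: h1 h3; rewrite y0// !ler_norml => /andP[_ h1] /andP[h3 _].
by rewrite ler_pdivrMr; nra.
Unshelve. all: by end_near. Qed.

(** [tilt0_le] applied twice, each use gaining one factor 1/lam. This bound controls the Taylor
    remainder of the characteristic function. *)
Lemma wmean_sqr2_bounded : exists M : R,
  \forall k \near +oo, lam k ^+ 2 * wmean a (fun s => (1 - s ^+ 2) ^+ 2) k <= M.
Proof.
have a1' := a1; have a2 : -1 < a + 1 by lra.
exists (2 * (2 * (a + 1 + 1) * (2 * (a + 1)) + 1)).
apply: bounded; [by rewrite !mulr_ge0//; lra|exact: close2|].
near=> k.
have l1 : 1 <= lam k by near: k; exact: lam_ge.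
have l0 : 0 < lam k by lra.
have J0 := tilt0_gt0 a1 (ltW l0).
rewrite (y2 (ltW l0)) [leLHS]mulrA ler_pdivrMr// (_ : a + 2 = a + 1 + 1); last by ring.
move: (lam k) l0 {l1 J0} => l l0.
have h1 := tilt0_le a2 (ltW l0); have h2 := tilt0_le a1 (ltW l0).
rewrite expr2 -mulrA (le_trans (ler_wpM2l (ltW l0) h1))//.
rewrite mulrCA -[leRHS]mulrA ler_wpM2l//; lra.
Unshelve. all: by end_near. Qed.

(** Makes the mean of 1 - theta' Xbar of order 1/lam, hence theta' Xbar close to 1. *)
Lemma wmean_onem_bounded : exists M : R,
  \forall k \near +oo, lam k * wmean a (fun s => 1 - s) k <= M.
Proof.
have [C C0 KC] := tilt1_tilt0 a1.
exists (2 * (C + 1)).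
have : \forall k \near +oo, lam k ^+ 1 * wmean a (fun s => 1 - s) k <= 2 * (C + 1).
  apply: bounded; [by []|exact: close3|].
  near=> k.
  have l1 : 1 <= lam k by near: k; exact: lam_ge.
  have l0 : 0 < lam k by lra.
  have J0 := tilt0_gt0 a1 (ltW l0).
  rewrite (y3 (ltW l0)) mulrA ler_pdivrMr// (le_trans (ler_wpM2l (ltW l0) (KC _ l1)))//.
  by rewrite mulrA mulrCA divff ?gt_eqF// mulr1.
by apply: filterS => k; rewrite expr1.
Unshelve. all: by end_near. Qed.

End moments.
End classF_asymptotics.

(** * Convergence in distribution *)

Section cos_bounds.
Context {R : realType}.

Lemma ge0_is_derive (F f : R -> R) : (forall x : R, is_derive x (1 : R) F (f x)) -> F 0 = 0 ->
  (forall x, 0 <= x -> 0 <= f x) -> forall x, 0 <= x -> 0 <= F x.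
Proof.
move=> dF F0 f0 x x0.
have cF : {within `[0, x], continuous F}.
  apply: continuous_subspaceT => y; apply: differentiable_continuous.
  by apply/derivable1_diffP; have := dF y => ?; exact: ex_derive.
have [c] := @MVT_segment R F f 0 x x0 (fun y _ => dF y) cF.
rewrite in_itv/= F0 !subr0 => /andP[c0 _] ->.
by rewrite mulr_ge0// f0.
Qed.

(** Starting from 1 - cos >= 0, each inequality is the derivative of the next one, all vanishing at
    0; parity settles negative x. *)
Lemma cos_taylor2 (x : R) : `|1 - cos x - x ^+ 2 / 2| <= x ^+ 4 / 24.
Proof.
have s1 (y : R) : 0 <= y -> 0 <= y - sin y.
  apply: (@ge0_is_derive (fun y => y - sin y) (fun y => 1 - cos y)).
  - by rewrite sin0 subr0.
  - by move=> z _; rewrite subr_ge0 (le_trans (ler_norm _))// cos_max.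
have s2 (y : R) : 0 <= y -> 0 <= y ^+ 2 / 2 - (1 - cos y).
  apply: (@ge0_is_derive (fun y => y ^+ 2 / 2 - (1 - cos y)) (fun y => y - sin y)) => //.
  - by move=> z; apply: is_derive_eq; rewrite /GRing.scale/=; field.
  - by rewrite cos0 subrr expr0n mul0r subrr.
have s3 (y : R) : 0 <= y -> 0 <= sin y - y + y ^+ 3 / 6.
  apply: (@ge0_is_derive (fun y => sin y - y + y ^+ 3 / 6) (fun y => y ^+ 2 / 2 - (1 - cos y))) => //.
  - by move=> z; apply: is_derive_eq; rewrite /GRing.scale/=; field.
  - by rewrite sin0 subrr expr0n mul0r addr0.
have s4 (y : R) : 0 <= y -> 0 <= (1 - cos y) - y ^+ 2 / 2 + y ^+ 4 / 24.
  apply: (@ge0_is_derive (fun y => (1 - cos y) - y ^+ 2 / 2 + y ^+ 4 / 24) (fun y => sin y - y + y ^+ 3 / 6)) => //.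
  - by move=> z; apply: is_derive_eq; rewrite /GRing.scale/=; field.
  - by rewrite cos0 !expr0n !mul0r !subrr addr0.
wlog x0 : x / 0 <= x.
  move=> H; have [/H//|/ltW x0] := leP 0 x.
  have e4 : (- x) ^+ 4 = x ^+ 4 by ring.
  have e2 : (- x) ^+ 2 = x ^+ 2 by ring.
  by have := H (- x); rewrite cosN e2 e4; apply; rewrite oppr_ge0.
have h2 := s2 x x0; have h4 := s4 x x0.
have q0 : 0 <= x ^+ 4 by rewrite exprn_ge0.
by rewrite ler_norml; apply/andP; split; lra.
Qed.

(** Since e^y >= 1 + y, it is enough that (1 + z + 2z^2)(1 - z) = 1 + z^2 (1 - 2z) is at least 1. *)
Lemma expR_lower (z : R) : 0 <= z <= 2^-1 -> expR (- (z + 2 * z ^+ 2)) <= 1 - z.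
Proof.
move=> /andP[z0 z1]; rewrite expRN -[leRHS]invrK lef_pV2 ?posrE ?expR_gt0 ?invr_gt0//; last by lra.
apply: (le_trans _ (expR_ge1Dx _)).
rewrite -[leLHS]mul1r ler_pdivrMr; last by lra.
have -> : (1 + (z + 2 * z ^+ 2)) * (1 - z) = 1 + z ^+ 2 * (1 - 2 * z) by ring.
by rewrite lerDl mulr_ge0 ?sqr_ge0//; lra.
Qed.

(** With z = 1 - phi_n, which tends to 0 because n z converges, phi_n^n lies between exp(-(nz +
    2nz^2)) and exp(-nz). *)
Lemma cvg_expn (phi : nat -> R) (b : R) : (forall n, phi n <= 1) ->
  n%:R * (1 - phi n) @[n --> \oo] --> b -> phi n ^+ n @[n --> \oo] --> expR (- b).
Proof.
move=> phi1 cb; pose z n := 1 - phi n.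
have z0 n : 0 <= z n by rewrite subr_ge0.
have phiE n : phi n = 1 - z n by rewrite /z subKr.
have cz : z n @[n --> \oo] --> 0.
  have : (n.+1%:R * (1 - phi n.+1)) * n.+1%:R^-1 @[n --> \oo] --> b * 0.
    apply: cvgM; last exact: cvg_harmonic.
    by move: cb; rewrite -cvg_shiftS.
  rewrite mulr0 => h; rewrite -cvg_shiftS; apply: cvg_trans h.
  by apply: near_eq_cvg; near=> n; rewrite /z mulrAC divff ?mul1r// pnatr_eq0.
have c1 : expR (- (n%:R * z n + 2 * (n%:R * z n) * z n)) @[n --> \oo] --> expR (- b).
  apply: continuous_cvg; first exact: continuous_expR.
  apply: cvgN; rewrite -[X in _ --> X]addr0; apply: cvgD => //.
  have -> : 0 = 2 * b * 0 :> R by rewrite mulr0.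
  by apply: cvgM => //; apply: cvgM => //; exact: cvg_cst.
have c2 : expR (- (n%:R * z n)) @[n --> \oo] --> expR (- b).
  by apply: continuous_cvg; [exact: continuous_expR|exact: cvgN].
apply: squeeze_cvgr c1 c2; near=> n.
have zn : z n <= 2^-1.
  near: n; have /cvgrPdist_le/(_ _ (_ : 0 < 2^-1)) := cz.
  move=> /(_ _)[]; first by rewrite invr_gt0.
  move=> N _ h; exists N => // n /h /=; rewrite sub0r normrN ger0_norm//.
rewrite phiE; apply/andP; split.
  have -> : - (n%:R * z n + 2 * (n%:R * z n) * z n) = n%:R * - (z n + 2 * z n ^+ 2) by ring.
  rewrite expRM_natl lerXn2r ?nnegrE ?expR_ge0//; first by lra.
  by rewrite expR_lower// z0.
have -> : - (n%:R * z n) = n%:R * - z n by ring.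
rewrite expRM_natl lerXn2r ?nnegrE ?expR_ge0//; first by lra.
exact: expR_ge1Dx.
Unshelve. all: by end_near. Qed.

End cos_bounds.

Lemma dotv_continuous (R : realType) p : continuous (fun x : 'cV[R]_p => dotv x x).
Proof.
rewrite (_ : (fun x : 'cV[R]_p => dotv x x) = fun x => \sum_i x i 0 * x i 0); last first.
  by apply/funext => y; rewrite dotvE.
apply: continuous_big => [|i _ x]; first exact: add_continuous.
by apply: continuousM; exact: coord_continuous.
Qed.

(** * Stability of convergence in distribution under perturbation *)

Section slutsky.
Context {R : realType} {p : nat} (d : nat -> measure_display)
  (Omega : forall n, measurableType (d n)) (P : forall n, probability (Omega n) R)
  (S : forall n, Omega n -> 'cV[R]_p) (U : forall n, Omega n -> R)
  {T : pseudoMetricType R} (H : 'cV[R]_p -> T) (Y : forall n, Omega n -> T)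
  {d'} {Omega' : measurableType d'} (Q : probability Omega' R) (S' : Omega' -> 'cV[R]_p).
Hypotheses (mS : forall n, measurable_fun setT (@S n)) (mU : forall n, measurable_fun setT (@U n))
  (mS' : measurable_fun setT S') (cH : continuous H)
  (cvgS : forall (g : 'cV[R]_p -> R) M, continuous g -> (forall x, `|g x| <= M) ->
    \int[P n]_w g (@S n w) @[n --> \oo] --> \int[Q]_w g (S' w))
  (U02 : forall n w, 0 <= @U n w <= 2)
  (cvgU : \int[P n]_w @U n w @[n --> \oo] --> 0)
  (closeY : forall M e : R, 0 < e -> exists2 r : R, 0 < r &
    \forall n \near \oo, forall w, (forall i, `|@S n w i 0| <= M) -> @U n w <= r ->
      ball (H (@S n w)) e (@Y n w)).

(* A continuous bounded substitute for the indicator of |x| > M: it is at least 1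
   there and tends to 0 as M grows. *)
Let nrm (M : R) (x : 'cV[R]_p) : R := 2 * (dotv x x / (M ^+ 2 + dotv x x)).

Let nrm_continuous M : 0 < M -> continuous (nrm M).
Proof.
move=> M0 x.
rewrite (_ : nrm M = cst 2 \* ((fun x => dotv x x) \* (fun x => (M ^+ 2 + dotv x x)^-1)))//.
apply: continuousM; first exact: cst_continuous.
apply: continuousM; first exact: dotv_continuous.
apply: continuousV; first by rewrite gt_eqF// ltr_pwDl ?exprn_gt0// dotvv_ge0.
by apply: continuousD; [exact: cst_continuous|exact: dotv_continuous].
Qed.

Let nrm_ge0 M x : 0 <= nrm M x.
Proof. by rewrite mulr_ge0// divr_ge0 ?dotvv_ge0// addr_ge0 ?sqr_ge0 ?dotvv_ge0. Qed.

Let nrm_le2 M x : 0 < M -> nrm M x <= 2.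
Proof.
move=> M0; rewrite ger_pMr// ler_pdivrMr ?mul1r ?lerDr ?sqr_ge0//.
by rewrite ltr_pwDl ?exprn_gt0// dotvv_ge0.
Qed.

Let nrm_ge1 M (x : 'cV[R]_p) i : 0 < M -> M < `|x i 0| -> 1 <= nrm M x.
Proof.
move=> M0 Mx; have M2 : 0 < M ^+ 2 by rewrite exprn_gt0.
have h : M ^+ 2 <= dotv x x.
  rewrite -enorm_sqr ler_sqr ?nnegrE ?enorm_ge0 ?(ltW M0)//.
  by rewrite (le_trans (ltW Mx))// ler_abs_enorm.
have d0 := dotvv_ge0 x.
by rewrite /nrm mulrA ler_pdivlMr; lra.
Qed.

Let measurable_nrm M : 0 < M -> measurable_fun setT (nrm M).
Proof. by move=> /nrm_continuous; exact: measurable_continuous_cV. Qed.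

(** Tightness of the limit: nrm M tends to 0 pointwise as M grows, and it is bounded by 2. *)
Let nrm_small e : 0 < e -> exists2 M, 0 < M & \int[Q]_w nrm M (S' w) < e.
Proof.
move=> e0.
have c : \int[Q]_w nrm n.+1%:R (S' w) @[n --> \oo] --> \int[Q]_w (0 : R).
  apply: (@Rdominated_cvg _ _ _ _ _ _ (fun=> 2)) => //.
  - by move=> n; apply: (measurableT_comp (measurable_nrm _)).
  - move=> w; rewrite /nrm -[X in _ --> X](mulr0 2); apply: cvgM; first exact: cvg_cst.
    rewrite -[X in _ --> X](mulr0 (dotv (S' w) (S' w))); apply: cvgM; first exact: cvg_cst.
    apply: (cvg0_le _ (@cvg_harmonic R)) => n.
    have d0 := dotvv_ge0 (S' w).
    rewrite ger0_norm ?invr_ge0 ?addr_ge0 ?sqr_ge0// lef_pV2 ?posrE ?ltr0n//.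
      by rewrite -[leLHS]addr0 lerD// expr2 ler_peMl// ler1n.
    by rewrite ltr_pwDl// exprn_gt0.
  - by apply: (integrable_le_bound _ (M := 2)) => // w; rewrite ger0_norm.
  - by move=> n w; rewrite ger0_norm ?nrm_ge0// nrm_le2.
move: c; rewrite Rintegral_prob_cst => /cvgrPdist_lt/(_ _ e0)[N _ /(_ N (leqnn _))] /=.
by rewrite sub0r normrN => h; exists N.+1%:R => //; exact: (le_lt_trans (ler_norm _) h).
Qed.

(** Y need only be close to H(S) where S is bounded and U is small. The exceptional events are
    bounded pointwise by [nrm M] of S and, in the spirit of Markov's inequality, by U/eta.
    Integrating uses only the convergence of S and E U -> 0. *)
Lemma slutsky (g : T -> R) (B : R) : continuous g -> (forall x, `|g x| <= B) ->
  (forall n, measurable_fun setT (g \o @Y n)) ->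
  \int[P n]_w g (@Y n w) @[n --> \oo] --> \int[Q]_w g (H (S' w)).
Proof.
move=> cg gB mgY.
have cgH : continuous (g \o H) by move=> x; apply: continuous_comp; [exact: cH|exact: cg].
have B0 : 0 <= B by rewrite (le_trans (normr_ge0 _) (gB (H 0))).
apply/cvgrPdist_le => e e0.
(* The total error is e' + (e' + 2B e' + 2B e'), below (3 + 4B) e' = e. *)
pose e' := e / (3 + 4 * B).
have e'0 : 0 < e' by rewrite divr_gt0//; lra.
have [M M0 nM] := nrm_small e'0.
have cK : compact (H @` [set x : 'cV[R]_p | forall i, `|x i 0| <= M]).
  by apply: continuous_compact; [exact: continuous_subspaceT|exact: compact_cV_cube].
have [r r0 gr] := compact_unif_continuous cK cg e'0.
have [eta eta0 Yr] := closeY M r0.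
have nb x : `|nrm M x| <= 2 by rewrite ger0_norm ?nrm_ge0// nrm_le2.
near=> n.
have mSn := @mS n; have mUn := @mU n.
have h1 : `|\int[Q]_w g (H (S' w)) - \int[P n]_w g (H (@S n w))| <= e'.
  by near: n; have /cvgrPdist_le := cvgS cgH (fun x => gB _); apply.
have h2 : \int[P n]_w nrm M (@S n w) <= e'.
  by near: n; apply: (cvgr_le _ (cvgS (nrm_continuous M0) nb)).
have h3 : \int[P n]_w @U n w <= e' * eta.
  by near: n; apply: (cvgr_le _ cvgU); rewrite mulr_gt0.
have pw w : `|g (H (@S n w)) - g (@Y n w)| <= e' + 2 * B * nrm M (@S n w) + 2 * B / eta * @U n w.
  have n0 := nrm_ge0 M (@S n w); have /andP[u0 _] := U02 w.
  have g2 : `|g (H (@S n w)) - g (@Y n w)| <= 2 * B.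
    by rewrite (le_trans (ler_normB _ _))// mulr2n mulrDl !mul1r lerD.
  have B2 : 0 <= 2 * B by rewrite mulr_ge0.
  have q1 : 0 <= 2 * B * nrm M (@S n w) by exact: mulr_ge0.
  have q2 : 0 <= 2 * B / eta * @U n w by rewrite mulr_ge0// divr_ge0// ltW.
  have [Ue|Ue] := leP (@U n w) eta; last first.
    have : 2 * B <= 2 * B / eta * @U n w.
      by rewrite -[leRHS]mulrA ler_peMr// mulrC ler_pdivlMr// mul1r ltW.
    by move=> ?; lra.
  have [SM|] := pselect (forall i, `|@S n w i 0| <= M); last first.
    move=> /existsNP[i /negP]; rewrite -ltNge => /(nrm_ge1 M0) n1.
    have : 2 * B <= 2 * B * nrm M (@S n w) by rewrite ler_peMr.
    by move=> ?; lra.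
  have : `|g (H (@S n w)) - g (@Y n w)| < e'.
    apply: gr; first by exists (@S n w).
    suff : forall w, (forall i, `|@S n w i 0| <= M) -> @U n w <= eta ->
      ball (H (@S n w)) r (@Y n w) by apply.
    by near: n.
  by move=> ?; lra.
have mg : measurable_fun setT (fun w => g (H (@S n w))).
  by apply: (measurableT_comp (measurable_continuous_cV cgH)).
have ig : (P n).-integrable setT (EFin \o (fun w => g (H (@S n w)))).
  by apply: (integrable_le_bound _ (M := B)) => // w; exact: gB.
have igY : (P n).-integrable setT (EFin \o (fun w => g (@Y n w))).
  by apply: (integrable_le_bound _ (M := B)) => [|w]; [exact: mgY|exact: gB].
have iN : (P n).-integrable setT (EFin \o (fun w => nrm M (@S n w))).
  apply: (integrable_le_bound _ (M := 2)) => [|w].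
    by apply: (measurableT_comp (measurable_nrm M0)).
  by rewrite ger0_norm ?nrm_ge0// nrm_le2.
have iU : (P n).-integrable setT (EFin \o (fun w => @U n w)).
  apply: (integrable_le_bound _ (M := 2)) => // w.
  by have /andP[u0 u2] := U02 w; rewrite ger0_norm.
have h4 : `|\int[P n]_w g (H (@S n w)) - \int[P n]_w g (@Y n w)| <= e' + 2 * B * e' + 2 * B * e'.
  have ic : (P n).-integrable setT (EFin \o (fun w => e' : R)).
    by apply: (integrable_le_bound _ (M := e')) => // w; rewrite ger0_norm// ltW.
  have i1 := integrable_EFinZl measurableT (2 * B) iN.
  have i2 := integrable_EFinZl measurableT (2 * B / eta) iU.
  have i3 := integrable_EFinD measurableT ic i1.
  have i4 := integrable_EFinD measurableT i3 i2.
  rewrite -RintegralB//.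
  have i5 := integrable_EFinB measurableT ig igY.
  rewrite (le_trans (le_normr_Rintegral measurableT i5))//.
  apply: (@le_trans _ _ (\int[P n]_w (e' + 2 * B * nrm M (@S n w) + 2 * B / eta * @U n w))).
    by apply: le_Rintegral => //; exact: integrable_norm.
  rewrite RintegralD// RintegralD// (RintegralZl _ _ iN)// (RintegralZl _ _ iU)//.
  rewrite [X in X + _ + _](_ : _ = e'); last exact: Rintegral_prob_cst.
  rewrite lerD//; first by rewrite lerD// ler_wpM2l// mulr_ge0.
  rewrite (le_trans (ler_wpM2l _ h3))//; first by rewrite divr_ge0 ?mulr_ge0// ltW.
  by rewrite le_eqVlt; apply/orP; left; apply/eqP; field; rewrite gt_eqF.
rewrite (le_trans (ler_distD (\int[P n]_w g (H (@S n w))) _ _))//.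
apply: (le_trans (lerD h1 h4)).
rewrite [leRHS](_ : e = (3 + 4 * B) * e'); last first.
  by rewrite /e' mulrC divfK// gt_eqF//; lra.
lra.
Unshelve. all: by end_near. Qed.

End slutsky.

(** * Expansions for a sample of fixed size *)

Section sample.
Context {R : realType} {p : nat} d (Omega : measurableType d) (P : probability Omega R) {n : nat}.
Local Notation leb := (@lebesgue_measure R).
Local Notation mR := (measurableTypeR R).
Local Notation D := (`]-1, 1[%classic : set R).
Variables (theta : 'cV[R]_p) (k : R) (f : R -> R) (X : 'I_n -> {RV P >-> 'cV[R]_p}).
Hypotheses (p_ge2 : (2 <= p)%N) (theta_sphere : sphere theta) (fF : classF f) (k0 : 0 < k)
  (sX : rotsym_sample theta k f X).

Let a : R := (p%:R - 3) / 2.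

Lemma half_dim_gtN1 : -1 < a.
Proof.
have : (2 : R) <= p%:R by rewrite ler_nat.
rewrite /a ltr_pdivlMr//; lra.
Qed.

Lemma sphere_dotv (x : 'cV[R]_p) : sphere x -> dotv x x = 1.
Proof. by rewrite -enorm_sqr => ->; rewrite expr1n. Qed.

Let theta1 := sphere_dotv theta_sphere.

Let X1 i w : dotv (X i w) (X i w) = 1.
Proof. exact/sphere_dotv/(sample_sphere sX). Qed.

Let C0 : R := norm_const p k f * Gamma_fun ((p%:R - 1) / 2) / (2 * pi `^ ((p%:R - 1) / 2)).

Let C0_ge0 : 0 <= C0.
Proof.
rewrite divr_ge0//; last by rewrite mulr_ge0// powR_ge0.
rewrite mulr_ge0//.
  rewrite invr_ge0; apply: Rintegral_ge0 => s _.
  by rewrite mulr_ge0 ?powR_ge0 ?(classF_ge0 fF).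
by apply: Rintegral_ge0 => s _; rewrite mulr_ge0 ?powR_ge0 ?expR_ge0.
Qed.

Let F (s : R) : R := C0 * f (k * s).

Let F_ge0 s : 0 <= F s. Proof. by rewrite mulr_ge0// (classF_ge0 fF). Qed.

Let mF : measurable_fun setT F.
Proof. by apply: measurable_funM => //; exact: (measurable_classF_scale fF k). Qed.

Let dX i (A : set 'cV[R]_p) : measurable A ->
  (distribution P (X i) A = \int[@surface_measure R p]_(x in A) (F (dotv x theta))%:E)%E.
Proof. exact: (sample_density sX). Qed.

Lemma sample_dot_le1 i w : -1 <= dotv (X i w) theta <= 1.
Proof.
rewrite -ler_norml -(@expr_le1 _ 2)// real_normK ?num_real//.
by rewrite (le_trans (dotv_CS _ _))// X1 theta1 mulr1.
Qed.

(** The constants of the law and of the density form one factor, which total mass one identifies as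
    the inverse of the denominator of [wmean]. *)
Lemma sample_dot_law i (Phi : R -> R) M : measurable_fun setT Phi ->
  (forall s, -1 <= s <= 1 -> 0 <= Phi s <= M) ->
  \int[P]_w Phi (dotv (X i w) theta) = wmean f a Phi k.
Proof.
have [C C_gt0 law] := rotsym_law_dot theta1 mF F_ge0 (X1 i) (@dX i) p_ge2.
have fk := classF_gt0 fF k0.
pose I (G : R -> R) := \int[leb]_(s in D) (G s * jacobi a s * f (k * s)).
have key (G : R -> R) (B : R) : measurable_fun setT G -> (forall s, -1 <= s <= 1 -> 0 <= G s <= B) ->
    \int[P]_w G (dotv (X i w) theta) = C * (C0 * I G).
  (* [rotsym_law_dot] asks for nonnegativity on the whole line, while [G] is controlled on [-1, 1]
     only, where the values of theta' X lie. *)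
  move=> mG GM; pose G' (s : R) := G s * (\1_(`[-1, 1]%classic : set R) s).
  have G'E s : -1 <= s <= 1 -> G' s = G s.
    by move=> s1; rewrite /G' indicE mem_set ?mulr1//= in_itv.
  have G'0 s : 0 <= G' s.
    rewrite /G' indicE; case: (boolP (s \in _)) => [|_]; last by rewrite mulr0.
    by rewrite inE/= in_itv/= mulr1 => /GM/andP[].
  have mG' : measurable_fun setT (EFin \o G').
    apply/measurable_EFinP; apply: measurable_funM => //.
  transitivity (fine (\int[P]_w (EFin \o G') (dotv (X i w) theta))%E).
    by apply: eq_Rintegral => w _; rewrite G'E ?sample_dot_le1.
  rewrite (law _ mG') => [|s]; last by rewrite lee_fin.
  have iG : leb.-integrable D (EFin \o (fun s => (G s * f (k * s)) * jacobi a s)).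
    apply: (@integrable_jacobiM _ a (B * f k) _ half_dim_gtN1).
      by apply: measurable_funM => //; exact: (measurable_classF_scale fF k).
    move=> s s1; have /GM/andP[g0 gM] : -1 <= s <= 1 by case/andP: s1 => /ltW -> /ltW ->.
    rewrite ger0_norm; last by rewrite mulr_ge0// (classF_ge0 fF).
    by rewrite ler_pM ?(classF_ge0 fF)// classF_le.
  have -> : (\int[leb]_(s in `](-1)%R, 1%R[) ((EFin \o G') s * (F s * (1 - s ^+ 2) `^ ((p%:R - 3) / 2))%:E) =
      \int[leb]_(s in D) (C0 * ((G s * f (k * s)) * jacobi a s))%:E)%E.
    apply: eq_integral => s /set_mem/=; rewrite in_itv/= => /andP[/ltW s1 /ltW s2].
    by rewrite -EFinM G'E ?s1//; congr EFin; rewrite /F /jacobi -/a; ring.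
  rewrite -EFin_Rintegral//; last exact: integrable_EFinZl.
  rewrite /= RintegralZl//; congr (_ * (_ * _)).
  by apply: eq_Rintegral => s _; ring.
move=> mPhi PhiM; rewrite (key _ _ mPhi PhiM) /wmean -/(I Phi).
have : \int[P]_w (1 : R) = C * (C0 * I (cst 1)).
  by rewrite -(key (cst 1) 1)// => s _; rewrite ler01 lexx.
rewrite Rintegral_prob_cst.
have -> : I (cst 1) = \int[leb]_(s in D) (jacobi a s * f (k * s)).
  by apply: eq_Rintegral => s _; rewrite mul1r.
set J := Rintegral _ _ _ => h.
have J0 : J != 0 by apply/eqP => J0; move/eqP: h; rewrite J0 !mulr0 oner_eq0.
apply: (mulIf J0); rewrite divfK//.
by rewrite -[RHS]mulr1 h; ring.
Qed.

(** All observations have the same density, so a single transform phi serves for every index. *)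
Lemma sample_same i j (g : 'cV[R]_p -> R) M : measurable_fun setT g -> (forall x, `|g x| <= M) ->
  \int[P]_w g (X i w) = \int[P]_w g (X j w).
Proof.
move=> mg gM; congr fine.
have mE : measurable_fun setT (EFin \o g) by exact/measurable_EFinP.
have ig l : P.-integrable setT (EFin \o g \o X l).
  by apply: (integrable_le_bound _ (M := M)) => // ; exact: measurableT_comp.
have e l : (\int[P]_w (g (X l w))%:E = \int[distribution P (X l)]_y (g y)%:E)%E.
  by rewrite (integral_distribution mE (ig l)).
by rewrite !e; apply: eq_measure_integral => A mA _; exact: (etrans (@dX i A mA) (esym (@dX j A mA))).
Qed.

Section orthogonal_direction.
Variables (v : 'cV[R]_p) (vt : dotv v theta = 0).

Let m2 := wmean f a (fun s => 1 - s ^+ 2) k.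
Let m4 := wmean f a (fun s => (1 - s ^+ 2) ^+ 2) k.

Let sq01 (s : R) : -1 <= s <= 1 -> 0 <= 1 - s ^+ 2 <= 1.
Proof. by move=> /andP[s1 s2]; rewrite gerBl sqr_ge0 andbT subr_ge0 expr2; nra. Qed.

Let msq : measurable_fun setT ((fun s : R => 1 - s ^+ 2) : mR -> R).
Proof. by apply: measurable_funB => //; exact: measurable_funX. Qed.

Let m2E i : \int[P]_w (1 - dotv (X i w) theta ^+ 2) = m2.
Proof. by rewrite /m2 -(@sample_dot_law i _ 1 msq sq01). Qed.

Let m4E i : \int[P]_w ((1 - dotv (X i w) theta ^+ 2) ^+ 2) = m4.
Proof.
rewrite /m4 -(@sample_dot_law i (fun s => (1 - s ^+ 2) ^+ 2) 1)//; first exact: measurable_funX.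
by move=> s /sq01/andP[s0 s1]; rewrite sqr_ge0 expr_le1.
Qed.

(** As v is orthogonal to theta, it sees only the tangential part of X, whose squared norm is 1 -
    (theta' X)^2; then Cauchy-Schwarz. *)
Let dotv_le i w : dotv v (X i w) ^+ 2 <= dotv v v * (1 - dotv (X i w) theta ^+ 2).
Proof.
have -> : dotv v (X i w) = dotv v (X i w - dotv (X i w) theta *: theta).
  by rewrite dotvBr dotvZr vt mulr0 subr0.
have -> : 1 - dotv (X i w) theta ^+ 2 =
    dotv (X i w - dotv (X i w) theta *: theta) (X i w - dotv (X i w) theta *: theta).
  by rewrite !(dotvBr, dotvBl, dotvZl, dotvZr) X1 theta1 (dotvC theta); ring.
exact: dotv_CS.
Qed.

Let mdX i : measurable_fun setT (fun w => dotv v (X i w)).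
Proof. by apply: measurable_dotv => //; exact: measurable_funP. Qed.

Let mdT i : measurable_fun setT (fun w => dotv (X i w) theta).
Proof. by apply: measurable_dotv => //; exact: measurable_funP. Qed.

(** phi is E cos(v' X). The quadratic term uses E(v' X)^2 = |v|^2 m2/(p - 1), and the remainder (v'
    X)^4/24 is at most |v|^4 (1 - (theta' X)^2)^2/24. *)
Lemma sample_cos : exists phi : R, [/\ phi <= 1,
  (forall i c, \int[P]_w cos (dotv v (X i w) + c) = cos c * phi) &
  ((0 < n)%N -> `|1 - phi - dotv v v * m2 / (2 * (p%:R - 1))| <= dotv v v ^+ 2 * m4 / 24)].
Proof.
(* An empty sample offers no observation from which to define phi; the value 1 is then a
   placeholder. *)
have [n0|n0] := posnP n.
  exists 1; split=> // i; exfalso.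
  by have := ltn_ord i; rewrite {2}n0.
pose i0 : 'I_n := Ordinal n0.
have mc : measurable_fun setT (fun x : 'cV[R]_p => cos (dotv v x)).
  by apply: (measurableT_comp measurable_cos); exact: measurable_dotvr.
have ic i : P.-integrable setT (EFin \o (fun w => cos (dotv v (X i w)))).
  apply: (integrable_le_bound _ (M := 1)) => [|w]; last exact: cos_max.
  by apply: (measurableT_comp measurable_cos); exact: mdX.
exists (\int[P]_w cos (dotv v (X i0 w))); split.
- rewrite -[leRHS](Rintegral_prob_cst P); apply: le_Rintegral => //.
  by apply: (integrable_le_bound _ (M := 1)) => // w; rewrite normr1.
- move=> i c; rewrite (rotsym_cos theta1 mF F_ge0 (@dX i) c vt).
  by rewrite (@sample_same i i0 (fun x => cos (dotv v x)) 1 mc (fun x => cos_max _)).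
move=> _.
have p1 : 0 < p%:R - 1 :> R by rewrite subr_gt0 ltr1n.
have vv0 := dotvv_ge0 v.
have i2 : P.-integrable setT (EFin \o (fun w => dotv v (X i0 w) ^+ 2)).
  apply: (integrable_le_bound _ (M := dotv v v)) => [|w]; first exact: measurable_funX.
  rewrite ger0_norm ?sqr_ge0// (le_trans (dotv_le _ _))//.
  by rewrite ler_piMr//; have /sq01/andP[] := sample_dot_le1 i0 w.
have V2 : \int[P]_w (dotv v (X i0 w) ^+ 2) = dotv v v * m2 / (p%:R - 1).
  apply: (mulfI (lt0r_neq0 p1)).
  rewrite (rotsym_sqr theta1 mF F_ge0 (X1 i0) (@dX i0) vt) m2E.
  by rewrite [RHS]mulrC divfK// gt_eqF.
have i2' := integrable_EFinZl measurableT (2^-1) i2.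
have i1 : P.-integrable setT (EFin \o (fun w => 1 : R)).
  by apply: (integrable_le_bound _ (M := 1)) => // w; rewrite normr1.
have i3 := integrable_EFinB measurableT i1 (ic i0).
have i4 := integrable_EFinB measurableT i3 i2'.
have -> : 1 - \int[P]_w cos (dotv v (X i0 w)) - dotv v v * m2 / (2 * (p%:R - 1)) =
    \int[P]_w (1 - cos (dotv v (X i0 w)) - 2^-1 * dotv v (X i0 w) ^+ 2).
  rewrite RintegralB// RintegralB// RintegralZl// V2.
  rewrite [X in _ = X - _ - _](_ : _ = 1); last exact: Rintegral_prob_cst.
  by congr (_ - _); field; rewrite gt_eqF.
rewrite (le_trans (le_normr_Rintegral measurableT i4))//.
have i5 : P.-integrable setT (EFin \o (fun w => (1 - dotv (X i0 w) theta ^+ 2) ^+ 2)).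
  apply: (integrable_le_bound _ (M := 1)) => [|w].
    by apply: measurable_funX; apply: measurable_funB => //; exact: measurable_funX.
  have /sq01/andP[s0 s1] := sample_dot_le1 i0 w.
  by rewrite ger0_norm ?sqr_ge0// expr_le1.
have -> : dotv v v ^+ 2 * m4 / 24 = \int[P]_w (dotv v v ^+ 2 / 24 * (1 - dotv (X i0 w) theta ^+ 2) ^+ 2).
  by rewrite RintegralZl// m4E; ring.
apply: le_Rintegral => //.
- exact: integrable_norm.
- exact: integrable_EFinZl.
move=> w _; rewrite mulrC; apply: le_trans (cos_taylor2 _) _.
have h := dotv_le i0 w; have /sq01/andP[s0 s1] := sample_dot_le1 i0 w.
have -> : dotv v (X i0 w) ^+ 4 = (dotv v (X i0 w) ^+ 2) ^+ 2 by rewrite -exprM.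
rewrite [leRHS]mulrAC ler_wpM2r// -exprMn lerXn2r// nnegrE ?sqr_ge0// mulr_ge0//.
Qed.

End orthogonal_direction.

Lemma sample_defect : (0 < n)%N ->
  \int[P]_w (1 - dotv theta (n%:R^-1 *: \sum_i X i w)) = wmean f a (fun s => 1 - s) k.
Proof.
move=> n0; have n0' : (n%:R : R) != 0 by rewrite pnatr_eq0 -lt0n.
have m1 : measurable_fun setT (fun s : R => 1 - s) by exact: measurable_funB.
have E i : \int[P]_w (1 - dotv (X i w) theta) = wmean f a (fun s => 1 - s) k.
  apply: (@sample_dot_law i _ 2 m1) => s /andP[s1 s2]; apply/andP; split; lra.
transitivity (\int[P]_w (n%:R^-1 * \sum_i (1 - dotv (X i w) theta))).
  apply: eq_Rintegral => w _; rewrite dotvZr dotv_sumr sumrB sumr_const card_ord mulrBr mulVf//.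
  by congr (_ - _ * _); apply: eq_bigr => i _; rewrite dotvC.
have iX i : P.-integrable setT (EFin \o (fun w => 1 - dotv (X i w) theta)).
  apply: (integrable_le_bound _ (M := 2)) => [|w].
    by apply: measurable_funB => //; apply: measurable_dotv => //; exact: measurable_funP.
  by have /andP[? ?] := sample_dot_le1 i w; rewrite ger0_norm; lra.
rewrite RintegralZl//; last first.
  by have := integrable_sum measurableT (enum 'I_n) (P := xpredT) (fun i _ => iX i); apply: eq_integrable => // w _; rewrite /= sumEFin big_enum.
rewrite Rintegral_sum//; under eq_bigr do rewrite E.
by rewrite sumr_const card_ord -[X in _ * X]mulr_natl mulKf.
Qed.

End sample.

(** * Effect of normalization on the tangential part *)

Section sphere_projection.
Context {R : realType} {p : nat} (theta : 'cV[R]_p) (theta1 : dotv theta theta = 1).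

Local Notation Pm := (1%:M - theta *m theta^T).

Lemma tangent_projE (x : 'cV[R]_p) : Pm *m x = x - dotv theta x *: theta.
Proof.
rewrite mulmxBl mul1mx -mulmxA; congr (_ - _).
have -> : theta^T *m x = (dotv theta x)%:M by rewrite /dotv [LHS]mx11_scalar.
by rewrite mul_mx_scalar.
Qed.

Lemma tangent_proj_tr : Pm^T = Pm.
Proof. by rewrite linearB /= trmx1 trmx_mul trmxK. Qed.

Lemma tangent_proj_orth (x : 'cV[R]_p) : dotv (Pm *m x) theta = 0.
Proof. by rewrite tangent_projE dotvBl dotvZl theta1 mulr1 dotvC subrr. Qed.

Lemma tangent_proj_idem (x : 'cV[R]_p) : Pm *m (Pm *m x) = Pm *m x.
Proof. by rewrite [LHS]tangent_projE dotvC tangent_proj_orth scale0r subr0. Qed.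

Section close.
Variables (x : 'cV[R]_p) (s r Q : R).
Hypotheses (s0 : 0 < s) (r1 : r <= 2^-1) (ur : 1 - dotv theta x <= r) (u1 : dotv theta x <= 1)
  (SQ : dotv (s *: (Pm *m x)) (s *: (Pm *m x)) <= Q).

Let u := dotv theta x.
Let v := Pm *m x.
Let rho := enorm x.

Let xE : x = u *: theta + v.
Proof. by rewrite /v tangent_projE addrC subrK. Qed.

Let rho2 : rho ^+ 2 = u ^+ 2 + dotv v v.
Proof.
have vt : dotv v theta = 0 by exact: tangent_proj_orth.
rewrite enorm_sqr xE !(dotvDl, dotvDr, dotvZl, dotvZr) theta1 (dotvC theta) vt; ring.
Qed.

Let uhalf : 2^-1 <= u.
Proof. by have := ur; have := r1; rewrite /u; lra. Qed.

Let v0 : 0 <= dotv v v. Proof. exact: dotvv_ge0. Qed.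

Let rhou : u <= rho.
Proof.
have r0 := enorm_ge0 x; rewrite -(@ler_sqr _ u)// ?nnegrE; last by have := uhalf; lra.
by rewrite -/rho rho2 lerDl.
Qed.

Let rho_gt0 : 0 < rho. Proof. by have := uhalf; have := rhou; lra. Qed.

Let vQ : dotv v v <= Q / s ^+ 2.
Proof.
rewrite ler_pdivlMr ?exprn_gt0//; apply: le_trans SQ.
by rewrite dotvZl dotvZr -/v le_eqVlt; apply/orP; left; apply/eqP; ring.
Qed.

Let one_rho2 : `|1 - rho ^+ 2| <= 2 * r + Q / s ^+ 2.
Proof.
rewrite rho2 ler_norml; have := vQ; have := uhalf; have := v0; have := u1; have := ur.
rewrite -/u expr2 => h1 h2 h3 h4 h5; apply/andP; split; nra.
Qed.

Let normE : normalize x = rho^-1 *: x. Proof. by []. Qed.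

(** With x = u theta + v and rho = |x|, the difference is s(1 - u/rho) theta + s v (1 - 1/rho). The
    first coefficient is of order s|v|^2, as rho - u = |v|^2/(rho + u); the second is governed by |1
    - rho^2|. *)
Lemma normalize_close i : `|theta i 0| <= 1 ->
  `|(s *: (Pm *m x)) i 0 - (s *: (normalize x - theta)) i 0| <=
  2 * Q / s + `|(s *: (Pm *m x)) i 0| * (4 * r + 2 * Q / s ^+ 2).
Proof.
move=> t1.
have e : (s *: (Pm *m x)) i 0 - (s *: (normalize x - theta)) i 0 =
    s * (1 - u / rho) * theta i 0 + (s *: v) i 0 * (1 - rho^-1).
  rewrite -/v normE xE !mxE; field.
  by rewrite gt_eqF.
rewrite e (le_trans (ler_normD _ _))// -/v lerD//.
  have h1 : 0 <= 1 - u / rho by rewrite subr_ge0 ler_pdivrMr// mul1r.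
  have h2 : 1 - u / rho <= 2 * dotv v v.
    have vE : dotv v v = (rho - u) * (rho + u) by have := rho2; lra.
    have -> : 1 - u / rho = (rho - u) / rho by field; rewrite gt_eqF.
    rewrite ler_pdivrMr// vE; have := rhou; have := uhalf => ? ?.
    have a1 : 0 <= rho - u by lra.
    have a2 : 1 <= 2 * (rho + u) * rho by nra.
    by rewrite -[leLHS]mulr1 (le_trans (ler_wpM2l a1 a2))// le_eqVlt; apply/orP; left; apply/eqP; ring.
  rewrite normrM ger0_norm ?mulr_ge0 ?(ltW s0)//.
  apply: (@le_trans _ _ (s * (1 - u / rho))).
    by rewrite ler_piMr// mulr_ge0// ltW.
  apply: (le_trans (ler_wpM2l (ltW s0) h2)).
  apply: (@le_trans _ _ (s * (2 * (Q / s ^+ 2)))).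
    by rewrite ler_wpM2l ?(ltW s0)// ler_wpM2l.
  by rewrite le_eqVlt; apply/orP; left; apply/eqP; field; rewrite gt_eqF.
rewrite normrM ler_wpM2l//.
have -> : 1 - rho^-1 = - (1 - rho) / rho by field; rewrite gt_eqF.
rewrite normrM normrN normfV (gtr0_norm rho_gt0) ler_pdivrMr//.
have h : `|1 - rho| <= `|1 - rho ^+ 2|.
  have -> : 1 - rho ^+ 2 = (1 - rho) * (1 + rho) by ring.
  rewrite normrM ler_peMr// ger0_norm; have := rho_gt0; lra.
have := one_rho2; have := rhou; have := uhalf; have n0 := normr_ge0 (1 - rho ^+ 2).
have -> : 4 * r + 2 * Q / s ^+ 2 = 2 * (2 * r + Q / s ^+ 2) by ring.
by move: (2 * r + Q / s ^+ 2) => q *; nra.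
Qed.

(** The squared sine of the angle between x and theta is |v|^2/rho^2, so only the factor 1/rho^2 has
    to be compared with 1; rho >= 1/2 accounts for the constant 4. *)
Lemma sqr_cos_close :
  `|dotv (s *: (Pm *m x)) (s *: (Pm *m x)) - s ^+ 2 * (1 - dotv theta (normalize x) ^+ 2)| <=
  4 * Q * (2 * r + Q / s ^+ 2).
Proof.
have Q0 : 0 <= Q by apply: le_trans SQ; exact: dotvv_ge0.
have e : s ^+ 2 * (1 - dotv theta (normalize x) ^+ 2) =
    dotv (s *: v) (s *: v) * (rho ^+ 2)^-1.
  rewrite normE dotvZr -/u dotvZl dotvZr exprMn exprVn.
  have -> : dotv v v = rho ^+ 2 - u ^+ 2 by rewrite rho2; ring.
  rewrite /u; by field; rewrite gt_eqF.
rewrite e -/v -{1}(mulr1 (dotv _ _)) -mulrBr normrM ger0_norm ?dotvv_ge0//.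
have -> : 1 - (rho ^+ 2)^-1 = - (1 - rho ^+ 2) / rho ^+ 2 by field; rewrite gt_eqF.
rewrite normrM normrN normfV (ger0_norm (sqr_ge0 _)).
have q4 : 4^-1 <= rho ^+ 2.
  by rewrite expr2; have := rhou; have := uhalf; nra.
have h : `|1 - rho ^+ 2| / rho ^+ 2 <= 4 * (2 * r + Q / s ^+ 2).
  rewrite ler_pdivrMr ?exprn_gt0//.
  have := one_rho2; have n0 := normr_ge0 (1 - rho ^+ 2).
  by move: (2 * r + Q / s ^+ 2) q4 => q *; nra.
rewrite (_ : 4 * Q * _ = Q * (4 * (2 * r + Q / s ^+ 2))); last by ring.
by rewrite ler_pM ?dotvv_ge0// mulr_ge0// invr_ge0 sqr_ge0.
Qed.

End close.
End sphere_projection.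

Section chi2_law.
Context {R : realType}.
Local Notation gam n := (@std_normal_cV R n).

(** |z|^2 without the first square is the squared norm of the remaining coordinates, again standard
    normal in one dimension less: the lost degree of freedom. *)
Lemma Rintegral_std_normal_tail n (g : R -> R) M : measurable_fun setT g -> (forall x, `|g x| <= M) ->
  \int[gam n.+1]_z g (dotv z z - z ord0 0 ^+ 2) = \int[gam n]_y g (dotv y y).
Proof.
move=> mg gM.
pose G (z : 'cV[R]_n.+1) := g (dotv z z - z ord0 0 ^+ 2).
have mG : measurable_fun setT G.
  apply: (measurableT_comp mg); apply: measurable_funB.
    by apply: measurable_dotv; exact: measurable_id.
  by apply: measurable_funX; exact: measurable_coord.
have mGE : measurable_fun setT (EFin \o G) by exact/measurable_EFinP.
have mGc : measurable_fun setT (G \o @cV_cons R n).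
  by apply: (measurableT_comp mG); exact: measurable_cV_cons.
have [e _] := Rfubini_prob (normal_prob (0:R) 1) (gam n) mGc (fun z => gM _).
transitivity (\int[(normal_prob (0:R) 1 \x gam n)%E]_z G (cV_cons z)).
  congr fine.
  apply: (integral_pushforward (@measurable_cV_cons R n) mGE) => //.
  rewrite preimage_setT; apply: measurable_bounded_integrable => //.
  - rewrite -[X in ((_ \x _) X < _)%E]setXTT product_measure1E//.
    rewrite [X in (X * _)%E]probability_setT mul1e.
    have gT : gam n setT = 1%E by exact: probability_setT.
    suff : (gam n setT < +oo)%E by []; by rewrite [X in (X < _)%E]gT ltry.
  - by exists M; split => [|y My x _]; [exact: num_real|rewrite /= (le_trans (gM _))// ltW].
rewrite e -[RHS](Rintegral_prob_cst (normal_prob (0:R) 1)); apply: eq_Rintegral => x _.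
apply: eq_Rintegral => y _; rewrite /= /G dotv_cV_cons mxE unlift_none/= expr2.
by rewrite addrC addKr.
Qed.

End chi2_law.

(** * The two limits *)

Section clt.
Context {R : realType} {p : nat} (theta : 'cV[R]_p) (f : R -> R) (kappa : nat -> R)
  (d : nat -> measure_display) (Omega : forall n, measurableType (d n))
  (P : forall n, probability (Omega n) R)
  (X : forall n, 'I_n -> {RV (P n) >-> 'cV[R]_p}).
Hypotheses (p_ge2 : (2 <= p)%N) (theta_sphere : sphere theta) (fF : classF f)
  (kappa_gt0 : forall n, 0 < kappa n) (kappa_cvgy : kappa @ \oo --> +oo)
  (sX : forall n, rotsym_sample theta (kappa n) f (@X n)).

Local Notation Pm := (1%:M - theta *m theta^T).
Local Notation gam := (@std_normal_cV R p).

Let theta1 : dotv theta theta = 1 := sphere_dotv theta_sphere.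
Let a : R := (p%:R - 3) / 2.
Let a1 : -1 < a := half_dim_gtN1 p_ge2.
Let l n := lam f (kappa n).
Let m2 n := wmean f a (fun s => 1 - s ^+ 2) (kappa n).
Let m4 n := wmean f a (fun s => (1 - s ^+ 2) ^+ 2) (kappa n).
Let m1 n := wmean f a (fun s => 1 - s) (kappa n).

Let near_kappa (Q : R -> Prop) : (\forall k \near +oo, Q k) -> \forall n \near \oo, Q (kappa n).
Proof. by move=> /kappa_cvgy. Qed.

Let l_ge M : \forall n \near \oo, M <= l n.
Proof.
by apply: (near_kappa (Q := fun k => M <= lam f k)); have := classF_cvgy fF => /cvgryPge/(_ M); apply.
Qed.

Let m2_cvg : l n * m2 n @[n --> \oo] --> (p%:R - 1 : R).
Proof.
have := cvg_wmean_sqr fF a1 => /(cvg_comp _ _ kappa_cvgy).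
by rewrite (_ : 2 * (a + 1) = p%:R - 1)//; rewrite /a; field.
Qed.

Let m4_bounded : exists M : R, \forall n \near \oo, l n ^+ 2 * m4 n <= M.
Proof.
have [M h] := wmean_sqr2_bounded fF a1; exists M.
exact: (near_kappa (Q := fun k => lam f k ^+ 2 * wmean f a (fun s => (1 - s ^+ 2) ^+ 2) k <= M)).
Qed.

Let m1_bounded : exists M : R, \forall n \near \oo, l n * m1 n <= M.
Proof.
have [M h] := wmean_onem_bounded fF a1; exists M.
exact: (near_kappa (Q := fun k => lam f k * wmean f a (fun s => 1 - s) k <= M)).
Qed.

Let Xbar n (w : Omega n) : 'cV[R]_p := n%:R^-1 *: \sum_i @X n i w.

Let S n (w : Omega n) : 'cV[R]_p := Num.sqrt (n%:R * l n) *: (Pm *m Xbar w).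

Let U n (w : Omega n) : R := 1 - dotv theta (Xbar w).

Let mXbar n : measurable_fun setT (@Xbar n).
Proof.
apply: measurable_scalecV => //; apply: measurable_sumcV => i.
exact: measurable_funP.
Qed.

Let mS n : measurable_fun setT (@S n).
Proof.
apply: measurable_scalecV => //.
exact: (measurableT_comp (measurable_mulmx _) (@mXbar n)).
Qed.

Let mU n : measurable_fun setT (@U n).
Proof. by apply: measurable_funB => //; apply: (measurableT_comp (measurable_dotvr theta)). Qed.

(** The weight of a single observation in [S]; n r^2 = l keeps the quadratic term of the expansion
    of order 1/n. *)
Let r n : R := Num.sqrt (n%:R * l n) / n%:R.

Let dot_S n (t : 'cV[R]_p) w : dotv t (@S n w) = \sum_i dotv (r n *: (Pm *m t)) (@X n i w).
Proof.
rewrite /S dotvZr dotv_mulmxr tangent_proj_tr /Xbar dotvZr dotv_sumr mulrA mulr_sumr.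
by apply: eq_bigr => i _; rewrite dotvZl.
Qed.

Let n_r2 n : (0 < n)%N -> 0 <= l n -> n%:R * r n ^+ 2 = l n.
Proof.
move=> n0 l0; rewrite /r exprMn (sqr_sqrtr (mulr_ge0 (ler0n _ n) l0)); field.
by rewrite pnatr_eq0 -lt0n.
Qed.

(** The expansion at r v gives n(1 - phi_n) = |v|^2 l m2 / (2(p - 1)) + O(l^2 m4 / n), which tends
    to |v|^2/2 since l m2 tends to p - 1. *)
Let cf_S t c : \int[P n]_w cos (dotv t (@S n w) + c) @[n --> \oo] -->
  cos c * expR (- (dotv (Pm *m t) (Pm *m t) / 2)).
Proof.
set v := Pm *m t.
have vt : dotv v theta = 0 by exact: tangent_proj_orth.
have vnt n : dotv (r n *: v) theta = 0 by rewrite dotvZl vt mulr0.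
have /choice[phi phiP] n := sample_cos p_ge2 theta_sphere fF (kappa_gt0 n) (@sX n) (vnt n).
have E n : \int[P n]_w cos (dotv t (@S n w) + c) = cos c * phi n ^+ n.
  have [_ h _] := phiP n.
  rewrite -(independent_sum_cos (measurable_dotvr (r n *: v)) (sample_independent (@sX n)) h c).
  by apply: eq_Rintegral => w _; rewrite dot_S.
under eq_fun do rewrite E.
apply: cvgM; first exact: cvg_cst.
apply: cvg_expn; first by move=> n; have [] := phiP n.
have [M M4] := m4_bounded.
have p1 : 0 < p%:R - 1 :> R by rewrite subr_gt0 ltr1n.
pose x n := dotv v v * (l n * m2 n) / (2 * (p%:R - 1)).
have cx : x n @[n --> \oo] --> dotv v v / 2.
  have -> : dotv v v / 2 = dotv v v * (p%:R - 1) / (2 * (p%:R - 1)) by field; rewrite gt_eqF.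
  by apply: cvgM; [apply: cvgM; [exact: cvg_cst|exact: m2_cvg]|exact: cvg_cst].
pose C := dotv v v ^+ 2 * M / 24.
have cC : C * n%:R^-1 @[n --> \oo] --> 0.
  rewrite -[X in _ --> X](mulr0 C); apply: cvgM; first exact: cvg_cst.
  by rewrite -cvg_shiftS; exact: cvg_harmonic.
have cC' : - (C * n%:R^-1) @[n --> \oo] --> 0 by rewrite -oppr0; exact: cvgN.
have cd : n%:R * (1 - phi n) - x n @[n --> \oo] --> 0.
  apply: squeeze_cvgr cC' cC; near=> n; rewrite -ler_norml.
  have n0 : (0 < n)%N by near: n; exists 1%N.
  have n0' : 0 < n%:R :> R by rewrite ltr0n.
  have l0 : 0 <= l n by near: n; exact: l_ge.
  have [_ _ /(_ n0)] := phiP n.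
  have nr := n_r2 n0 l0.
  have vv : dotv (r n *: v) (r n *: v) = l n * dotv v v / n%:R.
    by rewrite dotvZl dotvZr -nr; field; rewrite gt_eqF.
  rewrite vv => h.
  have -> : n%:R * (1 - phi n) - x n = n%:R * (1 - phi n - l n * dotv v v / n%:R * m2 n / (2 * (p%:R - 1))).
    by rewrite /x; field; rewrite !gt_eqF.
  rewrite normrM (ger0_norm (ltW n0')) (le_trans (ler_wpM2l (ltW n0') h))//.
  have -> : n%:R * ((l n * dotv v v / n%:R) ^+ 2 * m4 n / 24) = dotv v v ^+ 2 * (l n ^+ 2 * m4 n) / 24 / n%:R.
    by field; rewrite gt_eqF.
  rewrite /C !ler_wpM2r ?invr_ge0 ?(ltW n0')//.
  rewrite ler_wpM2l ?sqr_ge0//.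
  by near: n.
rewrite (_ : (fun n => n%:R * (1 - phi n)) = (fun n => (n%:R * (1 - phi n) - x n) + x n)).
  by rewrite -[X in _ --> X]add0r; exact: cvgD.
by apply/funext => n; rewrite subrK.
Unshelve. all: by end_near. Qed.

(** |A't|^2 = t'(I - theta theta')t = |Pm t|^2, so any square root [A] gives the same limit
    transform; the two statistics can thus use different roots. *)
Let cvg_S (A : 'M[R]_p) (g : 'cV[R]_p -> R) M : A *m A^T = Pm -> continuous g ->
  (forall x, `|g x| <= M) ->
  \int[P n]_w g (@S n w) @[n --> \oo] --> \int[gam]_z g (A *m z).
Proof.
move=> AP; apply: (@levy_continuity R p d Omega P S _ _ gam (fun z => A *m z)) => //.
  exact: measurable_mulmx.
move=> t c.
have -> : \int[gam]_z cos (dotv t (A *m z) + c) = cos c * expR (- (dotv (Pm *m t) (Pm *m t) / 2)).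
  transitivity (\int[gam]_z cos (dotv (A^T *m t) z + c)).
    by apply: eq_Rintegral => z _; rewrite dotv_mulmxr.
  rewrite std_normal_cV_cf; congr (_ * expR (- (_ / 2))).
  by rewrite dotv_mulmxl trmxK mulmxA AP [RHS]dotv_mulmxl tangent_proj_tr tangent_proj_idem.
exact: cf_S.
Qed.

Let U02 n w : 0 <= @U n w <= 2.
Proof.
(* At n = 0 the convention 0^-1 = 0 makes [Xbar] vanish, and U equals 1. *)
have [n0|n0] := posnP n.
  rewrite /U /Xbar (_ : n%:R = 0 :> R) ?n0// invr0 scale0r.
  by rewrite -(scale0r theta) dotvZr mul0r subr0; apply/andP; split; lra.
suff : `|dotv theta (@Xbar n w)| <= 1 by rewrite ler_norml /U => /andP[? ?]; apply/andP; split; lra.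
have n0' : 0 < n%:R :> R by rewrite ltr0n.
rewrite /Xbar dotvZr dotv_sumr normrM normfV (gtr0_norm n0') ler_pdivrMl// mulr1.
rewrite (le_trans (ler_norm_sum _ _ _))//.
apply: (@le_trans _ _ (\sum_(i < n) 1)); last by rewrite sumr_const card_ord.
apply: ler_sum => i _; rewrite dotvC ler_norml.
exact: (sample_dot_le1 theta_sphere (@sX n)).
Qed.

Let cvg_U : \int[P n]_w @U n w @[n --> \oo] --> 0.
Proof.
have [M h] := m1_bounded.
have cl : (M / l n) @[n --> \oo] --> 0.
  rewrite -[X in _ --> X](mulr0 M); apply: cvgM; first exact: cvg_cst.
  have cly : l n @[n --> \oo] --> +oo.
    by apply/cvgryPge => A; exact: l_ge.
  by apply/gtr0_cvgV0 => //; near=> n; apply: (@lt_le_trans _ _ 1) => //; near: n; exact: l_ge.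
apply: squeeze_cvgr (cvg_cst 0) cl; near=> n.
have n0 : (0 < n)%N by near: n; exists 1%N.
have l0 : 0 < l n by apply: (@lt_le_trans _ _ 1) => //; near: n; exact: l_ge.
rewrite Rintegral_ge0; last by move=> w _; have /andP[] := U02 w.
rewrite /= (sample_defect p_ge2 theta_sphere fF (kappa_gt0 n) (@sX n) n0).
by rewrite ler_pdivlMr// mulrC; near: n.
Unshelve. all: by end_near. Qed.

Let sqrt_ge M : \forall n \near \oo, M <= Num.sqrt (n%:R * l n).
Proof.
near=> n.
have n0 : (0 < n)%N by near: n; exists 1%N.
have l1 : M ^+ 2 <= l n by near: n; exact: l_ge.
have l0 : 0 <= l n by rewrite (le_trans _ l1)// sqr_ge0.
rewrite (le_trans (ler_norm _))// -sqrtr_sqr (ler_sqrt _ (mulr_ge0 (ler0n _ n) l0)).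
by rewrite (le_trans l1)// ler_peMl// ler1n.
Unshelve. all: by end_near. Qed.

Let cvg_root : (Num.sqrt (n%:R * l n))^-1 @[n --> \oo] --> 0.
Proof.
have cly : Num.sqrt (n%:R * l n) @[n --> \oo] --> +oo.
  by apply/cvgryPge => A; exact: sqrt_ge.
by apply/gtr0_cvgV0 => //; near=> n; apply: (@lt_le_trans _ _ 1) => //; near: n; exact: sqrt_ge.
Unshelve. all: by end_near. Qed.

Let cvg_root2 : (Num.sqrt (n%:R * l n))^-1 ^+ 2 @[n --> \oo] --> 0.
Proof.
rewrite -[X in _ --> X](mulr0 0); under eq_fun do rewrite expr2.
by apply: cvgM; exact: cvg_root.
Qed.

Let bounded_dotv (x : 'cV[R]_p) M : (forall i, `|x i 0| <= M) -> dotv x x <= p%:R * M ^+ 2.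
Proof.
move=> xM; rewrite dotvE -[X in X%:R](card_ord p) mulr_natl -sumr_const.
apply: ler_sum => i _; rewrite -expr2 -real_normK ?num_real//.
by rewrite lerXn2r ?nnegrE// (le_trans _ (xM i)).
Qed.

Let close_mean M e : 0 < e -> exists2 r0 : R, 0 < r0 &
  \forall n \near \oo, forall w, (forall i, `|@S n w i 0| <= M) -> @U n w <= r0 ->
    ball (@S n w) e (Num.sqrt (n%:R * l n) *: (normalize (@Xbar n w) - theta)).
Proof.
move=> e0; pose Q := p%:R * M ^+ 2.
have M1 : 0 < `|M| + 1 by rewrite ltr_wpDl.
(* 1/2 keeps theta' Xbar >= 1/2, as the geometric estimates require; the other bound makes 4 |M| r0
   at most e/4. *)
pose r0 := Num.min 2^-1 (e / (16 * (`|M| + 1))).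
exists r0; first by rewrite lt_min invr_gt0 ltr0n divr_gt0// mulr_gt0.
have c : 2 * Q * (Num.sqrt (n%:R * l n))^-1 + `|M| * (2 * Q * (Num.sqrt (n%:R * l n))^-1 ^+ 2) @[n --> \oo] --> 0.
  rewrite -[X in _ --> X]addr0; apply: cvgD.
    by rewrite -[X in _ --> X](mulr0 (2 * Q)); apply: cvgM => //; exact: cvg_cst.
  rewrite -[X in _ --> X](mulr0 `|M|); apply: cvgM; first exact: cvg_cst.
  rewrite -[X in _ --> X](mulr0 (2 * Q)); apply: cvgM; first exact: cvg_cst.
  exact: cvg_root2.
near=> n => w SM Ur.
have s1 : 1 <= Num.sqrt (n%:R * l n) by near: n; exact: sqrt_ge.
have s0 : 0 < Num.sqrt (n%:R * l n) by lra.
have h : 2 * Q * (Num.sqrt (n%:R * l n))^-1 + `|M| * (2 * Q * (Num.sqrt (n%:R * l n))^-1 ^+ 2) <= e / 2.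
  by near: n; apply: (cvgr_le _ c); rewrite divr_gt0.
have r12 : r0 <= 2^-1 by rewrite ge_min lexx.
have rM : `|M| * (4 * r0) <= e / 4.
  have : r0 <= e / (16 * (`|M| + 1)) by rewrite ge_min lexx orbT.
  rewrite ler_pdivlMr ?mulr_gt0// => h'.
  have r00 : 0 <= r0 by rewrite le_min invr_ge0 ler0n divr_ge0 ?mulr_ge0 ?(ltW e0) ?(ltW M1).
  nra.
have u1 : dotv theta (@Xbar n w) <= 1 by have /andP[u0 _] := U02 w; rewrite /U in u0; lra.
have SQ := bounded_dotv SM.
split=> // i j; rewrite ord1 /ball/=.
have t1 : `|theta i 0| <= 1.
  by rewrite (le_trans (ler_abs_enorm _ _))// theta_sphere.
apply: (le_lt_trans (normalize_close theta1 s0 r12 Ur u1 SQ t1)).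
have SiM : `|@S n w i 0| <= `|M| by rewrite (le_trans (SM i))// ler_norm.
have qs : 0 <= 4 * r0 + 2 * Q / Num.sqrt (n%:R * l n) ^+ 2.
  have r00 : 0 <= r0 by rewrite le_min invr_ge0 ler0n divr_ge0 ?mulr_ge0 ?(ltW e0) ?(ltW M1).
  have Q0 : 0 <= Q by rewrite mulr_ge0// sqr_ge0.
  by apply: addr_ge0; [exact: mulr_ge0|apply: divr_ge0; [exact: mulr_ge0|exact: sqr_ge0]].
apply: (le_lt_trans (lerD (lexx _) (ler_wpM2r qs SiM))).
move: h; rewrite exprVn mulrDr -/Q; lra.
Unshelve. all: by end_near. Qed.

Let close_cos M e : 0 < e -> exists2 r0 : R, 0 < r0 &
  \forall n \near \oo, forall w, (forall i, `|@S n w i 0| <= M) -> @U n w <= r0 ->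
    ball (dotv (@S n w) (@S n w)) e
      (Num.sqrt (n%:R * l n) ^+ 2 * (1 - dotv theta (normalize (@Xbar n w)) ^+ 2)).
Proof.
move=> e0; pose Q := p%:R * M ^+ 2.
have Q0 : 0 <= Q by rewrite mulr_ge0// sqr_ge0.
have Q1 : 0 < Q + 1 by lra.
(* The second bound makes the contribution 8 Q r0 at most e/4; Q + 1 guards against Q = 0. *)
pose r0 := Num.min 2^-1 (e / (32 * (Q + 1))).
have r0_gt0 : 0 < r0 by rewrite lt_min invr_gt0 ltr0n divr_gt0// mulr_gt0.
exists r0 => //.
have c : 4 * Q * (Q * (Num.sqrt (n%:R * l n))^-1 ^+ 2) @[n --> \oo] --> 0.
  rewrite -[X in _ --> X](mulr0 (4 * Q)); apply: cvgM; first exact: cvg_cst.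
  rewrite -[X in _ --> X](mulr0 Q); apply: cvgM; first exact: cvg_cst.
  exact: cvg_root2.
near=> n => w SM Ur.
have s1 : 1 <= Num.sqrt (n%:R * l n) by near: n; exact: sqrt_ge.
have s0 : 0 < Num.sqrt (n%:R * l n) by lra.
have h : 4 * Q * (Q * (Num.sqrt (n%:R * l n))^-1 ^+ 2) <= e / 4.
  by near: n; apply: (cvgr_le _ c); rewrite divr_gt0.
have r12 : r0 <= 2^-1 by rewrite ge_min lexx.
have rM : 4 * Q * (2 * r0) <= e / 4.
  have : r0 <= e / (32 * (Q + 1)) by rewrite ge_min lexx orbT.
  by rewrite ler_pdivlMr ?mulr_gt0// => h'; nra.
have u1 : dotv theta (@Xbar n w) <= 1 by have /andP[u0 _] := U02 w; rewrite /U in u0; lra.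
have SQ := bounded_dotv SM.
rewrite /ball/=; apply: (le_lt_trans (sqr_cos_close theta1 s0 r12 Ur u1 SQ)).
by move: h; rewrite exprVn mulrDr -/Q; lra.
Unshelve. all: by end_near. Qed.

Lemma cvg_spherical_mean (A : 'M[R]_p) (g : 'cV[R]_p -> R) M : A *m A^T = Pm ->
  continuous g -> (forall x, `|g x| <= M) ->
  \int[P n]_w g (Num.sqrt (n%:R * lam f (kappa n)) *: (spherical_mean (@X n) w - theta))
    @[n --> \oo] --> \int[gam]_z g (A *m z).
Proof.
move=> AP cg gM.
have idc : continuous (@id 'cV[R]_p) by move=> x; exact: cvg_id.
have := @slutsky R p d Omega P S U _ id
  (fun n w => Num.sqrt (n%:R * l n) *: (normalize (@Xbar n w) - theta)) _ _ gam (fun z => A *m z)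
  mS mU (measurable_mulmx A) idc (fun g M cg gM => cvg_S AP cg gM) U02 cvg_U close_mean g M cg gM.
apply=> n; apply: (measurableT_comp (measurable_continuous_cV cg)).
apply: measurable_scalecV => //; apply: measurable_subcV => //.
exact: (measurableT_comp (@measurable_normalize R p) (@mXbar n)).
Qed.

(** A second use of [slutsky], now with H the squared norm: the statistic is compared directly with
    |S|^2, not derived from the first limit. *)
Lemma cvg_sqr_cosine (A : 'M[R]_p) (g : R -> R) M : A *m A^T = Pm ->
  continuous g -> (forall x, `|g x| <= M) ->
  \int[P n]_w g (n%:R * lam f (kappa n) * (1 - dotv theta (spherical_mean (@X n) w) ^+ 2))
    @[n --> \oo] --> \int[gam]_z g (dotv (A *m z) (A *m z)).
Proof.
move=> AP cg gM.
have := @slutsky R p d Omega P S U R (fun x => dotv x x)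
  (fun n w => Num.sqrt (n%:R * l n) ^+ 2 * (1 - dotv theta (normalize (@Xbar n w)) ^+ 2))
  _ _ gam (fun z => A *m z) mS mU (measurable_mulmx A) (@dotv_continuous R p)
  (fun g M cg gM => cvg_S AP cg gM) U02 cvg_U close_cos g M cg gM.
have mY n : measurable_fun setT (g \o (fun w : Omega n =>
    Num.sqrt (n%:R * l n) ^+ 2 * (1 - dotv theta (normalize (Xbar w)) ^+ 2))).
  apply: measurableT_comp; first exact: continuous_measurable_fun.
  apply: measurable_funM => //; apply: measurable_funB => //; apply: measurable_funX.
  apply: (measurableT_comp (measurable_dotvr theta)).
  exact: (measurableT_comp (@measurable_normalize R p) (@mXbar n)).
move=> /(_ mY); apply: cvg_trans; apply: near_eq_cvg; near=> n.
have l0 : 0 <= l n by near: n; exact: l_ge.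
by apply: eq_Rintegral => w _; rewrite (sqr_sqrtr (mulr_ge0 (ler0n _ n) l0)).
Unshelve. all: by end_near. Qed.

End clt.


Section tangent_root.
Context {R : realType} {q : nat} (theta : 'cV[R]_q.+1) (theta1 : dotv theta theta = 1).

Let e1 : 'cV[R]_q.+1 := delta_mx ord0 0.

(* A reflection exchanging the first axis and theta, composed with the projection
   orthogonal to the first axis: a square root of I - theta theta' for which
   |A z|^2 visibly has the chi-square law. *)
Definition tangent_root : 'M[R]_q.+1 :=
  householder ((delta_mx ord0 0 : 'cV_q.+1) - theta) *m
  (1%:M - (delta_mx ord0 0 : 'cV_q.+1) *m (delta_mx ord0 0 : 'cV_q.+1)^T).

Let e1dot x : dotv e1 x = x ord0 0.
Proof.
rewrite dotvE (bigD1 ord0)//= mxE !eqxx mul1r big1 ?addr0// => i i0.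
by rewrite mxE (negbTE i0) mul0r.
Qed.

Let e11 : dotv e1 e1 = 1. Proof. by rewrite e1dot mxE !eqxx. Qed.

Let HH : householder (e1 - theta) *m householder (e1 - theta) = 1%:M.
Proof. by rewrite -{1}householder_tr householder_orth. Qed.

Let He1 : householder (e1 - theta) *m e1 = theta.
Proof. by apply: householder_swap; rewrite e11 theta1. Qed.

Lemma tangent_rootP : tangent_root *m tangent_root^T = 1%:M - theta *m theta^T.
Proof.
rewrite /tangent_root -/e1 trmx_mul householder_tr tangent_proj_tr.
have DD : (1%:M - e1 *m e1^T) *m (1%:M - e1 *m e1^T) = 1%:M - e1 *m e1^T.
  rewrite mulmxBl mul1mx -[X in _ - X = _]mulmxA.
  have -> : e1^T *m (1%:M - e1 *m e1^T) = 0.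
    rewrite mulmxBr mulmx1 mulmxA; have -> : e1^T *m e1 = 1%:M.
      by rewrite [LHS]mx11_scalar; congr (_%:M); exact: e11.
    by rewrite mul1mx subrr.
  by rewrite mulmx0 subr0.
move: HH He1 (householder_tr (e1 - theta)); move: (householder _) => H HH' He1' Ht.
rewrite mulmxA -(mulmxA H _ (1%:M - _)) DD mulmxBr mulmx1 mulmxBl HH' mulmxA He1'.
by rewrite -[X in _ *m X]Ht -mulmxA -trmx_mul He1'.
Qed.

Lemma tangent_root_sqr z : dotv (tangent_root *m z) (tangent_root *m z) = dotv z z - z ord0 0 ^+ 2.
Proof.
rewrite /tangent_root -/e1 -mulmxA mulmx_orth_dotv ?householder_orth//.
rewrite tangent_projE// e1dot !(dotvBl, dotvBr, dotvZl, dotvZr) e11 (dotvC z) e1dot; ring.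
Qed.

End tangent_root.

(** Passes from extended-real expectations to real integrals. Topology and sigma-algebra on T are
    linked by no axiom, so measurability of continuous functions is a premise, supplied separately
    for R^p and R. *)
Lemma cvg_in_distributionP (R : realType) (d : nat -> measure_display)
    (Omega : forall n, measurableType (d n)) (P : forall n, probability (Omega n) R)
    d' (T : measurableTopologicalType d') (Y : forall n, Omega n -> T)
    d1 (Omega1 : measurableType d1) (Q : probability Omega1 R) (Z : {mfun Omega1 >-> T}) :
  (forall g : T -> R, continuous g -> measurable_fun setT g) ->
  (forall n, measurable_fun setT (@Y n)) ->
  (forall (g : T -> R) (M : R), continuous g -> (forall x, `|g x| <= M) ->
    \int[P n]_w g (@Y n w) @[n --> \oo] --> \int[Q]_z g (Z z)) ->
  cvg_in_distribution P Y (distribution Q Z).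
Proof.
move=> mc mY h g cg [M [_ gM]].
(* [bounded_fun] provides a bound only for numbers strictly above M. *)
have gM1 x : `|g x| <= M + 1 by apply: (gM (M + 1)) => //; rewrite ltrDl.
have mg := mc _ cg.
rewrite unlock.
have E n : (\int[P n]_w ((g \o @Y n) w)%:E = (\int[P n]_w g (@Y n w))%:E)%E.
  rewrite EFin_Rintegral//; apply: (integrable_le_bound _ (M := M + 1)) => //.
  exact: measurableT_comp.
under eq_fun do rewrite E.
rewrite integral_distribution; last 2 first.
- exact/measurable_EFinP.
- apply: (integrable_le_bound _ (M := M + 1)) => [|w]; last exact: gM1.
  exact: measurableT_comp.
have -> : (\int[Q]_z ((fun y => (g y)%:E) \o Z) z)%E = (\int[Q]_z g (Z z))%:E.
  rewrite EFin_Rintegral//; apply: (integrable_le_bound _ (M := M + 1)) => [|w]; last exact: gM1.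
  exact: measurableT_comp.
by apply: cvg_EFin; [exact: nearW|exact: h cg gM1].
Qed.

Theorem theorem3p1 (R : realType) (p : nat) (theta : 'cV[R]_p) (f : R -> R)
    (kappa : nat -> R) (d : nat -> measure_display)
    (Omega : forall n, measurableType (d n))
    (P : forall n, probability (Omega n) R)
    (X : forall n, 'I_n -> {RV (P n) >-> 'cV[R]_p})
    (p_ge2 : (2 <= p)%N) (theta_sphere : sphere theta) (f_classF : classF f)
    (kappa_gt0 : forall n, 0 < kappa n) (kappa_cvgy : kappa @ \oo --> +oo)
    (X_sample : forall n, rotsym_sample theta (kappa n) f (@X n)) :
  cvg_in_distribution P
    (fun n w => Num.sqrt (n%:R * kappa n * varphi f (kappa n)) *:
       (spherical_mean (@X n) w - theta))
    (normal_cV 0 (1%:M - theta *m theta^T)) /\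
  cvg_in_distribution P
    (fun n w => n%:R * kappa n * varphi f (kappa n) *
       (1 - dotv theta (spherical_mean (@X n) w) ^+ 2))
    (chi2 p.-1).
Proof.
case: p theta X p_ge2 theta_sphere X_sample => [//|q] theta X p_ge2 theta_sphere X_sample.
have theta1 := sphere_dotv theta_sphere.
have AP := tangent_rootP theta1.
(* The limit [normal_cV] is built on an arbitrarily selected root; the explicit one shows that the
   selection is not the default 0. *)
set A := xget (0 : 'M[R]_q.+1) [set A : 'M[R]_q.+1 | A *m A^T = 1%:M - theta *m theta^T].
have AX : A *m A^T = 1%:M - theta *m theta^T.
  by apply: (@xgetPex _ 0 [set A : 'M[R]_q.+1 | A *m A^T = 1%:M - theta *m theta^T]); exists (tangent_root theta).
have mX n i : measurable_fun setT (@X n i) by exact: measurable_funP.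
have mmean n : measurable_fun setT (spherical_mean (@X n)).
  apply: (measurableT_comp (@measurable_normalize R q.+1)).
  by apply: measurable_scalecV => //; exact: measurable_sumcV.
split.
  apply: (cvg_in_distributionP (Z := affine_cV 0 A)).
  - exact: measurable_continuous_cV.
  - by move=> n; apply: measurable_scalecV => //; exact: measurable_subcV.
  move=> g M cg gM.
  have := cvg_spherical_mean p_ge2 theta_sphere f_classF kappa_gt0 kappa_cvgy X_sample AX cg gM.
  rewrite (_ : (fun n => _) = fun n => \int[P n]_w g (Num.sqrt (n%:R * kappa n * varphi f (kappa n)) *:
    (spherical_mean (@X n) w - theta))).
    have -> : (fun z => g (affine_cV 0 A z)) = fun z => g (A *m z); last by [].
    by apply/funext => z; rewrite /affine_cV add0r.
  by apply/funext => n; rewrite mulrA.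
apply: cvg_in_distributionP => /=.
- exact: continuous_measurable_fun.
- move=> n; apply: measurable_funM => //; apply: measurable_funB => //; apply: measurable_funX.
  exact: (measurableT_comp (measurable_dotvr theta)).
move=> g M cg gM.
(* Here the explicit root is used, for which |A z|^2 = |z|^2 - z_0^2 and the chi-square law with q =
   p - 1 degrees of freedom appears. *)
have := cvg_sqr_cosine p_ge2 theta_sphere f_classF kappa_gt0 kappa_cvgy X_sample AP cg gM.
have -> : (fun z => g (dotv (tangent_root theta *m z) (tangent_root theta *m z))) =
    fun z => g (dotv z z - z ord0 0 ^+ 2).
  by apply/funext => z; rewrite tangent_root_sqr.
rewrite (Rintegral_std_normal_tail q (continuous_measurable_fun cg) gM).
rewrite (_ : (fun n => _) = fun n => \int[P n]_w g (n%:R * kappa n * varphi f (kappa n) *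
  (1 - dotv theta (spherical_mean (@X n) w) ^+ 2))); first exact.
by apply/funext => n; rewrite mulrA.
Qed.
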